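(* (Multivariate Central Limit Theorem) Let $k\in\mathbb N$, $k\ge1$. Consider any sequence of $k$-tuples of admissible triples $(l_{i1},l_{i2},l_{i3})$, $i=1,\dots,k$, with $l_{i1}\le l_{i2}\le l_{i3}$ for every $i$, with $l_{11}\le l_{21}\le\dots\le l_{k1}$, and with the $k$ triples pairwise distinct, along which $l_{11}\to\infty$. Then each of the two random vectors $$\left(\frac{I_{l_{11}l_{12}l_{13}}}{\sqrt{\Delta_{l_{11}l_{12}l_{13}}}},\dots,\frac{I_{l_{k1}l_{k2}l_{k3}}}{\sqrt{\Delta_{l_{k1}l_{k2}l_{k3}}}}\right)\qquad\text{and}\qquad \left(\frac{\widehat I_{l_{11}l_{12}l_{13}}}{\sqrt{\Delta_{l_{11}l_{12}l_{13}}}},\dots,\frac{\widehat I_{l_{k1}l_{k2}l_{k3}}}{\sqrt{\Delta_{l_{k1}l_{k2}l_{k3}}}}\right)$$ converges in distribution to the Gaussian law $N(0,I_k)$, where $I_k$ is the $k\times k$ identity matrix.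
   Context: $T(\theta,\varphi)$ is a zero-mean, finite-variance, mean-square continuous, isotropic, real Gaussian random field on the unit sphere $S^2$ with spectral representation $T=\sum_{l\ge1}\sum_{m=-l}^{l}a_{lm}Y_{lm}$, where $Y_{lm}$ are the standard orthonormal spherical harmonics ($Y_{l,-m}=(-1)^m\overline{Y_{lm}}$) and $a_{lm}=\int_{S^2}T\,\overline{Y_{lm}}$. Thus the $a_{lm}$ are zero-mean, complex Gaussian, independent over $l\ge1$ and $0\le m\le l$ ($a_{l0}$ is real $N(0,C_l)$; for $m>0$ the real and imaginary parts of $a_{lm}$ are independent $N(0,C_l/2)$), $a_{l,-m}=(-1)^m\overline{a_{lm}}$, and $E|a_{lm}|^2=C_l$. The angular power spectrum satisfies $C_l>0$ for all $l$. Wigner's $3j$ symbols: $\begin{pmatrix} l_1&l_2&l_3\\ m_1&m_2&m_3\end{pmatrix}$ is the standard symbol, equal to $0$ unless $m_1+m_2+m_3=0$, $|m_i|\le l_i$ and $|l_1-l_2|\le l_3\le l_1+l_2$, and otherwise equal to $$(-1)^{l_1-l_2-m_3}\left[\frac{(l_1+l_2-l_3)!(l_1-l_2+l_3)!(-l_1+l_2+l_3)!}{(l_1+l_2+l_3+1)!}\right]^{1/2}\left[\prod_{i=1}^3(l_i+m_i)!(l_i-m_i)!\right]^{1/2}\sum_t\frac{(-1)^t}{t!(l_3-l_2+t+m_1)!(l_3-l_1+t-m_2)!(l_1+l_2-l_3-t)!(l_1-t-m_1)!(l_2-t+m_2)!},$$ the sum being over integers $t$ for which all factorial arguments are nonnegative.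 A triple $(l_1,l_2,l_3)$ of positive integers is admissible if $l_i\le l_j+l_k$ for all choices of $\{i,j,k\}=\{1,2,3\}$ and $l_1+l_2+l_3$ is even. The sample angle averaged bispectrum is $$\widehat B_{l_1l_2l_3}=\sum_{m_1=-l_1}^{l_1}\sum_{m_2=-l_2}^{l_2}\sum_{m_3=-l_3}^{l_3}\begin{pmatrix} l_1&l_2&l_3\\ m_1&m_2&m_3\end{pmatrix}a_{l_1m_1}a_{l_2m_2}a_{l_3m_3},$$ the normalized bispectrum is $I_{l_1l_2l_3}=(-1)^{(l_1+l_2+l_3)/2}\,\widehat B_{l_1l_2l_3}/\sqrt{C_{l_1}C_{l_2}C_{l_3}}$, and, with $\widehat C_l=\frac{1}{2l+1}\sum_{m=-l}^{l}|a_{lm}|^2$, its version with estimated spectrum is $\widehat I_{l_1l_2l_3}=(-1)^{(l_1+l_2+l_3)/2}\,\widehat B_{l_1l_2l_3}/\sqrt{\widehat C_{l_1}\widehat C_{l_2}\widehat C_{l_3}}$. For $l_1\le l_2\le l_3$, $\Delta_{l_1l_2l_3}=1+\delta_{l_1}^{l_2}+\delta_{l_2}^{l_3}+3\delta_{l_1}^{l_3}$ (with $\delta$ Kronecker's delta), i.e. $1$ if $l_1<l_2<l_3$, $2$ if exactly two of the indices coincide, $6$ if $l_1=l_2=l_3$. *)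

(* Defs.v *)
From HB Require Import structures.
From mathcomp Require Import all_boot all_order all_algebra.
From mathcomp Require Import all_classical all_reals all_analysis.
From mathcomp Require Import complex zify ring.
Import numFieldNormedType.Exports.

Set Implicit Arguments.
Unset Strict Implicit.
Unset Printing Implicit Defensive.

Import Order.TTheory GRing.Theory Num.Theory.
Local Open Scope classical_set_scope.
Local Open Scope complex_scope.
Local Open Scope ring_scope.

Local Notation normc := complex.ComplexField.Normc.normc.

(* Sums over m = -l, ..., l are indexed by 'I_(2 * l).+1. *)
Definition mval (l : nat) (m : 'I_(2 * l).+1) : int := m%:Z - l%:Z.

Section SphericalHarmonics.
Context {R : realType}.

Definition sphere : set 'rV[R]_3 := [set x | \sum_i (x 0 i) ^+ 2 = 1].

(* theta is the colatitude, phi the longitude *)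
Definition sph (theta phi : R) : 'rV[R]_3 :=
  \row_(i < 3) [:: sin theta * cos phi; sin theta * sin phi; cos theta]`_i.

Definition rotation (Q : 'M[R]_3) : Prop := Q *m Q^T = 1%:M /\ \det Q = 1.

(* Rodrigues' formula *)
Definition legendre (l : nat) : {poly R} :=
  ((2 ^ l * l`!)%N%:R)^-1 *: (('X^2 - 1) ^+ l)^`(l).

(* with the Condon-Shortley phase *)
Definition assoc_legendre (l m : nat) (x : R) : R :=
  (-1) ^+ m * Num.sqrt (1 - x ^+ 2) ^+ m * ((legendre l)^`(m)).[x].

Definition Ylm_nat (l m : nat) (theta phi : R) : R[i] :=
  (Num.sqrt ((2 * l + 1)%N%:R / (4 * pi) * ((l - m)`!%:R / (l + m)`!%:R))
    * assoc_legendre l m (cos theta))%:C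
  * (cos (m%:R * phi) +i* sin (m%:R * phi)).

Definition Ylm (l : nat) (m : int) (theta phi : R) : R[i] :=
  if (0 <= m)%R then Ylm_nat l `|m|%N theta phi
  else (-1) ^+ `|m|%N * (Ylm_nat l `|m|%N theta phi)^*%C.

Definition sphere_integral (f : R -> R -> R) : R :=
  \int[lebesgue_measure]_(theta in `[0, pi])
    (\int[lebesgue_measure]_(phi in `[0, pi *+ 2]) (f theta phi * sin theta)).

Definition sphere_integralC (f : R -> R -> R[i]) : R[i] :=
  sphere_integral (fun theta phi => complex.Re (f theta phi))
  +i* sphere_integral (fun theta phi => complex.Im (f theta phi)).

End SphericalHarmonics.

Section Probability.
Context d (Omega : measurableType d) (R : realType) (P : probability Omega R).

Definition has_law (X : Omega -> R) (mu : set R -> \bar R) : Prop :=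
  measurable_fun setT X /\
  forall A : set R, measurable A -> P (X @^-1` A) = mu A.

(* N(0, v); the library's [normal_prob] takes the standard deviation and is
   not the Dirac mass when it vanishes *)
Definition centered_normal (v : R) : set R -> \bar R :=
  if v == 0 then \d_(0 : R) else normal_prob 0 (Num.sqrt v).

Definition independent2 (X Y : Omega -> R) : Prop :=
  forall A B : set R, measurable A -> measurable B ->
    P (X @^-1` A `&` Y @^-1` B) = (P (X @^-1` A) * P (Y @^-1` B))%E.

Definition mutually_independent (I : eqType) (D : {pred I})
    d' (E : measurableType d') (X : I -> Omega -> E) : Prop :=
  forall (s : seq I), uniq s -> {subset s <= D} ->
  forall A : I -> set E, (forall i, measurable (A i)) ->
    P [set w | forall i, i \in s -> A i (X i w)] =
    (\prod_(i <- s) P (X i @^-1` A i))%E.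

Definition isotropic (T : 'rV[R]_3 -> Omega -> R) : Prop :=
  forall Q, rotation Q ->
  forall (n : nat) (x : 'I_n -> 'rV[R]_3), (forall i, sphere (x i)) ->
  forall A : 'I_n -> set R, (forall i, measurable (A i)) ->
    P [set w | forall i, A i (T (x i *m Q) w)] =
    P [set w | forall i, A i (T (x i) w)].

(* Only the values of T on [sphere] are relevant.  The Gaussian condition on
   linear combinations contains the zero mean and the finite variance; joint
   measurability gives a meaning to integrals of the paths. *)
Record isotropic_gaussian_field (T : 'rV[R]_3 -> Omega -> R) : Prop := {
  igf_measurable : measurable_fun setT
    (fun z : Omega * (R * R)%type => T (sph z.2.1 z.2.2) z.1) ;
  igf_gaussian : forall (n : nat) (x : 'I_n -> 'rV[R]_3) (c : 'I_n -> R),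
    (forall i, sphere (x i)) ->
    exists2 v : R, 0 <= v &
      has_law (fun w => \sum_(i < n) c i * T (x i) w) (centered_normal v) ;
  igf_continuous : forall x, sphere x ->
    (\int[P]_w ((T y w - T x w) ^+ 2)%:E)%E
      @[y --> within sphere (nbhs x)] --> 0%E ;
  igf_isotropic : isotropic T }.

Definition harmonic_coef (T : 'rV[R]_3 -> Omega -> R)
    (l : nat) (m : int) (w : Omega) : R[i] :=
  sphere_integralC (fun theta phi =>
    (T (sph theta phi) w)%:C * (Ylm l m theta phi)^*%C).

(* T is the sum over l >= 1 of its harmonic components, in mean square *)
Definition spectral_representation (T : 'rV[R]_3 -> Omega -> R) : Prop :=
  forall theta phi : R, 0 <= theta <= pi ->
    (\int[P]_w ((normc ((T (sph theta phi) w)%:C -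
       \sum_(1 <= l < L.+1) \sum_(m < (2 * l).+1)
         harmonic_coef T l (mval m) w * Ylm l (mval m) theta phi)) ^+ 2)%:E)%E
      @[L --> \oo] --> 0%E.

(* the joint law of the harmonic coefficients, with angular power spectrum C:
   the Gaussian laws below give E|a_lm|^2 = C l for all |m| <= l *)
Record gaussian_coefs (C : nat -> R) (a : nat -> int -> Omega -> R[i])
    : Prop := {
  gc_conj : forall (l m : nat) (w : Omega), (0 < l)%N -> (m <= l)%N ->
    a l (- m%:Z) w = (-1) ^+ m * (a l m%:Z w)^*%C ;
  gc_zero : forall l : nat, (0 < l)%N ->
    has_law (fun w => complex.Re (a l 0 w)) (centered_normal (C l)) ;
  gc_Re : forall l m : nat, (0 < m)%N -> (m <= l)%N ->
    has_law (fun w => complex.Re (a l m%:Z w)) (centered_normal (C l / 2)) ;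
  gc_Im : forall l m : nat, (0 < m)%N -> (m <= l)%N ->
    has_law (fun w => complex.Im (a l m%:Z w)) (centered_normal (C l / 2)) ;
  gc_Re_Im : forall l m : nat, (0 < m)%N -> (m <= l)%N ->
    independent2 (fun w => complex.Re (a l m%:Z w))
                 (fun w => complex.Im (a l m%:Z w)) ;
  gc_independent :
    mutually_independent [pred lm : nat * nat | (0 < lm.1)%N & (lm.2 <= lm.1)%N]
      (fun (lm : nat * nat) w =>
         (complex.Re (a lm.1 lm.2%:Z w), complex.Im (a lm.1 lm.2%:Z w))) }.

End Probability.

Section StandardNormal.
Context {R : realType}.

Definition tuple_cons (n : nat) (p : measurableTypeR R * n.-tuple R) : n.+1.-tuple R :=
  [tuple of p.1 :: p.2].

Lemma measurable_tuple_cons (n : nat) : measurable_fun setT (@tuple_cons n).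
Proof. exact: measurable_cons. Qed.

HB.instance Definition _ (n : nat) :=
  @isMeasurableFun.Build _ _ _ _ (@tuple_cons n) (@measurable_tuple_cons n).

(* N(0, I_k), as a k-fold product of N(0, 1) *)
Fixpoint std_normal (k : nat) : probability (k.-tuple R) R :=
  match k with
  | 0 => \d_[tuple]
  | k'.+1 => distribution ((normal_prob 0 1 : probability (measurableTypeR R) R) \x std_normal k')%E
      (@tuple_cons k')
  end.

End StandardNormal.

Definition cvg_in_distribution d (Omega : measurableType d) (R : realType)
    (P : probability Omega R) (k : nat) (X : nat -> Omega -> 'rV[R]_k)
    (mu : probability (k.-tuple R) R) : Prop :=
  forall f : 'rV[R]_k -> R, continuous f ->
    (exists M : R, forall x, `|f x| <= M) ->
    (\int[P]_w (f (X n w))%:E)%E @[n --> \oo] -->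
      (\int[mu]_t (f (\row_i tnth t i))%:E)%E.

Section Bispectrum.
Context {R : realType}.

(* only used at nonnegative arguments *)
Definition zfact (z : int) : R := (`|z|%N)`!%:R.

Definition wigner3j (l1 l2 l3 : nat) (m1 m2 m3 : int) : R :=
  if [&& m1 + m2 + m3 == 0,
         `|m1| <= l1%:Z, `|m2| <= l2%:Z, `|m3| <= l3%:Z,
         `|l1%:Z - l2%:Z| <= l3%:Z & l3%:Z <= l1%:Z + l2%:Z]
  then
    (-1) ^ (l1%:Z - l2%:Z - m3)
    * Num.sqrt (zfact (l1%:Z + l2%:Z - l3%:Z) * zfact (l1%:Z - l2%:Z + l3%:Z)
                * zfact (- l1%:Z + l2%:Z + l3%:Z)
                / zfact (l1%:Z + l2%:Z + l3%:Z + 1))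
    * Num.sqrt (zfact (l1%:Z + m1) * zfact (l1%:Z - m1)
                * (zfact (l2%:Z + m2) * zfact (l2%:Z - m2))
                * (zfact (l3%:Z + m3) * zfact (l3%:Z - m3)))
    * \sum_(t < (l1 + l2).+1 |
        [&& 0 <= l3%:Z - l2%:Z + t%:Z + m1, 0 <= l3%:Z - l1%:Z + t%:Z - m2,
            0 <= l1%:Z + l2%:Z - l3%:Z - t%:Z, 0 <= l1%:Z - t%:Z - m1
          & 0 <= l2%:Z - t%:Z + m2])
        (-1) ^+ t / (zfact t%:Z
          * zfact (l3%:Z - l2%:Z + t%:Z + m1) * zfact (l3%:Z - l1%:Z + t%:Z - m2)
          * zfact (l1%:Z + l2%:Z - l3%:Z - t%:Z) * zfact (l1%:Z - t%:Z - m1)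
          * zfact (l2%:Z - t%:Z + m2))
  else 0.

Definition admissible (l1 l2 l3 : nat) : bool :=
  [&& (0 < l1)%N, (0 < l2)%N, (0 < l3)%N,
      (l1 <= l2 + l3)%N, (l2 <= l1 + l3)%N, (l3 <= l1 + l2)%N
    & ~~ odd (l1 + l2 + l3)].

Definition Delta (l1 l2 l3 : nat) : nat :=
  (1 + (l1 == l2) + (l2 == l3) + 3 * (l1 == l3))%N.

Context {Omega : Type}.
Implicit Type a : nat -> int -> Omega -> R[i].

Definition sample_bispectrum a (l1 l2 l3 : nat) (w : Omega) : R[i] :=
  \sum_(m1 < (2 * l1).+1) \sum_(m2 < (2 * l2).+1) \sum_(m3 < (2 * l3).+1)
    (wigner3j l1 l2 l3 (mval m1) (mval m2) (mval m3))%:C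
    * a l1 (mval m1) w * a l2 (mval m2) w * a l3 (mval m3) w.

Definition sample_spectrum a (l : nat) (w : Omega) : R :=
  ((2 * l + 1)%N%:R)^-1
  * \sum_(m < (2 * l).+1) (normc (a l (mval m) w)) ^+ 2.

Definition normalized_bispectrum a (C : nat -> R) (l1 l2 l3 : nat) (w : Omega)
    : R[i] :=
  (-1) ^+ (l1 + l2 + l3)./2 * sample_bispectrum a l1 l2 l3 w
  / (Num.sqrt (C l1 * C l2 * C l3))%:C.

Definition estimated_bispectrum a (l1 l2 l3 : nat) (w : Omega) : R[i] :=
  normalized_bispectrum a (fun l => sample_spectrum a l w) l1 l2 l3 w.

End Bispectrum.

(* The bispectrum is real for even l1 + l2 + l3, so that taking real parts of
   the normalized bispectra loses nothing. *)
Section BispectrumReal.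
Context {R : realType}.

Let signE (x y : int) : ~~ odd `|x - y|%N -> (-1) ^ x = (-1) ^ y :> R.
Proof.
move=> h; rewrite -[x](subrK y) expfzDr ?oppr_eq0 ?oner_eq0//.
suff -> : (-1 : R) ^ (x - y) = 1 by rewrite mul1r.
case: (x - y) h => n /= h; rewrite /exprz -signr_odd.
  by rewrite (negbTE h) expr0.
have -> : odd n.+1 = false by apply/negbTE; move: h; lia.
by rewrite expr0 invr1.
Qed.

Lemma wigner3jN (l1 l2 l3 : nat) (m1 m2 m3 : int) : ~~ odd (l1 + l2 + l3) ->
  wigner3j l1 l2 l3 (- m1) (- m2) (- m3) = wigner3j l1 l2 l3 m1 m2 m3 :> R.
Proof.
move=> even; rewrite /wigner3j -!opprD oppr_eq0 !normrN.
case: ifP => // /and5P[/eqP m0 h1 h2 h3 /andP[h4 h5]].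
congr (_ * _ * _ * _).
- by apply: signE; lia.
- congr Num.sqrt; rewrite !opprK.
  by congr (_ * _ * _); rewrite mulrC.
- pose L := (l1 + l2 - l3)%N.
  pose h (t : 'I_(l1 + l2).+1) : 'I_(l1 + l2).+1 :=
    inord (if (t <= L)%N then L - t else t)%N.
  have hE t : h t = (if (t <= L)%N then L - t else t)%N :> nat.
    by rewrite inordK//; have := ltn_ord t; case: ifP; rewrite /L; lia.
  have hK : involutive h.
    move=> t; apply: val_inj; rewrite /= !hE.
    have [tL|Lt] := leqP t L; first by rewrite leq_subr subKn.
    by rewrite leqNgt Lt.
  rewrite (reindex_inj (inv_inj hK)) /=; apply/esym/eq_big => [t|t].
    by rewrite !hE; rewrite /L; case: ifP; lia.
  move=> /and5P[a1 a2 a3 a4 a5].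
  have tL : (t <= L)%N by rewrite /L; move: a3; lia.
  rewrite !hE tL; apply/esym; congr (_ / _).
    rewrite -signr_odd -[RHS]signr_odd; congr (_ ^+ nat_of_bool _).
    by rewrite /L; rewrite /L in tL; lia.
  have e : (L - t)%N%:Z = l1%:Z + l2%:Z - l3%:Z - t%:Z.
    by rewrite /L; rewrite /L in tL; lia.
  rewrite e.
  set x1 := zfact t%:Z; set x2 := zfact (l3%:Z - l2%:Z + t%:Z + m1).
  set x3 := zfact (l3%:Z - l1%:Z + t%:Z - m2).
  set x4 := zfact (l1%:Z + l2%:Z - l3%:Z - t%:Z).
  set x5 := zfact (l1%:Z - t%:Z - m1); set x6 := zfact (l2%:Z - t%:Z + m2).
  rewrite (_ : l3%:Z - l2%:Z + _ - m1 = l1%:Z - t%:Z - m1); last by lia.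
  rewrite (_ : l3%:Z - l1%:Z + _ - - m2 = l2%:Z - t%:Z + m2); last by lia.
  rewrite (_ : l1%:Z + l2%:Z - l3%:Z - (_ - t%:Z) = t%:Z); last by lia.
  rewrite (_ : l1%:Z - _ - - m1 = l3%:Z - l2%:Z + t%:Z + m1); last by lia.
  rewrite (_ : l2%:Z - _ - m2 = l3%:Z - l1%:Z + t%:Z - m2); last by lia.
  rewrite -/x1 -/x2 -/x3 -/x4 -/x5 -/x6.
  by ring.
Qed.


Lemma sample_bispectrum_real d (Omega : measurableType d)
    (P : probability Omega R) (C : nat -> R) (a : nat -> int -> Omega -> R[i])
    (l1 l2 l3 : nat) (w : Omega) :
  gaussian_coefs P C a -> admissible l1 l2 l3 ->
  (sample_bispectrum a l1 l2 l3 w)^*%C = sample_bispectrum a l1 l2 l3 w.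
Proof.
move=> ha /and5P[l1_gt0 l2_gt0 l3_gt0 _ /and3P[_ _ even]].
have conjE (l : nat) (m : 'I_(2 * l).+1) : (0 < l)%N ->
    (a l (mval m) w)^*%C = (-1) ^ mval m * a l (mval (rev_ord m)) w.
  move=> l_gt0; have := ltn_ord m => mlt.
  have -> : mval (rev_ord m) = - mval m by rewrite /mval /=; lia.
  have [lm|ml] := leqP l m.
    have -> : mval m = (m - l)%N%:Z by rewrite /mval; lia.
    rewrite (gc_conj ha) //; last by lia.
    by rewrite -exprnP mulrA -exprMn mulrNN mulr1 expr1n mul1r.
  have -> : mval m = - (l - m)%N%:Z by rewrite /mval; lia.
  rewrite opprK (gc_conj ha) //; last by lia.
  rewrite [in LHS]rmorphM /= (conjcK (a l _ w)); congr (_ * _).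
  rewrite -exprnN -exprVn invrN1.
  by rewrite [LHS](rmorphXn (@conjc R)) (rmorphN1 (@conjc R)).
rewrite /sample_bispectrum rmorph_sum (reindex_inj rev_ord_inj) /=.
apply: eq_bigr => m1 _; rewrite rmorph_sum (reindex_inj rev_ord_inj) /=.
apply: eq_bigr => m2 _; rewrite rmorph_sum (reindex_inj rev_ord_inj) /=.
apply: eq_bigr => m3 _; rewrite !rmorphM /= !conjE // !rev_ordK oppr0 complexr0.
have revE (l : nat) (m : 'I_(2 * l).+1) : mval (rev_ord m) = - mval m.
  by have := ltn_ord m; rewrite /mval /=; lia.
rewrite !revE wigner3jN //.
have [s0|s0] := eqVneq (mval m1 + mval m2 + mval m3) 0; last first.
  by rewrite /wigner3j (negbTE s0) /= !mul0r.
have sgn : (-1) ^ (- mval m1) * (-1) ^ (- mval m2) * (-1) ^ (- mval m3) = 1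
    :> R[i].
  rewrite -!expfzDr ?oppr_eq0 ?oner_eq0//.
  by rewrite -!opprD s0.
set x1 := (-1) ^ _ in sgn *; set x2 := (-1) ^ _ in sgn *.
set x3 := (-1) ^ _ in sgn *.
rewrite [LHS](_ : _ = (x1 * x2 * x3) * ((wigner3j l1 l2 l3 (mval m1) (mval m2) (mval m3))%:C *
  a l1 (mval m1) w * a l2 (mval m2) w * a l3 (mval m3) w)); last by ring.
by rewrite sgn mul1r.
Qed.

Lemma Im_normalized_bispectrum d (Omega : measurableType d)
    (P : probability Omega R) (C D : nat -> R)
    (a : nat -> int -> Omega -> R[i]) (l1 l2 l3 : nat) (w : Omega) :
  gaussian_coefs P C a -> admissible l1 l2 l3 ->
  complex.Im (normalized_bispectrum a D l1 l2 l3 w) = 0.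
Proof.
move=> ha hadm; have := sample_bispectrum_real w ha hadm.
rewrite /normalized_bispectrum -fmorphV /=.
case: (sample_bispectrum a l1 l2 l3 w) => x y [/eqP].
rewrite eqNr => /eqP -> /=.
rewrite -signr_odd; case: odd; rewrite ?expr1 ?expr0 ?mulN1r ?mul1r /=.
  by rewrite !(oppr0, mulr0, mul0r, addr0).
by rewrite !(mulr0, mul0r, addr0).
Qed.

End BispectrumReal.

(* Main.v *)
Require Import Defs.
From mathcomp Require Import all_boot all_order all_algebra.
From mathcomp Require Import all_classical all_reals all_analysis.
From mathcomp Require Import complex measurable_realfun zify ring lra.
Import Order.TTheory GRing.Theory Num.Theory numFieldNormedType.Exports.
Local Open Scope classical_set_scope.
Local Open Scope ring_scope.

(** Expressed in real coordinates, the coefficients a_lm of degree l are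
    sqrt (C_l) times a unitary image of 2 l + 1 independent N(0, 1) variables.
    A linear combination of the normalized bispectra is therefore a cubic form
    f(x, x, x) in independent standard normal variables x, where f is a
    symmetric tensor assembled from Wigner's 3j symbols.  Three properties of f
    make the form asymptotically normal.

    - f is trace-free: a partial trace of an invariant tensor is an invariant
      vector of positive spin, hence 0 ([invariant_trace0]).
    - 6 |f|^2 is the sum of the squared coefficients: the tensors of distinct
      sorted triples of degrees have disjoint supports, each has norm 1, and
      Delta counts the permutations that fix a triple ([trgram_symcomb]).
    - Fixing one argument of f at a vector x gives a matrix of squared norm at
      most rho |x|^2 with rho of order 1 / l, where l is the smallest degree
      ([symcomb_flat]).  This is orthogonality of the 3j symbols: by Schur's
      lemma the squared norm 1 of an invariant tensor is spread evenly over the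
      2 l + 1 values of each index ([sqnorm3_cst]).

    The 3j relations all follow from one fact: the tensor of 3j symbols is
    annihilated by the raising and lowering operators, which is a three-term
    recurrence for Racah's sum ([racah_sum_rec]).

    For a symmetric trace-free f, put Y = f(x, x, x) and
    A(s) = E cos (s Y + th).  Gaussian integration by parts gives
    A'(s) = - c s A(s) + s^2 D(s) with c = 6 |f|^2 = E Y^2, where D(s) is an
    expectation of contractions of several copies of f; two further
    integrations by parts and the Cauchy-Schwarz inequality bound it by a
    multiple of c sqrt rho.  Hence A(1) differs from exp (- c / 2) cos th by
    O(c sqrt rho) ([Ex_cos_cubic]).

    Second moments equal to 1 give tightness, so convergence of characteristic
    functions passes to bounded continuous functions ([levy_continuity]),
    through an explicit trigonometric approximation.  For the estimated
    spectrum, the ratio of estimated to true C_l is a mean of 2 l + 1 squares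
    with variance 2 / (2 l + 1), so that the two vectors differ by a factor
    tending to 1 in probability ([slutsky]). *)

Set Implicit Arguments.
Unset Strict Implicit.
Unset Printing Implicit Defensive.

(** * Racah's sum and its three-term recurrence *)

Section RacahSum.
Context {R : realType}.
Implicit Types (z m : int) (l : nat).

(** 1/z!, continued by 0 to the negative integers, so that the summation
    constraints in Racah's formula become vanishing terms. *)
Definition rfact z : R := if 0 <= z then (zfact z)^-1 else 0.

Lemma zfact_gt0 z : 0 < zfact z :> R.
Proof. by rewrite /zfact ltr0n fact_gt0. Qed.

Lemma zfactS z : 0 <= z -> zfact (z + 1) = (z + 1)%:~R * zfact z :> R.
Proof.
case: z => // n _; rewrite /zfact -PoszD addn1 /= factS natrM.
by rewrite -pmulrn.
Qed.

Lemma rfact_lt0 z : z < 0 -> rfact z = 0.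
Proof. by rewrite /rfact ltNge => /negbTE ->. Qed.

(** Valid for every integer, in particular at z = 0 where both sides vanish;
    this is what removes all case distinctions at the ends of the sum. *)
Lemma rfact_rec z : z%:~R * rfact z = rfact (z - 1).
Proof.
have [z0|z0] := ltP z 1.
  rewrite [RHS]rfact_lt0 ?subr_lt0//; have [->|zn] := eqVneq z 0.
    by rewrite mul0r.
  by rewrite rfact_lt0 ?mulr0//; lia.
have z1 : 0 <= z - 1 by lia.
rewrite /rfact z1 (_ : 0 <= z); last by lia.
have := zfactS z1; rewrite subrK => ->.
rewrite invfM mulrA divff ?mul1r//.
by rewrite intr_eq0; lia.
Qed.

Definition racah_term l1 l2 l3 m1 m2 z : R :=
  rfact z * rfact (l3%:Z - l2%:Z + z + m1) * rfact (l3%:Z - l1%:Z + z - m2)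
  * rfact (l1%:Z + l2%:Z - l3%:Z - z) * rfact (l1%:Z - z - m1)
  * rfact (l2%:Z - z + m2).

Definition racah_sum l1 l2 l3 m1 m2 : R :=
  \sum_(t < (l1 + l2).+1) (-1) ^+ t * racah_term l1 l2 l3 m1 m2 t%:Z.

Lemma racah_sumE l1 l2 l3 m1 m2 :
  \sum_(t < (l1 + l2).+1 |
        [&& 0 <= l3%:Z - l2%:Z + t%:Z + m1, 0 <= l3%:Z - l1%:Z + t%:Z - m2,
            0 <= l1%:Z + l2%:Z - l3%:Z - t%:Z, 0 <= l1%:Z - t%:Z - m1
          & 0 <= l2%:Z - t%:Z + m2])
        (-1) ^+ t / (zfact t%:Z
          * zfact (l3%:Z - l2%:Z + t%:Z + m1) * zfact (l3%:Z - l1%:Z + t%:Z - m2)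
          * zfact (l1%:Z + l2%:Z - l3%:Z - t%:Z) * zfact (l1%:Z - t%:Z - m1)
          * zfact (l2%:Z - t%:Z + m2)) = racah_sum l1 l2 l3 m1 m2.
Proof.
rewrite big_mkcond; apply: eq_bigr => t _; rewrite /racah_term /rfact /=.
case: ifP => [/and5P[-> -> -> -> ->]|]; first by rewrite !invfM !mulrA.
by do 5![case: (0 <= _) => //=]; rewrite ?(mulr0, mul0r).
Qed.

(** Each of the three prefactors is a sum of two factorial arguments of the
    general term, so each product splits in two.  The halves S1 and S2 occur on
    both sides; the other two, G and P, cancel after a shift of the summation
    index. *)
Lemma racah_sum_rec l1 l2 l3 m1 m2 :
  (l1%:Z + m1 + 1)%:~R * racah_sum l1 l2 l3 (m1 + 1) m2
  + (l2%:Z + m2 + 1)%:~R * racah_sum l1 l2 l3 m1 (m2 + 1)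
  = (l3%:Z - m1 - m2)%:~R * racah_sum l1 l2 l3 m1 m2.
Proof.
rewrite /racah_sum !mulr_sumr.
pose H z : R := rfact (l3%:Z - l2%:Z + z + m1) * rfact (l3%:Z - l1%:Z + z - m2 - 1)
  * rfact (l1%:Z + l2%:Z - l3%:Z - z) * rfact (l1%:Z - z - m1)
  * rfact (l2%:Z - z + m2 + 1).
pose G (t : nat) : R := rfact (t%:Z) * H (t%:Z + 1).
pose P (t : nat) : R := rfact (t%:Z - 1) * H t%:Z.
have shift : \sum_(t < (l1 + l2).+1) (-1) ^+ t * P t
    = - \sum_(t < (l1 + l2).+1) (-1) ^+ t * G t.
  rewrite big_ord_recl /P /= rfact_lt0 // mul0r mulr0 add0r.
  rewrite big_ord_recr /= {2}/G /H [X in (_ + _ * (_ * X))](_ : _ = 0); last first.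
    rewrite [rfact (_ - _ - (_ + 1))]rfact_lt0; last by lia.
    by rewrite !(mulr0, mul0r).
  rewrite mulr0 mulr0 addr0 -sumrN; apply: eq_bigr => t _.
  rewrite /G /bump /= add1n exprS mulN1r mulNr; congr (- (_ * (rfact _ * H _))); lia.
pose S1 (t : nat) : R := rfact t%:Z * rfact (l3%:Z - l2%:Z + t%:Z + m1)
   * rfact (l3%:Z - l1%:Z + t%:Z - m2)
  * rfact (l1%:Z + l2%:Z - l3%:Z - t%:Z) * rfact (l1%:Z - t%:Z - m1 - 1)
  * rfact (l2%:Z - t%:Z + m2).
pose S2 (t : nat) : R := rfact t%:Z * rfact (l3%:Z - l2%:Z + t%:Z + m1)
   * rfact (l3%:Z - l1%:Z + t%:Z - m2 - 1)
  * rfact (l1%:Z + l2%:Z - l3%:Z - t%:Z) * rfact (l1%:Z - t%:Z - m1)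
  * rfact (l2%:Z - t%:Z + m2).
have E1 (t : nat) : (l1%:Z + m1 + 1)%:~R * racah_term l1 l2 l3 (m1 + 1) m2 t%:Z
    = S1 t + G t.
  rewrite (_ : l1%:Z + m1 + 1 = (l3%:Z - l2%:Z + t%:Z + (m1 + 1))
       + (l1%:Z + l2%:Z - l3%:Z - t%:Z)); last by lia.
  rewrite intrD mulrDl /racah_term /S1 /G /H.
  set x := _ + (m1 + 1); set y := l1%:Z + l2%:Z - l3%:Z - t%:Z.
  have -> : l3%:Z - l2%:Z + t%:Z + m1 = x - 1 by rewrite /x; lia.
  have -> : l1%:Z + l2%:Z - l3%:Z - (t%:Z + 1) = y - 1 by rewrite /y; lia.
  rewrite -(rfact_rec x) -(rfact_rec y).
  have -> : l1%:Z - t%:Z - m1 - 1 = l1%:Z - t%:Z - (m1 + 1) by lia.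
  have -> : l3%:Z - l2%:Z + (t%:Z + 1) + m1 = x by rewrite /x; lia.
  have -> : l3%:Z - l1%:Z + (t%:Z + 1) - m2 - 1 = l3%:Z - l1%:Z + t%:Z - m2 by lia.
  have -> : l1%:Z - (t%:Z + 1) - m1 = l1%:Z - t%:Z - (m1 + 1) by lia.
  have -> : l2%:Z - (t%:Z + 1) + m2 + 1 = l2%:Z - t%:Z + m2 by lia.
  by ring.
have E2 (t : nat) : (l2%:Z + m2 + 1)%:~R * racah_term l1 l2 l3 m1 (m2 + 1) t%:Z
    = S2 t + P t.
  rewrite (_ : l2%:Z + m2 + 1 = (l2%:Z - t%:Z + (m2 + 1)) + t%:Z); last by lia.
  rewrite intrD mulrDl /racah_term /S2 /P /H.
  set x := l2%:Z - _ + _.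
  have -> : l2%:Z - t%:Z + m2 = x - 1 by rewrite /x; lia.
  have -> : x - 1 + 1 = x by rewrite subrK.
  rewrite -(rfact_rec x) -(rfact_rec t%:Z).
  have -> : l3%:Z - l1%:Z + t%:Z - (m2 + 1) = l3%:Z - l1%:Z + t%:Z - m2 - 1 by lia.
  by ring.
have E3 (t : nat) : (l3%:Z - m1 - m2)%:~R * racah_term l1 l2 l3 m1 m2 t%:Z
    = S1 t + S2 t.
  rewrite (_ : l3%:Z - m1 - m2 = (l1%:Z - t%:Z - m1) + (l3%:Z - l1%:Z + t%:Z - m2));
    last by lia.
  rewrite intrD mulrDl /racah_term /S1 /S2 -!rfact_rec.
  by ring.
under eq_bigr do rewrite mulrCA E1 mulrDr.
rewrite big_split /=.
under [X in _ + X]eq_bigr do rewrite mulrCA E2 mulrDr.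
rewrite [X in _ + X]big_split /= shift.
under [RHS]eq_bigr do rewrite mulrCA E3 mulrDr.
by rewrite big_split /=; ring.
Qed.

(** The coefficient of the raising operator of spin l from level m to m + 1. *)
Definition lad l m : R := Num.sqrt ((l%:Z - m) * (l%:Z + m + 1))%:~R.

Lemma lad_top l : lad l l%:Z = 0.
Proof. by rewrite /lad subrr mul0r sqrtr0. Qed.

Lemma lad_bot l : lad l (- l%:Z - 1) = 0.
Proof. by rewrite /lad (_ : _ * _ = 0) ?sqrtr0//; lia. Qed.

Lemma ladN l m : lad l (- m) = lad l (m - 1).
Proof. by rewrite /lad; congr (Num.sqrt _%:~R); lia. Qed.

Lemma lad_gt0 l m : - l%:Z <= m -> m < l%:Z -> 0 < lad l m.
Proof. by move=> h1 h2; rewrite sqrtr_gt0 ltr0z mulr_gt0//; lia. Qed.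

(** The factor contributed by one pair (l, m) to the second square root of the
    3j symbol. *)
Definition mfact l m : R := Num.sqrt (zfact (l%:Z + m) * zfact (l%:Z - m)).

(** The square roots in the 3j symbol absorb the ladder coefficient and leave an
    integer factor, the one of racah_sum_rec. *)
Lemma mfact_rec l m : `|m| <= l%:Z -> m < l%:Z ->
  lad l m * mfact l (m + 1) = (l%:Z + m + 1)%:~R * mfact l m.
Proof.
move=> h1 h2; rewrite /lad /mfact.
have p0 : 0 <= (l%:Z + m + 1)%:~R :> R by rewrite ler0z; lia.
rewrite -(ger0_norm p0) -sqrtr_sqr -!sqrtrM ?sqr_ge0//; last first.
  by rewrite ler0z mulr_ge0//; lia.
congr Num.sqrt.
have -> : l%:Z + (m + 1) = l%:Z + m + 1 by lia.
have e : l%:Z - m = (l%:Z - (m + 1)) + 1 by lia.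
rewrite zfactS; last by lia.
rewrite {2}e zfactS; last by lia.
rewrite -e intrM; ring.
Qed.

(** The first square root of the 3j symbol. *)
Definition wnorm l1 l2 l3 : R := Num.sqrt (zfact (l1%:Z + l2%:Z - l3%:Z) * zfact (l1%:Z - l2%:Z + l3%:Z)
                * zfact (- l1%:Z + l2%:Z + l3%:Z)
                / zfact (l1%:Z + l2%:Z + l3%:Z + 1)).

Definition triangle l1 l2 l3 : bool :=
  [&& (l1 <= l2 + l3)%N, (l2 <= l1 + l3)%N & (l3 <= l1 + l2)%N].

Lemma wigner3jE l1 l2 l3 m1 m2 m3 : triangle l1 l2 l3 ->
  `|m1| <= l1%:Z -> `|m2| <= l2%:Z -> `|m3| <= l3%:Z -> m1 + m2 + m3 = 0 ->
  wigner3j l1 l2 l3 m1 m2 m3 = (-1) ^ (l1%:Z - l2%:Z - m3) * wnorm l1 l2 l3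
    * (mfact l1 m1 * mfact l2 m2 * mfact l3 m3) * racah_sum l1 l2 l3 m1 m2 :> R.
Proof.
move=> /and3P[t1 t2 t3] h1 h2 h3 h0; rewrite /wigner3j ifT; last first.
  rewrite h1 h2 h3 h0 eqxx /=; lia.
rewrite racah_sumE /mfact; congr (_ * _ * _ * _).
by rewrite !sqrtrM ?mulr_ge0 ?ltW ?zfact_gt0// ?mulrA.
Qed.

Lemma wigner3j_0 l1 l2 l3 m1 m2 m3 :
  ~~ [&& m1 + m2 + m3 == 0, `|m1| <= l1%:Z, `|m2| <= l2%:Z & `|m3| <= l3%:Z] ->
  wigner3j l1 l2 l3 m1 m2 m3 = 0 :> R.
Proof.
rewrite /wigner3j; case: ifP => // /and5P[-> -> -> ->]//.
Qed.

End RacahSum.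

(** * Tensors annihilated by the ladder operators *)

Section MSum.
Context {V : nmodType}.
Implicit Types (l : nat) (F : int -> V).

(** Sums over m = -l, ..., l in which m is an integer and can be negated or
    shifted. *)
Definition zsum l F : V := \sum_(i < (2 * l).+1) F (mval i).

Lemma mval_range l (i : 'I_(2 * l).+1) : `|mval i| <= l%:Z.
Proof. by have := ltn_ord i; rewrite /mval; lia. Qed.

Lemma eq_zsum l F G : (forall m, `|m| <= l%:Z -> F m = G m) ->
  zsum l F = zsum l G.
Proof. by move=> h; apply: eq_bigr => i _; apply/h/mval_range. Qed.

Lemma zsumN l F : zsum l (fun m => F (- m)) = zsum l F.
Proof.
rewrite /zsum (reindex_inj rev_ord_inj) /=; apply: eq_bigr => i _.
by congr F; have := ltn_ord i; rewrite /mval /=; lia.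
Qed.

Lemma zsum0 l : zsum l (fun=> 0) = 0.
Proof. by rewrite /zsum big1. Qed.

Lemma zsumD l F G : zsum l (fun m => F m + G m) = zsum l F + zsum l G.
Proof. by rewrite /zsum big_split. Qed.

Lemma exchange_zsum l1 l2 (F : int -> int -> V) :
  zsum l1 (fun m1 => zsum l2 (F m1)) = zsum l2 (fun m2 => zsum l1 (F ^~ m2)).
Proof. exact: exchange_big. Qed.

Lemma zsum1 l (m : int) F : `|m| <= l%:Z ->
  (forall m', m' != m -> F m' = 0) -> zsum l F = F m.
Proof.
move=> hm h0; have hlt : (`|(m + l%:Z)%R|%N < (2 * l).+1)%N by lia.
have e : mval (Ordinal hlt) = m by rewrite /mval /=; lia.
rewrite /zsum (bigD1 (Ordinal hlt)) //= e big1 ?addr0// => i ni.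
apply: h0; apply: contra ni => /eqP im; apply/eqP/val_inj => /=.
by rewrite /mval in im; lia.
Qed.

Lemma zsum_cst l (c : V) : zsum l (fun=> c) = c *+ (2 * l).+1.
Proof. by rewrite /zsum sumr_const card_ord. Qed.

End MSum.

Section Invariant.
Context {R : realType}.
Implicit Types (z m : int) (l : nat) (w u : int -> int -> int -> R).

Lemma mulr_zsumr l (x : R) (F : int -> R) :
  x * zsum l F = zsum l (fun m => x * F m).
Proof. by rewrite /zsum mulr_sumr. Qed.

(** Summation by parts; the ladder coefficient vanishes at both ends. *)
Lemma zsum_lad l (F : int -> R) :
  zsum l (fun m => lad l m * F m) = zsum l (fun m => lad l (m - 1) * F (m - 1)).
Proof.
rewrite /zsum big_ord_recr big_ord_recl /=.
have -> : mval (ord_max : 'I_(2 * l).+1) = l%:Z by rewrite /mval /=; lia.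
have -> : mval (ord0 : 'I_(2 * l).+1) - 1 = - l%:Z - 1 by rewrite /mval /=; lia.
rewrite lad_top lad_bot !mul0r addr0 add0r; apply: eq_bigr => i _.
have -> : mval (lift ord0 i) - 1 = mval (widen_ord (leqnSn (2 * l)) i).
  by rewrite /mval lift0 /=; lia.
by [].
Qed.

(** The raising and the lowering operators, acting on the three indices at once,
    annihilate w: it has total angular momentum 0. *)
Record su2_invariant l1 l2 l3 w : Prop := {
  inv_supp : forall m1 m2 m3,
    ~~ [&& m1 + m2 + m3 == 0, `|m1| <= l1%:Z, `|m2| <= l2%:Z & `|m3| <= l3%:Z] ->
    w m1 m2 m3 = 0 ;
  inv_up : forall m1 m2 m3,
    `|m1| <= l1%:Z -> `|m2| <= l2%:Z -> `|m3| <= l3%:Z -> m1 + m2 + m3 = -1 ->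
    lad l1 m1 * w (m1 + 1) m2 m3 + lad l2 m2 * w m1 (m2 + 1) m3
      + lad l3 m3 * w m1 m2 (m3 + 1) = 0 ;
  inv_dn : forall m1 m2 m3,
    `|m1| <= l1%:Z -> `|m2| <= l2%:Z -> `|m3| <= l3%:Z -> m1 + m2 + m3 = 1 ->
    lad l1 (m1 - 1) * w (m1 - 1) m2 m3 + lad l2 (m2 - 1) * w m1 (m2 - 1) m3
      + lad l3 (m3 - 1) * w m1 m2 (m3 - 1) = 0 }.

Lemma invariant12 l1 l2 l3 w : su2_invariant l1 l2 l3 w ->
  su2_invariant l2 l1 l3 (fun a b c => w b a c).
Proof.
move=> h; split=> [m1 m2 m3 hm|m1 m2 m3 h1 h2 h3 s|m1 m2 m3 h1 h2 h3 s].
- by apply: (inv_supp h); move: hm; lia.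
- by rewrite [X in X + _]addrC; apply: (inv_up h) => //; lia.
- by rewrite [X in X + _]addrC; apply: (inv_dn h) => //; lia.
Qed.

Lemma invariant23 l1 l2 l3 w : su2_invariant l1 l2 l3 w ->
  su2_invariant l1 l3 l2 (fun a b c => w a c b).
Proof.
move=> h; split=> [m1 m2 m3 hm|m1 m2 m3 h1 h2 h3 s|m1 m2 m3 h1 h2 h3 s].
- by apply: (inv_supp h); move: hm; lia.
- by rewrite addrAC; apply: (inv_up h) => //; lia.
- by rewrite addrAC; apply: (inv_dn h) => //; lia.
Qed.

Lemma invariantB l1 l2 l3 w u : su2_invariant l1 l2 l3 w -> su2_invariant l1 l2 l3 u ->
  su2_invariant l1 l2 l3 (fun a b c => w a b c - u a b c).
Proof.
move=> h k; split=> [m1 m2 m3 hm|m1 m2 m3 h1 h2 h3 s|m1 m2 m3 h1 h2 h3 s].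
- by rewrite (inv_supp h)// (inv_supp k)// subrr.
- by rewrite !mulrBr -[RHS](subrr 0) -{1}(inv_up h h1 h2 h3 s)
    -(inv_up k h1 h2 h3 s); ring.
- by rewrite !mulrBr -[RHS](subrr 0) -{1}(inv_dn h h1 h2 h3 s)
    -(inv_dn k h1 h2 h3 s); ring.
Qed.

Lemma inv_sum0 l1 l2 l3 w m1 m2 m3 : su2_invariant l1 l2 l3 w ->
  m1 + m2 + m3 != 0 -> w m1 m2 m3 = 0.
Proof. by move=> h s; apply: (inv_supp h); rewrite (negbTE s). Qed.

Definition sqnorm3 l1 l2 w m3 : R :=
  zsum l1 (fun m1 => zsum l2 (fun m2 => w m1 m2 m3 ^+ 2)).

(** Schur's lemma in coordinates.  The raising relation paired with level m + 1
    and the lowering relation paired with level m express the two norms through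
    the same cross terms up1 and up2. *)
Lemma sqnorm3_step l1 l2 l3 w m : su2_invariant l1 l2 l3 w ->
  - l3%:Z <= m -> m < l3%:Z -> sqnorm3 l1 l2 w (m + 1) = sqnorm3 l1 l2 w m.
Proof.
move=> h mlo mhi; have lad0 := lad_gt0 (R := R) mlo mhi.
apply: (mulfI (lt0r_neq0 lad0)).
pose up1 := zsum l1 (fun m1 => zsum l2 (fun m2 =>
  lad l1 m1 * (w m1 m2 (m + 1) * w (m1 + 1) m2 m))).
pose up2 := zsum l1 (fun m1 => zsum l2 (fun m2 =>
  lad l2 m2 * (w m1 m2 (m + 1) * w m1 (m2 + 1) m))).
transitivity (- (up1 + up2)); last first.
  transitivity (- (zsum l1 (fun m1 => zsum l2 (fun m2 =>
      lad l1 (m1 - 1) * (w (m1 - 1) m2 (m + 1) * w m1 m2 m))) +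
      zsum l1 (fun m1 => zsum l2 (fun m2 =>
      lad l2 (m2 - 1) * (w m1 (m2 - 1) (m + 1) * w m1 m2 m))))).
    congr (- (_ + _)).
      rewrite /up1 [LHS]exchange_zsum [RHS]exchange_zsum.
      apply: eq_zsum => m2 _.
      rewrite (zsum_lad l1 (fun m1 => w m1 m2 (m + 1) * w (m1 + 1) m2 m)).
      by apply: eq_zsum => m1 _; rewrite subrK.
    apply: eq_zsum => m1 _.
    rewrite (zsum_lad l2 (fun m2 => w m1 m2 (m + 1) * w m1 (m2 + 1) m)).
    by apply: eq_zsum => m2 _; rewrite subrK.
  apply/eqP; rewrite eq_sym -subr_eq0 opprK -zsumD /sqnorm3 mulr_zsumr -zsumD.
  apply/eqP; rewrite -[RHS](zsum0 l1); apply: eq_zsum => m1 h1.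
  rewrite -zsumD mulr_zsumr -zsumD -[RHS](zsum0 l2); apply: eq_zsum => m2 h2.
  have [s|s] := eqVneq (m1 + m2 + m) 0; last first.
    by rewrite (inv_sum0 h s) !(mulr0, mul0r, expr0n, addr0).
  have := inv_dn h h1 h2 (_ : `|m + 1| <= l3%:Z) _; rewrite addrK.
  by move=> /(_ ltac:(lia) ltac:(lia)) /(congr1 (fun x => w m1 m2 m * x));
    rewrite mulr0 => <-; ring.
apply/eqP; rewrite -subr_eq0 opprK -zsumD /sqnorm3 mulr_zsumr -zsumD.
apply/eqP; rewrite -[RHS](zsum0 l1); apply: eq_zsum => m1 h1.
rewrite -zsumD mulr_zsumr -zsumD -[RHS](zsum0 l2); apply: eq_zsum => m2 h2.
have [s|s] := eqVneq (m1 + m2 + (m + 1)) 0; last first.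
  by rewrite (inv_sum0 h s) !(mulr0, mul0r, expr0n, addr0).
have := inv_up h h1 h2 (_ : `|m| <= l3%:Z) _.
by move=> /(_ ltac:(lia) ltac:(lia)) /(congr1 (fun x => w m1 m2 (m + 1) * x));
  rewrite mulr0 => <-; ring.
Qed.

Lemma sqnorm3_cst l1 l2 l3 w m : su2_invariant l1 l2 l3 w -> `|m| <= l3%:Z ->
  sqnorm3 l1 l2 w m = sqnorm3 l1 l2 w l3%:Z.
Proof.
move=> h hm; have [n e] : exists n : nat, m = l3%:Z - n%:Z.
  by exists `|(l3%:Z - m)%R|%N; lia.
rewrite e in hm *; clear e.
have {hm} : (n <= 2 * l3)%N by lia.
elim: n => [|n IH] hn; first by rewrite subr0.
rewrite -IH; last by lia.
have -> : l3%:Z - n%:Z = l3%:Z - n.+1%:Z + 1 by lia.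
by rewrite (sqnorm3_step h)//; lia.
Qed.

Lemma sqnorm3_total l1 l2 l3 w m : su2_invariant l1 l2 l3 w -> `|m| <= l3%:Z ->
  zsum l1 (fun m1 => zsum l2 (fun m2 => zsum l3 (fun m3 => w m1 m2 m3 ^+ 2)))
  = (2 * l3).+1%:R * sqnorm3 l1 l2 w m.
Proof.
move=> h hm.
transitivity (zsum l3 (fun m3 => sqnorm3 l1 l2 w m3)).
  rewrite /sqnorm3 [RHS]exchange_zsum; apply: eq_zsum => m1 _.
  by rewrite exchange_zsum.
transitivity (zsum l3 (fun=> sqnorm3 l1 l2 w l3%:Z)).
  by apply: eq_zsum => m3 h3; rewrite (sqnorm3_cst h).
by rewrite zsum_cst (sqnorm3_cst h hm) mulr_natl.
Qed.

(** The lowering relation computes level m3 from level m3 + 1, so an invariant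
    tensor is determined by its top level. *)
Lemma invariant_top0 l1 l2 l3 u : su2_invariant l1 l2 l3 u ->
  (forall m1 m2, `|m1| <= l1%:Z -> `|m2| <= l2%:Z -> m1 + m2 + l3%:Z = 0 ->
     u m1 m2 l3%:Z = 0) ->
  forall m1 m2 m3, u m1 m2 m3 = 0.
Proof.
move=> h top m1 m2 m3.
case: (boolP [&& m1 + m2 + m3 == 0, `|m1| <= l1%:Z, `|m2| <= l2%:Z & `|m3| <= l3%:Z]);
  last exact: inv_supp h _ _ _.
move=> /and4P[/eqP s h1 h2 h3].
have [n e] : exists n : nat, m3 = l3%:Z - n%:Z by exists `|(l3%:Z - m3)%R|%N; lia.
elim: n m1 m2 m3 e s h1 h2 h3 => [|n IH] m1 m2 m3 e s h1 h2 h3.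
  by rewrite e subr0 top//; lia.
have IH' m1' m2' : m1' + m2' + (m3 + 1) = 0 -> u m1' m2' (m3 + 1) = 0.
  move=> s'; case: (boolP [&& m1' + m2' + (m3 + 1) == 0, `|m1'| <= l1%:Z,
      `|m2'| <= l2%:Z & `|m3 + 1| <= l3%:Z]); last exact: inv_supp h _ _ _.
  by move=> /and4P[_ k1 k2 k3]; apply: IH => //; lia.
have := inv_dn h h1 h2 (_ : `|m3 + 1| <= l3%:Z) _; rewrite addrK.
move=> /(_ ltac:(lia) ltac:(lia)).
rewrite !IH' ?mulr0 ?addr0 ?add0r; [|lia..].
move=> /eqP; rewrite mulf_eq0 => /orP[/eqP l0|/eqP//].
by have := @lad_gt0 R l3 m3; rewrite l0 ltxx => /(_ ltac:(lia) ltac:(lia)).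
Qed.

(** The trace is an invariant vector of spin l3 > 0, hence zero.  Only m3 = 0
    needs an argument: the raising relation at m3 = -1 expresses the trace by two
    sums that are opposite to each other after a shift. *)
Lemma invariant_trace0 l l3 w : (0 < l3)%N -> su2_invariant l l l3 w ->
  forall m3, zsum l (fun m => (-1) ^ m * w m (- m) m3) = 0.
Proof.
move=> l3_gt0 h m3; have [->|m30] := eqVneq m3 0; last first.
  rewrite -[RHS](zsum0 l); apply: eq_zsum => m _.
  by rewrite (inv_sum0 h) ?mulr0//; lia.
apply/eqP; rewrite -(inj_eq (mulfI (lt0r_neq0 (@lad_gt0 R l3 (-1) _ _))));
  [|lia|lia].
rewrite mulr0 mulr_zsumr.
pose F1 m := (-1) ^ m * (lad l m * w (m + 1) (- m) (-1)) : R.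
pose F2 m := (-1) ^ m * (lad l (- m) * w m (- m + 1) (-1)) : R.
have -> : zsum l (fun m => lad l3 (-1) * ((-1) ^ m * w m (- m) 0))
    = - (zsum l F1 + zsum l F2).
  apply/eqP; rewrite -subr_eq0 opprK -!zsumD -[X in _ == X](zsum0 l).
  apply/eqP/eq_zsum => m hm.
  have := inv_up h hm (_ : `|- m| <= l%:Z) (_ : `|-1| <= l3%:Z) _.
  rewrite addNr => /(_ ltac:(lia) ltac:(lia) ltac:(lia))
    /(congr1 (fun x => (-1) ^ m * x)).
  by rewrite mulr0 => <-; rewrite /F1 /F2; ring.
have -> : zsum l F1 = - zsum l F2.
  transitivity (zsum l (fun m => lad l m * ((-1) ^ m * w (m + 1) (- m) (-1)))).
    by apply: eq_zsum => m _; rewrite /F1; ring.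
  rewrite zsum_lad /zsum -sumrN; apply: eq_bigr => i _.
  set m := mval i; rewrite /F2 ladN subrK.
  have -> : - (m - 1) = - m + 1 by ring.
  have -> : (-1 : R) ^ m = - (-1) ^ (m - 1).
    by rewrite -{1}[m](subrK 1) expfzDr ?oppr_eq0 ?oner_eq0// expr1z mulrN1.
  by ring.
by rewrite addNr oppr0.
Qed.

End Invariant.

(** * The 3j symbols as an invariant tensor *)

Section Wigner.
Context {R : realType}.
Implicit Types (z m : int) (l : nat).

Local Lemma signz_congr (x y : int) : ~~ odd `|x - y|%N ->
  (-1) ^ x = (-1) ^ y :> R.
Proof.
move=> h; rewrite -[x](subrK y) expfzDr ?oppr_eq0 ?oner_eq0//.
suff -> : (-1 : R) ^ (x - y) = 1 by rewrite mul1r.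
case: (x - y) h => n /= h; rewrite /exprz -signr_odd.
  by rewrite (negbTE h) expr0.
have -> : odd n.+1 = false by apply/negbTE; move: h; lia.
by rewrite expr0 invr1.
Qed.

Lemma racah_sum_m1_gt l1 l2 l3 m2 : racah_sum l1 l2 l3 (l1%:Z + 1) m2 = 0 :> R.
Proof.
rewrite /racah_sum big1// => t _; rewrite /racah_term.
by rewrite [rfact (l1%:Z - t%:Z - _)]rfact_lt0 ?(mulr0, mul0r)//; lia.
Qed.

Lemma racah_sum_m2_gt l1 l2 l3 m1 : racah_sum l1 l2 l3 m1 (l2%:Z + 1) = 0 :> R.
Proof.
rewrite /racah_sum big1// => t _; rewrite /racah_term.
case: (ltP (l1%:Z + l2%:Z - l3%:Z - t%:Z) 0) => ht.
  by rewrite [rfact (_ + _ - _ - t%:Z)]rfact_lt0 ?(mulr0, mul0r)//; lia.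
by rewrite [rfact (_ - _ + t%:Z - _)]rfact_lt0 ?(mulr0, mul0r)//; lia.
Qed.

Lemma racah_sum_m3_gt l1 l2 l3 m1 m2 : l3%:Z + m1 + m2 < 0 ->
  racah_sum l1 l2 l3 m1 m2 = 0 :> R.
Proof.
move=> h; rewrite /racah_sum big1// => t _; rewrite /racah_term.
case: (ltP (l2%:Z - t%:Z + m2) 0) => ht.
  by rewrite [rfact (_ - t%:Z + m2)]rfact_lt0 ?(mulr0, mul0r)//; lia.
by rewrite [rfact (_ + t%:Z + m1)]rfact_lt0 ?(mulr0, mul0r)//; lia.
Qed.

(** By mfact_rec, the three terms are those of racah_sum_rec times a common
    factor. *)
Lemma wigner3j_up l1 l2 l3 m1 m2 m3 : triangle l1 l2 l3 ->
  `|m1| <= l1%:Z -> `|m2| <= l2%:Z -> `|m3| <= l3%:Z -> m1 + m2 + m3 = -1 ->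
  lad l1 m1 * wigner3j l1 l2 l3 (m1 + 1) m2 m3
  + lad l2 m2 * wigner3j l1 l2 l3 m1 (m2 + 1) m3
  + lad l3 m3 * wigner3j l1 l2 l3 m1 m2 (m3 + 1) = 0 :> R.
Proof.
move=> tr h1 h2 h3 s.
pose c : R := (-1) ^ (l1%:Z - l2%:Z - m3) * wnorm l1 l2 l3
    * (mfact l1 m1 * mfact l2 m2 * mfact l3 m3).
have -> : lad l1 m1 * wigner3j l1 l2 l3 (m1 + 1) m2 m3
    = c * ((l1%:Z + m1 + 1)%:~R * racah_sum l1 l2 l3 (m1 + 1) m2).
  have [lt|ge] := ltP m1 l1%:Z.
    rewrite wigner3jE; [|by []|lia|lia|lia|lia].
    transitivity ((-1) ^ (l1%:Z - l2%:Z - m3) * wnorm l1 l2 l3 *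
       ((lad l1 m1 * mfact l1 (m1 + 1)) * mfact l2 m2 * mfact l3 m3)
        * racah_sum l1 l2 l3 (m1 + 1) m2 : R); first by ring.
    by rewrite mfact_rec// /c; ring.
  have -> : m1 = l1%:Z by lia.
  by rewrite lad_top racah_sum_m1_gt mul0r !mulr0.
have -> : lad l2 m2 * wigner3j l1 l2 l3 m1 (m2 + 1) m3
    = c * ((l2%:Z + m2 + 1)%:~R * racah_sum l1 l2 l3 m1 (m2 + 1)).
  have [lt|ge] := ltP m2 l2%:Z.
    rewrite wigner3jE; [|by []|lia|lia|lia|lia].
    transitivity ((-1) ^ (l1%:Z - l2%:Z - m3) * wnorm l1 l2 l3 *
       (mfact l1 m1 * (lad l2 m2 * mfact l2 (m2 + 1)) * mfact l3 m3)
        * racah_sum l1 l2 l3 m1 (m2 + 1) : R); first by ring.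
    by rewrite mfact_rec// /c; ring.
  have -> : m2 = l2%:Z by lia.
  by rewrite lad_top racah_sum_m2_gt mul0r !mulr0.
have -> : lad l3 m3 * wigner3j l1 l2 l3 m1 m2 (m3 + 1)
    = - (c * ((l3%:Z - m1 - m2)%:~R * racah_sum l1 l2 l3 m1 m2)).
  have [lt|ge] := ltP m3 l3%:Z.
    rewrite wigner3jE; [|by []|lia|lia|lia|lia].
    transitivity ((-1) ^ (l1%:Z - l2%:Z - (m3 + 1)) * wnorm l1 l2 l3 *
       (mfact l1 m1 * mfact l2 m2 * (lad l3 m3 * mfact l3 (m3 + 1)))
        * racah_sum l1 l2 l3 m1 m2 : R); first by ring.
    rewrite mfact_rec// /c.
    have -> : (-1 : R) ^ (l1%:Z - l2%:Z - m3) = - (-1) ^ (l1%:Z - l2%:Z - (m3 + 1)).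
      have -> : l1%:Z - l2%:Z - m3 = l1%:Z - l2%:Z - (m3 + 1) + 1 by lia.
      by rewrite expfzDr ?oppr_eq0 ?oner_eq0// expr1z mulrN1.
    have -> : l3%:Z - m1 - m2 = l3%:Z + m3 + 1 by lia.
    by ring.
  have -> : m3 = l3%:Z by lia.
  by rewrite lad_top racah_sum_m3_gt ?mul0r ?mulr0 ?oppr0//; lia.
by rewrite -mulrDr racah_sum_rec subrr.
Qed.

(** Lowering is raising under m -> -m, a symmetry without sign when the sum of
    the degrees is even. *)
Lemma wigner3j_invariant l1 l2 l3 : triangle l1 l2 l3 -> ~~ odd (l1 + l2 + l3) ->
  su2_invariant l1 l2 l3 (wigner3j l1 l2 l3 : _ -> _ -> _ -> R).
Proof.
move=> tr ev; split=> m1 m2 m3; first exact: wigner3j_0.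
  exact: wigner3j_up.
move=> h1 h2 h3 s.
rewrite -(wigner3jN (m1 - 1))// -(wigner3jN m1 (m2 - 1))// -(wigner3jN m1 m2)//.
rewrite -!ladN !opprB ![1 - _]addrC.
by apply: wigner3j_up; rewrite ?normrN//; lia.
Qed.

(** Only the term t = l2 + m2 survives. *)
Lemma racah_sum_top3 l1 l2 l3 m1 m2 : triangle l1 l2 l3 ->
  `|m1| <= l1%:Z -> `|m2| <= l2%:Z -> m1 + m2 + l3%:Z = 0 ->
  racah_sum l1 l2 l3 m1 m2 = (-1) ^ (l2%:Z + m2) *
    (rfact (l2%:Z + m2) * rfact (l1%:Z + m1) * rfact (l2%:Z + l3%:Z - l1%:Z)
     * rfact (l1%:Z + l3%:Z - l2%:Z)) :> R.
Proof.
move=> /and3P[t1 t2 t3] h1 h2 s; have hlt : (`|(l2%:Z + m2)%R|%N < (l1 + l2).+1)%N by lia.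
have e : `|(l2%:Z + m2)%R|%:Z = l2%:Z + m2 by lia.
rewrite /racah_sum (bigD1 (Ordinal hlt))//= big1 ?addr0 => [|t tn].
  rewrite exprnP e /racah_term; congr (_ * _).
  have -> : l3%:Z - l2%:Z + (l2%:Z + m2) + m1 = 0 by lia.
  have -> : l2%:Z - (l2%:Z + m2) + m2 = 0 by lia.
  have -> : l3%:Z - l1%:Z + (l2%:Z + m2) - m2 = l2%:Z + l3%:Z - l1%:Z by lia.
  have -> : l1%:Z + l2%:Z - l3%:Z - (l2%:Z + m2) = l1%:Z + m1 by lia.
  have -> : l1%:Z - (l2%:Z + m2) - m1 = l1%:Z + l3%:Z - l2%:Z by lia.
  by rewrite /(rfact 0) lexx /zfact /= fact0 invr1; ring.
rewrite /racah_term; have tn' : t%:Z != l2%:Z + m2.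
  by apply: contra tn => /eqP te; apply/eqP/val_inj => /=; lia.
case: (ltP (l2%:Z - t%:Z + m2) 0) => ht.
  by rewrite [rfact (_ - t%:Z + m2)]rfact_lt0 ?(mulr0, mul0r)//; lia.
by rewrite [rfact (_ + t%:Z + m1)]rfact_lt0 ?(mulr0, mul0r)//; lia.
Qed.

(** Only the term t = 0 survives. *)
Lemma racah_sum_top1 l1 l2 l3 m2 m3 : triangle l1 l2 l3 ->
  `|m2| <= l2%:Z -> `|m3| <= l3%:Z -> l1%:Z + m2 + m3 = 0 ->
  racah_sum l1 l2 l3 l1%:Z m2 =
    rfact (l1%:Z + l3%:Z - l2%:Z) * rfact (l1%:Z + l2%:Z - l3%:Z) *
    (rfact (l2%:Z + m2) * rfact (l3%:Z + m3)) :> R.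
Proof.
move=> /and3P[t1 t2 t3] h1 h2 s.
rewrite /racah_sum big_ord_recl big1 ?addr0 => [|t _].
  rewrite /racah_term expr0 mul1r /=.
  have -> : l3%:Z - l1%:Z + 0%:Z - m2 = l3%:Z + m3 by lia.
  have -> : l3%:Z - l2%:Z + 0%:Z + l1%:Z = l1%:Z + l3%:Z - l2%:Z by lia.
  have -> : l1%:Z - 0%:Z - l1%:Z = 0 by lia.
  have -> : l2%:Z - 0%:Z + m2 = l2%:Z + m2 by lia.
  have -> : l1%:Z + l2%:Z - l3%:Z - 0%:Z = l1%:Z + l2%:Z - l3%:Z by lia.
  by rewrite /(rfact 0) lexx /zfact /= fact0 invr1; ring.
rewrite /racah_term [rfact (l1%:Z - _ - l1%:Z)]rfact_lt0 ?(mulr0, mul0r)//.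
by rewrite lift0; lia.
Qed.

(** Both sides are invariant tensors, and their top levels m3 = l3 are explicit. *)
Lemma wigner3j_swap12 l l3 m1 m2 m3 : triangle l l l3 -> ~~ odd (l + l + l3) ->
  wigner3j l l l3 m1 m2 m3 = wigner3j l l l3 m2 m1 m3 :> R.
Proof.
move=> tr ev; apply/eqP; rewrite -subr_eq0; apply/eqP.
have inv := @wigner3j_invariant l l l3 tr ev.
apply: (invariant_top0 (invariantB inv (invariant12 inv))) => {}m1 {}m2 h1 h2 s.
rewrite !wigner3jE//; [|lia..].
rewrite !racah_sum_top3//; last by lia.
rewrite (@signz_congr (l%:Z + m2) (l%:Z + m1)); last by lia.
by ring.
Qed.

(** As for wigner3j_swap12, at the top level of the first index. *)
Lemma wigner3j_swap23 l1 l m1 m2 m3 : triangle l1 l l -> ~~ odd (l1 + l + l) ->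
  wigner3j l1 l l m1 m2 m3 = wigner3j l1 l l m1 m3 m2 :> R.
Proof.
move=> tr ev; apply/eqP; rewrite -subr_eq0; apply/eqP.
have inv := @wigner3j_invariant l1 l l tr ev.
have := invariantB inv (invariant23 inv).
move=> /invariant12 /invariant23 /invariant_top0; apply => {}m2 {}m3 h2 h3 s.
rewrite !wigner3jE//; [|lia..].
rewrite (@racah_sum_top1 _ _ _ _ m3)//; [|lia..].
rewrite (@racah_sum_top1 _ _ _ _ m2)//; [|lia..].
rewrite (@signz_congr (l1%:Z - l%:Z - m3) (l1%:Z - l%:Z - m2)); last by lia.
by ring.
Qed.

(** Vandermonde's convolution for negative exponents, by Pascal's rule. *)
Lemma binomial_convolution p q L :
  (\sum_(a < L.+1) 'C(q + a, a) * 'C(p + (L - a), L - a) = 'C((p + q + L).+1, L))%N.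
Proof.
elim: L p => [|L IHL] p.
  by rewrite big_ord_recl big_ord0 !addn0 !bin0.
elim: p => [|p IHp].
  rewrite big_ord_recr /= subnn !addn0 !add0n bin0 muln1.
  transitivity (\sum_(a < L.+1) 'C(q + a, a) * 'C(0 + (L - a), L - a) + 'C(q + L.+1, L.+1))%N.
    congr (_ + _)%N; apply: eq_bigr => a _.
    by rewrite !add0n !binn.
  by rewrite IHL add0n [RHS]binS addnS addnC.
transitivity (\sum_(a < L.+2) 'C(q + a, a) * 'C(p + (L.+1 - a), L.+1 - a)
   + \sum_(a < L.+1) 'C(q + a, a) * 'C(p.+1 + (L - a), L - a))%N.
  rewrite big_ord_recr [in RHS]big_ord_recr /= !subnn !bin0 addnAC; congr (_ + _)%N.
  rewrite -big_split /=; apply: eq_bigr => a _; rewrite -mulnDr; congr (_ * _)%N.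
  have -> : (L.+1 - a = (L - a).+1)%N by have := ltn_ord a; lia.
  by rewrite addSn binS addnS addSn addnC.
rewrite IHp IHL.
have -> : ((p + q + L.+1).+1 = (p.+1 + q + L).+1)%N by lia.
have -> : ((p.+1 + q + L.+1).+1 = (p.+1 + q + L).+2)%N by lia.
by rewrite [RHS]binS addnC.
Qed.

Lemma wigner3j_top3_sqr l1 l2 l3 (a : nat) : triangle l1 l2 l3 ->
  (a <= l1 + l2 - l3)%N -> let L := (l1 + l2 - l3)%N in
  wigner3j l1 l2 l3 (a%:Z - l1%:Z) ((L - a)%N%:Z - l2%:Z) l3%:Z ^+ 2 =
  (L`! * (2 * l3)`!)%:R / ((l1 + l2 + l3).+1`!)%:R *
  ('C((l2 + l3 - l1) + a, a) * 'C((l1 + l3 - l2) + (L - a), L - a))%:R :> R.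
Proof.
move=> tr ha L; rewrite -/L in ha; have /and3P[t1 t2 t3] := tr.
have [m1h m2h] : `|a%:Z - l1%:Z| <= l1%:Z /\ `|(L - a)%N%:Z - l2%:Z| <= l2%:Z.
  by move: ha; rewrite /L; lia.
have s0 : a%:Z - l1%:Z + ((L - a)%N%:Z - l2%:Z) + l3%:Z = 0.
  by move: ha; rewrite /L; lia.
rewrite wigner3jE//.
rewrite racah_sum_top3// !exprMn.
have sgn2 z : ((-1) ^ z) ^+ 2 = 1 :> R.
  by rewrite [LHS]exprnP exprzAC -exprnP sqrrN expr1n exp1rz.
rewrite !sgn2 !mul1r /wnorm /mfact !sqr_sqrtr; last 4 first.
- by rewrite !mulr_ge0 ?invr_ge0// ltW// zfact_gt0.
- by rewrite !mulr_ge0 ?invr_ge0// ltW// zfact_gt0.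
- by rewrite !mulr_ge0 ?invr_ge0// ltW// zfact_gt0.
- by rewrite !mulr_ge0 ?invr_ge0// ltW// zfact_gt0.
have zf (z : int) (n : nat) : z = n%:Z -> zfact z = n`!%:R :> R by move=> ->.
have rf (z : int) (n : nat) : z = n%:Z -> rfact z = (n`!%:R)^-1 :> R by move=> ->.
pose b := (L - a)%N; pose p := (l1 + l3 - l2)%N; pose q := (l2 + l3 - l1)%N.
rewrite (zf _ L); last by rewrite /L; lia.
rewrite (zf _ p); last by rewrite /p; lia.
rewrite (zf _ q); last by rewrite /q; lia.
rewrite (zf _ (l1 + l2 + l3).+1); last by lia.
rewrite (zf _ a); last by lia.
rewrite (zf _ (p + b)%N); last by rewrite /p /b; move: ha; rewrite /L; lia.
rewrite (zf _ b); last by rewrite /b; lia.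
rewrite (zf _ (q + a)%N); last by rewrite /q; move: ha; rewrite /L; lia.
rewrite (zf _ (2 * l3)%N); last by lia.
rewrite (zf _ 0%N); last by lia.
rewrite (rf _ b); last by rewrite /b; lia.
rewrite (rf _ a); last by lia.
rewrite (rf _ q); last by rewrite /q; lia.
rewrite (rf _ p); last by rewrite /p; lia.
have binE (u v : nat) : 'C(u + v, v)%:R = (u + v)`!%:R / (v`!%:R * u`!%:R) :> R.
  apply: canRL (mulfK _) _; first by rewrite mulf_neq0// pnatr_eq0 -lt0n fact_gt0.
  by rewrite -!natrM -(@bin_fact (u + v) v) ?leq_addl// addnK.
have nz (n : nat) : n`!%:R != 0 :> R by rewrite pnatr_eq0 -lt0n fact_gt0.
have := nz (l1 + l2 + l3).+1; set sf : R := ((l1 + l2 + l3).+1`!)%:R => sf0.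
rewrite -/b -/p -/q !natrM !binE fact0.
by field; rewrite !nz.
Qed.

(** The squared entries at the top level are products of two binomial
    coefficients, which sum up to binomial_convolution. *)
Lemma wigner3j_sqnorm3 l1 l2 l3 : triangle l1 l2 l3 ->
  sqnorm3 l1 l2 (wigner3j l1 l2 l3) l3%:Z = (2 * l3).+1%:R^-1 :> R.
Proof.
move=> tr; have /and3P[t1 t2 t3] := tr; set L := (l1 + l2 - l3)%N.
have inner m1 : `|m1| <= l1%:Z ->
    zsum l2 (fun m2 => wigner3j l1 l2 l3 m1 m2 l3%:Z ^+ 2)
    = wigner3j l1 l2 l3 m1 (- l3%:Z - m1) l3%:Z ^+ 2 :> R.
  move=> h1; have [h2|h2] := boolP (`|- l3%:Z - m1| <= l2%:Z).
    apply: (zsum1 (F := fun m2 => wigner3j l1 l2 l3 m1 m2 l3%:Z ^+ 2) h2) => m' m'n.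
    by rewrite wigner3j_0 ?expr0n//; lia.
  rewrite wigner3j_0 ?(negbTE h2) ?andbF ?andbT//= expr0n /=.
  rewrite -[RHS](zsum0 l2); apply: eq_zsum => m2 hm2.
  by rewrite wigner3j_0 ?expr0n//; lia.
rewrite /sqnorm3 (eq_zsum inner) /zsum.
have hL : (L.+1 <= (2 * l1).+1)%N by rewrite /L; lia.
transitivity (\sum_(a < L.+1) ((L`! * (2 * l3)`!)%:R / ((l1 + l2 + l3).+1`!)%:R *
  ('C((l2 + l3 - l1) + a, a) * 'C((l1 + l3 - l2) + (L - a), L - a))%:R) : R).
  rewrite (big_ord_widen _ (fun a : nat => (L`! * (2 * l3)`!)%:R / ((l1 + l2 + l3).+1`!)%:R *
     ('C((l2 + l3 - l1) + a, a) * 'C((l1 + l3 - l2) + (L - a), L - a))%:R) hL).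
  rewrite [RHS]big_mkcond /=; apply: eq_bigr => a _.
  rewrite ltnS; case: ifP => ha.
    rewrite -wigner3j_top3_sqr// /mval -/L.
    by congr (wigner3j _ _ _ _ _ _ ^+ 2); move: ha; rewrite /L; lia.
  by rewrite wigner3j_0 ?expr0n// /mval; move: ha; rewrite /L; lia.
rewrite -mulr_sumr -natr_sum binomial_convolution.
have -> : ((l1 + l3 - l2 + (l2 + l3 - l1) + L).+1 = (l1 + l2 + l3).+1)%N.
  by rewrite /L; lia.
have hb : (L <= (l1 + l2 + l3).+1)%N by rewrite /L; lia.
have := bin_fact hb; have -> : ((l1 + l2 + l3).+1 - L = (2 * l3).+1)%N by rewrite /L; lia.
move=> <-; rewrite [(2 * l3).+1`!]factS !natrM.
have nz (n : nat) : n`!%:R != 0 :> R by rewrite pnatr_eq0 -lt0n fact_gt0.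
have cz : 'C((l1 + l2 + l3).+1, L)%:R != 0 :> R by rewrite pnatr_eq0 -lt0n bin_gt0.
have : (2 * l3).+1%:R != 0 :> R by rewrite pnatr_eq0.
move: cz; set cc : R := 'C(_, _)%:R; set n1 : R := (2 * l3).+1%:R => cz n10.
clearbody cc n1; by field; rewrite !nz cz n10.
Qed.

Lemma wigner3j_sqnorm l1 l2 l3 : triangle l1 l2 l3 -> ~~ odd (l1 + l2 + l3) ->
  zsum l1 (fun m1 => zsum l2 (fun m2 => zsum l3 (fun m3 =>
     wigner3j l1 l2 l3 m1 m2 m3 ^+ 2))) = 1 :> R.
Proof.
move=> tr ev; rewrite (@sqnorm3_total _ _ _ _ _ l3%:Z (wigner3j_invariant tr ev)); last by lia.
by rewrite wigner3j_sqnorm3// divff// pnatr_eq0.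
Qed.

End Wigner.

(** * Cubic forms and Gaussian integration by parts *)

Section RealAnalysis.
Context {R : realType}.

Lemma mean_value (F dF : R -> R) (a b : R) :
  (forall x : R, is_derive x 1 F (dF x)) ->
  exists2 c, `|c - a| <= `|b - a| & F b - F a = dF c * (b - a).
Proof.
move=> h; have cF x : {for x, continuous F}.
  by apply/differentiable_continuous/derivable1_diffP; have [] := h x.
have [ab|ba] := leP a b.
  have [|c cab E] := @MVT_segment R F dF a b ab (fun x _ => h x).
    by apply: continuous_subspaceT; exact: cF.
  exists c => //; rewrite in_itv /= in cab; case/andP: cab => ac cb.
  by rewrite !ger0_norm ?subr_ge0// lerB.
have [|c cab E] := @MVT_segment R F dF b a (ltW ba) (fun x _ => h x).
  by apply: continuous_subspaceT; exact: cF.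
exists c; last by rewrite -opprB E -mulrN opprB.
rewrite in_itv /= in cab; case/andP: cab => bc ca.
by rewrite distrC [leRHS]distrC !ger0_norm ?subr_ge0 ?(ltW ba)// lerB.
Qed.

Lemma cos_taylor1 (u v : R) : `|cos (u + v) - cos u + v * sin u| <= v ^+ 2.
Proof.
have [c cu E] := @mean_value cos (fun x => - sin x) u (u + v) (fun x => is_derive_cos x).
have [e ec E2] := @mean_value sin cos u c (fun x => is_derive_sin x).
have -> : cos (u + v) - cos u + v * sin u = - (sin c - sin u) * v.
  by rewrite E [u + v]addrC addrK; ring.
rewrite E2 normrM normrN normrM; rewrite [u + v]addrC addrK in cu.
rewrite -[v ^+ 2]ger0_norm ?sqr_ge0// normrX expr2.
rewrite ler_wpM2r//; apply: le_trans cu.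
by rewrite ler_piMl//; rewrite ler_norml cos_geN1 cos_le1.
Qed.

(** A way to differentiate under an expectation: a quadratic remainder estimate
    survives averaging. *)
Lemma is_derive_quadratic (F : R -> R) (s d K : R) :
  (forall h, `|F (s + h) - F s - h * d| <= K * h ^+ 2) -> is_derive s 1 F d.
Proof.
move=> hF; have K0 : 0 <= K.
  by have := hF 1; rewrite expr1n mulr1; apply: le_trans.
suff cv : h^-1 *: (F (h *: 1 + s) - F s) @[h --> 0^'] --> d.
  split; last exact/cvg_lim.
  by apply/cvg_ex; exists d.
apply/cvgrPdist_le => e e0; near=> h.
have h0 : h != 0 by near: h; exact: nbhs_dnbhs_neq.
have -> : d - h^-1 *: (F (h *: 1 + s) - F s) = - (h^-1 * (F (s + h) - F s - h * d)).
  by rewrite /GRing.scale /= mulr1 [h + s]addrC; field.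
rewrite normrN normrM normfV ler_pdivrMl ?normr_gt0//.
apply: le_trans (hF h) _.
have -> : K * h ^+ 2 = `|h| * (K * `|h|).
  by rewrite -[h ^+ 2]ger0_norm ?sqr_ge0// normrX expr2; ring.
rewrite ler_wpM2l//.
have : `|h| <= e / (K + 1) by near: h; apply: dnbhs0_le; rewrite divr_gt0// ltr_wpDl.
rewrite ler_pdivlMr ?ltr_wpDl//; apply: le_trans.
by rewrite mulrC ler_wpM2l// lerDl.
Unshelve. all: by end_near. Qed.

(** Multiplication by exp (c s^2 / 2) removes the linear term; then apply the
    mean value theorem on [0, 1]. *)
Lemma gaussian_ode (A D : R -> R) (c K : R) : 0 <= c ->
  (forall s : R, is_derive s 1 A (- (c * s * A s) + s ^+ 2 * D s)) ->
  (forall s : R, `|D s| <= K) -> `|A 1 - expR (- (c / 2)) * A 0| <= K.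
Proof.
move=> c0 dA hD; pose B s := A s * expR (c / 2 * s ^+ 2).
have dB (s : R) : is_derive s 1 B (s ^+ 2 * expR (c / 2 * s ^+ 2) * D s).
  have d1 : is_derive s 1 (fun s : R => c / 2 * s ^+ 2) (c * s).
    have d2 : is_derive s 1 (fun s : R => s ^+ 2) (2 * s).
      apply: (is_derive_eq (is_deriveX 2 (is_derive_id s (1 : R)))).
      by rewrite /GRing.scale /= expr1 mulr1.
    apply: (is_derive_eq (is_deriveZ (c / 2) d2)).
    by rewrite /GRing.scale /=; field.
  have d3 : is_derive s 1 (fun s : R => expR (c / 2 * s ^+ 2)) (expR (c / 2 * s ^+ 2) * (c * s)).
    exact: (is_derive1_comp (is_derive_expR _) d1).
  apply: (is_derive_eq (is_deriveM (dA s) d3)).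
  by rewrite /GRing.scale /=; ring.
have [xi hxi] := mean_value 0 1 dB.
rewrite /B expr0n /= mulr0 expR0 mulr1 expr1n mulr1 subr0 mulr1 => E.
rewrite !subr0 normr1 in hxi.
have -> : A 1 - expR (- (c / 2)) * A 0 =
   expR (- (c / 2)) * (xi ^+ 2 * expR (c / 2 * xi ^+ 2) * D xi).
  by rewrite -E mulrBr mulrCA -expRD addNr expR0 mulr1.
have -> : expR (- (c / 2)) * (xi ^+ 2 * expR (c / 2 * xi ^+ 2) * D xi) =
    expR (- (c / 2) + c / 2 * xi ^+ 2) * xi ^+ 2 * D xi by rewrite expRD; ring.
rewrite normrM; apply: le_trans (hD xi); rewrite ler_piMl//.
rewrite normrM ger0_norm ?expR_ge0//.
have xi2 : xi ^+ 2 <= 1 by rewrite -[xi ^+ 2]ger0_norm ?sqr_ge0// normrX expr_le1.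
rewrite mulr_ile1 ?expR_ge0//; last by rewrite ger0_norm ?sqr_ge0.
rewrite -[leRHS]expR0 ler_expR.
have -> : - (c / 2) + c / 2 * xi ^+ 2 = - (c / 2 * (1 - xi ^+ 2)) by ring.
by rewrite oppr_le0 !mulr_ge0 ?invr_ge0 ?ler0n// subr_ge0.
Qed.

End RealAnalysis.

Section Tame.
Context {R : realType} {J : finType}.
Implicit Types (F G : (J -> R) -> R) (DF DG : J -> (J -> R) -> R).

(** Functions built from the variables by sums, products, sines and cosines,
    paired with their partial derivatives: a class that contains all the integrands
    below and is closed under the operations performed on them. *)
Inductive tame : ((J -> R) -> R) -> (J -> (J -> R) -> R) -> Prop :=
| tame_cst c : tame (fun=> c) (fun _ _ => 0)
| tame_var j : tame (fun x => x j) (fun i _ => (i == j)%:R)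
| tame_add F DF G DG : tame F DF -> tame G DG ->
    tame (fun x => F x + G x) (fun i x => DF i x + DG i x)
| tame_mul F DF G DG : tame F DF -> tame G DG ->
    tame (fun x => F x * G x) (fun i x => DF i x * G x + F x * DG i x)
| tame_cos F DF : tame F DF ->
    tame (fun x => cos (F x)) (fun i x => - (sin (F x) * DF i x))
| tame_sin F DF : tame F DF ->
    tame (fun x => sin (F x)) (fun i x => cos (F x) * DF i x).

Definition smooth F := exists DF, tame F DF.

Lemma eq_tame F DF G DG : tame F DF -> F =1 G -> (forall i, DF i =1 DG i) ->
  tame G DG.
Proof.
move=> h /funext <- e; suff <- : DF = DG by [].
by apply/funext => i; apply/funext => x; apply: e.
Qed.

Lemma tame_sum (I : finType) (F : I -> (J -> R) -> R)
    (DF : I -> J -> (J -> R) -> R) :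
  (forall i, tame (F i) (DF i)) ->
  tame (fun x => \sum_i F i x) (fun j x => \sum_i DF i j x).
Proof.
move=> h; rewrite /index_enum; elim: (locked_with _ _) => [|i s IH] /=.
  apply: (eq_tame (tame_cst 0)) => [x|j x]; by rewrite big_nil.
by apply: (eq_tame (tame_add (h i) IH)) => [x|j x]; rewrite big_cons.
Qed.

Lemma smooth_cst c : smooth (fun=> c).
Proof. by eexists; exact: tame_cst. Qed.

Lemma smooth_var j : smooth (fun x => x j).
Proof. by eexists; exact: tame_var. Qed.

Lemma smooth_add F G : smooth F -> smooth G -> smooth (fun x => F x + G x).
Proof. by move=> [DF hF] [DG hG]; eexists; exact: tame_add hF hG. Qed.

Lemma smooth_mul F G : smooth F -> smooth G -> smooth (fun x => F x * G x).
Proof. by move=> [DF hF] [DG hG]; eexists; exact: tame_mul hF hG. Qed.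

Lemma smooth_cos F : smooth F -> smooth (fun x => cos (F x)).
Proof. by move=> [DF hF]; eexists; exact: tame_cos hF. Qed.

Lemma smooth_sin F : smooth F -> smooth (fun x => sin (F x)).
Proof. by move=> [DF hF]; eexists; exact: tame_sin hF. Qed.

Lemma smooth_opp F : smooth F -> smooth (fun x => - F x).
Proof.
move=> h; rewrite (_ : (fun x => _) = (fun x => -1 * F x)); last first.
  by apply/funext => x; rewrite mulN1r.
by apply: smooth_mul => //; exact: smooth_cst.
Qed.

Lemma smooth_exp F n : smooth F -> smooth (fun x => F x ^+ n).
Proof.
move=> h; elim: n => [|n IH]; first exact: smooth_cst.
rewrite (_ : (fun x => _) = (fun x => F x * F x ^+ n)); first exact: smooth_mul.
by apply/funext => x; rewrite exprS.
Qed.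

Lemma smooth_sum (I : finType) (F : I -> (J -> R) -> R) :
  (forall i, smooth (F i)) -> smooth (fun x => \sum_i F i x).
Proof. by move=> /choice[DF h]; exists (fun j x => \sum_i DF i j x); exact: tame_sum. Qed.

Lemma tame_D F DF : tame F DF -> forall j, smooth (DF j).
Proof.
have sm G DG : tame G DG -> smooth G by exists DG.
elim=> [c|i|G DG H DH hG IG hH IH|G DG H DH hG IG hH IH|G DG hG IG|G DG hG IG] j.
- exact: smooth_cst.
- exact: smooth_cst.
- exact: smooth_add.
- by apply: smooth_add; apply: smooth_mul => //; exact: sm hG || exact: sm hH.
- by apply: smooth_opp; apply: smooth_mul => //; apply: smooth_sin; exact: sm hG.
- by apply: smooth_mul => //; apply: smooth_cos; exact: sm hG.
Qed.

End Tame.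

Ltac smooth_tac :=
  repeat first [ assumption | exact: smooth_cst | exact: smooth_var
    | apply: smooth_add | apply: smooth_mul | apply: smooth_opp
    | apply: smooth_sin | apply: smooth_cos | apply: smooth_exp
    | (apply: smooth_sum => ?) ].

Section GaussExpectation.
Context {R : realType} {J : finType}.
Variable Ex : ((J -> R) -> R) -> R.

(** The properties of an expectation over independent N(0, 1) variables on which
    the analysis of cubic forms rests; gE_ibp characterizes the law. *)
Record gauss_expectation : Prop := {
  gE_cst : forall c, Ex (fun=> c) = c ;
  gE_lin : forall a F G, smooth F -> smooth G ->
    Ex (fun x => a * F x + G x) = a * Ex F + Ex G ;
  gE_le : forall F G, smooth F -> smooth G -> (forall x, F x <= G x) ->
    Ex F <= Ex G ;
  gE_ibp : forall j F DF, tame F DF -> Ex (fun x => x j * F x) = Ex (DF j) }.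

Hypothesis gE : gauss_expectation.
Implicit Types (F G : (J -> R) -> R) (DF DG : J -> (J -> R) -> R).

Lemma eq_Ex F G : F =1 G -> Ex F = Ex G.
Proof. by move=> /funext ->. Qed.

Lemma ExD F G : smooth F -> smooth G -> Ex (fun x => F x + G x) = Ex F + Ex G.
Proof.
move=> hF hG; rewrite -[Ex F]mul1r -(gE_lin gE)//.
by apply: eq_Ex => x; rewrite mul1r.
Qed.

Lemma ExZ a F : smooth F -> Ex (fun x => a * F x) = a * Ex F.
Proof.
move=> hF; rewrite -[RHS]addr0 -(gE_cst gE 0) -(gE_lin gE)//; last exact: smooth_cst.
by apply: eq_Ex => x; rewrite addr0.
Qed.

Lemma ExN F : smooth F -> Ex (fun x => - F x) = - Ex F.
Proof.
by move=> hF; rewrite -mulN1r -ExZ//; apply: eq_Ex => x; rewrite mulN1r.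
Qed.

Lemma Ex_sum (I : finType) (F : I -> (J -> R) -> R) :
  (forall i, smooth (F i)) -> Ex (fun x => \sum_i F i x) = \sum_i Ex (F i).
Proof.
move=> h; rewrite /index_enum.
suff [] : Ex (fun x => \sum_(i <- locked_with index_enum_key (Finite.enum I)) F i x) =
  \sum_(i <- locked_with index_enum_key (Finite.enum I)) Ex (F i) /\
  smooth (fun x => \sum_(i <- locked_with index_enum_key (Finite.enum I)) F i x) by [].
elim: (locked_with _ _) => [|i s [IH1 IH2]].
  rewrite big_nil; split.
    transitivity (Ex (fun=> 0)); last exact: gE_cst.
    by apply: eq_Ex => x; rewrite big_nil.
  by rewrite (_ : (fun x => _) = fun=> 0); [exact: smooth_cst|apply/funext => x; rewrite big_nil].
have e : (fun x => \sum_(j <- i :: s) F j x) = (fun x => F i x + \sum_(j <- s) F j x).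
  by apply/funext => x; rewrite big_cons.
by rewrite e big_cons ExD// IH1; split => //; exact: smooth_add.
Qed.

Lemma Ex_ibp_sum (G : J -> (J -> R) -> R) (DG : J -> J -> (J -> R) -> R) : (forall j, tame (G j) (DG j)) ->
  Ex (fun x => \sum_j x j * G j x) = Ex (fun x => \sum_j DG j j x).
Proof.
move=> h; rewrite (@Ex_sum _ (fun j x => x j * G j x)) => [|j]; last first.
  by apply: smooth_mul; [exact: smooth_var|exists (DG j)].
rewrite (@Ex_sum _ (fun j => DG j j)) => [|j]; last exact: tame_D (h j) j.
by apply: eq_bigr => j _; exact: gE_ibp.
Qed.

Lemma Ex_abs_le F G : smooth F -> smooth G -> (forall x, `|F x| <= G x) ->
  `|Ex F| <= Ex G.
Proof.
move=> hF hG h; rewrite ler_norml -ExN//; apply/andP; split.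
  apply: gE_le => //; first exact: smooth_opp.
  by move=> x; have := h x; rewrite ler_norml => /andP[].
by apply: gE_le => // x; have := h x; rewrite ler_norml => /andP[].
Qed.

Lemma Ex_cos_derive F th (s : R) : smooth F ->
  is_derive s 1 (fun s : R => Ex (fun x => cos (s * F x + th)))
    (- Ex (fun x => F x * sin (s * F x + th))).
Proof.
move=> hF; apply: (@is_derive_quadratic _ _ _ _ (Ex (fun x => F x ^+ 2))) => h.
rewrite mulrN opprK [leRHS]mulrC -[leRHS]ExZ; last by smooth_tac.
have -> : Ex (fun x => cos ((s + h) * F x + th)) - Ex (fun x => cos (s * F x + th)) +
    h * Ex (fun x => F x * sin (s * F x + th)) =
  Ex (fun x => cos ((s + h) * F x + th) + - cos (s * F x + th) +
    h * (F x * sin (s * F x + th))).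
  by rewrite !ExD ?ExN ?ExZ//; smooth_tac.
apply: Ex_abs_le; [smooth_tac..|] => x.
have -> : (s + h) * F x + th = (s * F x + th) + h * F x by ring.
rewrite -exprMn; apply: le_trans (cos_taylor1 _ _).
by rewrite mulrA.
Qed.

(** The remainder in gaussian_ode vanishes for a linear form. *)
Lemma Ex_cos_linear (t : J -> R) th :
  Ex (fun x => cos (\sum_j t j * x j + th)) = expR (- ((\sum_j t j ^+ 2) / 2)) * cos th.
Proof.
pose c := \sum_j t j ^+ 2; pose F (x : J -> R) := \sum_j t j * x j.
have tF : tame F (fun j _ => t j).
  apply: (eq_tame (tame_sum (F := fun j x => t j * x j) _)) => [j|//|j x].
    exact: tame_mul (tame_cst _) (tame_var _).
  rewrite /= (bigD1 j) //= eqxx mul0r add0r mulr1 big1 ?addr0// => i ni.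
  by rewrite eq_sym (negbTE ni) mul0r mulr0 addr0.
have sF : smooth F by exists (fun j _ => t j).
pose A s := Ex (fun x => cos (s * F x + th)).
have dA (s : R) : is_derive s 1 A (- (c * s * A s) + s ^+ 2 * 0).
  apply: (is_derive_eq (Ex_cos_derive th s sF)); rewrite mulr0 addr0; congr (- _).
  have tS : tame (fun x => sin (s * F x + th)) (fun j x => cos (s * F x + th) * (s * t j)).
    apply: (eq_tame (tame_sin (tame_add (tame_mul (tame_cst s) tF) (tame_cst th)))) => // j x.
    by rewrite /= mul0r add0r addr0.
  have -> : (fun x => F x * sin (s * F x + th)) =
      (fun x => \sum_j t j * (x j * sin (s * F x + th))).
    by apply/funext => x; rewrite mulr_suml; apply: eq_bigr => j _; rewrite mulrA.
  rewrite Ex_sum => [|j]; last by smooth_tac.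
  rewrite -[RHS]mulrA [RHS]mulr_suml; apply: eq_bigr => j _.
  rewrite ExZ; last by smooth_tac.
  rewrite (gE_ibp gE j tS); under eq_fun do rewrite mulrC.
  by rewrite ExZ /A; [ring|smooth_tac].
have c0 : 0 <= c by apply: sumr_ge0 => j _; exact: sqr_ge0.
have D0 (s : R) : `|(fun=> 0 : R) s| <= 0 :> R by rewrite normr0.
have := gaussian_ode c0 dA D0; rewrite normr_le0 subr_eq0 => /eqP e.
rewrite -[LHS](_ : A 1 = _); last by rewrite /A; under eq_fun do rewrite mul1r.
by rewrite e /A; under eq_fun do rewrite mul0r add0r; rewrite gE_cst.
Qed.

Lemma Ex_var_sqr j : Ex (fun x => x j ^+ 2) = 1.
Proof.
have t : tame (fun x : J -> R => x j) (fun i _ => (i == j)%:R) := tame_var j.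
under eq_fun do rewrite expr2; rewrite (gE_ibp gE j t) /=; rewrite eqxx; exact: gE_cst.
Qed.

(** Integration by parts shows that the x_j^2 - 1 are orthogonal of variance 2. *)
Lemma Ex_chi_square (c : J -> R) :
  Ex (fun x => (\sum_j c j * (x j ^+ 2 - 1)) ^+ 2) = 2 * \sum_j c j ^+ 2.
Proof.
have tH i : tame (fun x : J -> R => x i ^+ 2 - 1) (fun j x => 2 * ((j == i)%:R * x i)).
  apply: (eq_tame (tame_add (tame_mul (tame_var i) (tame_var i)) (tame_cst (-1)))).
    by move=> x; rewrite expr2.
  by move=> j x; ring.
have pair i j : Ex (fun x => (x i ^+ 2 - 1) * (x j ^+ 2 - 1)) = 2 * (i == j)%:R.
  have -> : (fun x : J -> R => (x i ^+ 2 - 1) * (x j ^+ 2 - 1)) =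
      (fun x => x i * (x i * (x j ^+ 2 - 1)) + - (x j ^+ 2 - 1)).
    by apply/funext => x; ring.
  rewrite ExD; [|smooth_tac..].
  rewrite (gE_ibp gE i (tame_mul (tame_var i) (tH j))) ExN; last by smooth_tac.
  rewrite -[X in X + _](_ : Ex (fun x => (x j ^+ 2 - 1) + 2 * (i == j)%:R * x i ^+ 2) = _).
    rewrite ExD; [|smooth_tac..]; rewrite addrAC subrr add0r ExZ; last by smooth_tac.
    by rewrite Ex_var_sqr mulr1.
  by apply: eq_Ex => x /=; rewrite eqxx; case: eqP => [->|_] /=; ring.
have -> : (fun x : J -> R => (\sum_j c j * (x j ^+ 2 - 1)) ^+ 2) =
    (fun x => \sum_i \sum_j c i * c j * ((x i ^+ 2 - 1) * (x j ^+ 2 - 1))).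
  apply/funext => x; rewrite expr2 mulr_suml; apply: eq_bigr => i _.
  by rewrite mulr_sumr; apply: eq_bigr => j _; ring.
rewrite Ex_sum => [|i]; last by smooth_tac.
rewrite mulr_sumr; apply: eq_bigr => i _; rewrite Ex_sum => [|j]; last by smooth_tac.
rewrite (bigD1 i) //= big1 ?addr0 => [|j ji]; rewrite ExZ ?pair; try by smooth_tac.
  by rewrite eqxx mulr1n; ring.
by rewrite eq_sym (negbTE ji) !mulr0.
Qed.

Section CubicForm.
Variable f : J -> J -> J -> R.
Hypothesis fC12 : forall a b c, f a b c = f b a c.
Hypothesis fC23 : forall a b c, f a b c = f a c b.
Hypothesis ftr : forall c, \sum_a f a a c = 0.

(** For a symmetric tensor f, cubM is the matrix f(x, ., .), cubV the vector
    f(x, x, .), a third of the gradient of the cubic form, and cubU the image of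
    cubV under cubM.  All error terms are controlled by gram, the Gram matrix of
    the slices of f. *)
Definition cubM (x : J -> R) a b := \sum_c f a b c * x c.
Definition cubV (x : J -> R) a := \sum_b cubM x a b * x b.
Definition cubU (x : J -> R) a := \sum_b cubM x a b * cubV x b.
Definition cubic (x : J -> R) := \sum_a x a * cubV x a.
Definition gram a b := \sum_c \sum_d f a c d * f b c d.
Definition gramL (x : J -> R) a := \sum_b gram a b * x b.

Lemma fC13 a b c : f a b c = f c b a.
Proof. by rewrite fC12 fC23 fC12. Qed.

Lemma ftr23 a : \sum_b f a b b = 0.
Proof. by rewrite -[RHS](ftr a); apply: eq_bigr => b _; rewrite fC13. Qed.

Lemma sum_delta (F : J -> R) j : \sum_b F b * (j == b)%:R = F j.
Proof.
rewrite (bigD1 j)//= eqxx mulr1 big1 ?addr0// => b.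
by rewrite eq_sym => /negbTE ->; rewrite mulr0.
Qed.

Lemma exchange22 (F : J -> J -> J -> J -> R) :
  \sum_a \sum_b \sum_c \sum_d F a b c d = \sum_c \sum_d \sum_a \sum_b F a b c d.
Proof.
under eq_bigr do rewrite exchange_big.
rewrite exchange_big /=; apply: eq_bigr => c _.
by under eq_bigr do rewrite exchange_big; rewrite exchange_big.
Qed.

Lemma cubM_C x a b : cubM x a b = cubM x b a.
Proof. by apply: eq_bigr => c _; rewrite fC12. Qed.

Lemma cubM_tr x : \sum_a cubM x a a = 0.
Proof.
rewrite /cubM exchange_big /= big1// => c _.
by rewrite -mulr_suml ftr mul0r.
Qed.

Lemma tame_cubM a b : tame (fun x => cubM x a b) (fun j _ => f a b j).
Proof.
apply: (eq_tame (tame_sum (fun c => tame_mul (tame_cst (f a b c)) (tame_var c)))) => // j x.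
by under eq_bigr do rewrite mul0r add0r; rewrite sum_delta.
Qed.

Lemma tame_cubV a : tame (fun x => cubV x a) (fun j x => 2 * cubM x a j).
Proof.
apply: (eq_tame (tame_sum (fun b => tame_mul (tame_cubM a b) (tame_var b)))) => // j x.
rewrite big_split /= sum_delta mulr_natl mulr2n; congr (_ + _).
by apply: eq_bigr => b _; rewrite fC23.
Qed.

Lemma tame_cubU a : tame (fun x => cubU x a)
  (fun j x => \sum_b (f a b j * cubV x b + cubM x a b * (2 * cubM x b j))).
Proof. exact: (tame_sum (fun b => tame_mul (tame_cubM a b) (tame_cubV b))). Qed.

Lemma tame_cubic : tame cubic (fun j x => 3 * cubV x j).
Proof.
apply: (eq_tame (tame_sum (fun b => tame_mul (tame_var b) (tame_cubV b)))) => // j x.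
rewrite big_split /=; under eq_bigr do rewrite mulrC; rewrite sum_delta.
rewrite (_ : \sum_b _ = 2 * cubV x j); first by ring.
by rewrite mulr_sumr; apply: eq_bigr => b _; rewrite cubM_C; ring.
Qed.

Lemma tame_gramL a : tame (fun x => gramL x a) (fun j _ => gram a j).
Proof.
apply: (eq_tame (tame_sum (fun c => tame_mul (tame_cst (gram a c)) (tame_var c)))) => // j x.
by under eq_bigr do rewrite mul0r add0r; rewrite sum_delta.
Qed.

Lemma smooth_cubM a b : smooth (fun x => cubM x a b).
Proof. by eexists; exact: tame_cubM. Qed.
Lemma smooth_cubV a : smooth (fun x => cubV x a).
Proof. by eexists; exact: tame_cubV. Qed.
Lemma smooth_cubU a : smooth (fun x => cubU x a).
Proof. by eexists; exact: tame_cubU. Qed.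
Lemma smooth_gramL a : smooth (fun x => gramL x a).
Proof. by eexists; exact: tame_gramL. Qed.
Lemma smooth_cubic : smooth cubic.
Proof. by eexists; exact: tame_cubic. Qed.

Local Ltac sm := repeat first [ assumption | exact: smooth_cubM | exact: smooth_cubV
  | exact: smooth_cubU | exact: smooth_gramL | exact: smooth_cubic
  | exact: smooth_cst | exact: smooth_var
    | apply: smooth_add | apply: smooth_mul | apply: smooth_opp
    | apply: smooth_sin | apply: smooth_cos | apply: smooth_exp
    | (apply: smooth_sum => ?) ].

(** One variable of the form is integrated by parts; the divergence of cubV
    vanishes because f is trace-free. *)
Lemma Ex_cubic G DG : tame G DG ->
  Ex (fun x => cubic x * G x) = Ex (fun x => \sum_a cubV x a * DG a x).
Proof.
move=> hG; transitivity (Ex (fun x => \sum_a x a * (cubV x a * G x))).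
  apply: eq_Ex => x; rewrite /cubic mulr_suml; apply: eq_bigr => a _.
  by rewrite mulrA.
rewrite (Ex_ibp_sum (fun a => tame_mul (tame_cubV a) hG)); apply: eq_Ex => x.
rewrite big_split /= (_ : \sum_i _ = 0) ?add0r//.
by rewrite -mulr_suml -mulr_sumr cubM_tr mulr0 mul0r.
Qed.

(** One of the two variables in cubV is integrated by parts; the trace term drops
    out again. *)
Lemma Ex_cubV (H : J -> (J -> R) -> R) (DH : J -> J -> (J -> R) -> R) : (forall a, tame (H a) (DH a)) ->
  Ex (fun x => \sum_a cubV x a * H a x) =
  Ex (fun x => \sum_a \sum_b cubM x a b * DH a b x).
Proof.
move=> hH; transitivity (Ex (fun x => \sum_b x b * (\sum_a cubM x a b * H a x))).
  apply: eq_Ex => x; rewrite /cubV; under eq_bigr do rewrite mulr_suml.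
  rewrite exchange_big /=; apply: eq_bigr => b _; rewrite mulr_sumr.
  by apply: eq_bigr => a _; ring.
rewrite (Ex_ibp_sum (fun b => tame_sum (fun a => tame_mul (tame_cubM a b) (hH a)))).
apply: eq_Ex => x; under eq_bigr do rewrite big_split /=.
rewrite big_split /= (_ : (\sum_i \sum_a _) = 0) ?add0r; first by rewrite exchange_big.
by rewrite exchange_big big1// => a _; rewrite -mulr_suml ftr23 mul0r.
Qed.

Lemma Ex_cubMM a b d e :
  Ex (fun x => cubM x a b * cubM x d e) = \sum_c f a b c * f d e c.
Proof.
transitivity (Ex (fun x => \sum_c x c * (f a b c * cubM x d e))).
  by apply: eq_Ex => x; rewrite mulr_suml; apply: eq_bigr => c _; ring.
rewrite (Ex_ibp_sum (fun c => tame_mul (tame_cst (f a b c)) (tame_cubM d e))).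
rewrite -[RHS](gE_cst gE); apply: eq_Ex => x.
by apply: eq_bigr => c _; rewrite mul0r add0r.
Qed.

Lemma cubM_sqr x : \sum_a \sum_b cubM x a b * cubM x a b = \sum_c x c * gramL x c.
Proof.
transitivity (\sum_a \sum_b \sum_c \sum_d x c * (f c a b * f d a b * x d)).
  apply: eq_bigr => a _; apply: eq_bigr => b _; rewrite mulr_suml.
  apply: eq_bigr => c _; rewrite mulr_sumr; apply: eq_bigr => d _.
  by rewrite (fC12 c) (fC12 d) (fC23 a c) (fC23 a d); ring.
rewrite exchange22; apply: eq_bigr => c _; rewrite mulr_sumr.
apply: eq_bigr => d _; rewrite mulr_suml mulr_sumr.
apply: eq_bigr => a _; rewrite mulr_suml mulr_sumr.
by apply: eq_bigr.
Qed.

Definition trgram := \sum_a gram a a.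
Definition sqgram := \sum_a \sum_b gram a b ^+ 2.

Lemma Ex_gramL_sqr : Ex (fun x => \sum_a gramL x a ^+ 2) = sqgram.
Proof.
transitivity (Ex (fun x => \sum_b x b * (\sum_a gram a b * gramL x a))).
  apply: eq_Ex => x; under [RHS]eq_bigr do rewrite mulr_sumr.
  rewrite exchange_big /=; apply: eq_bigr => a _.
  rewrite expr2 {1}/gramL mulr_suml; apply: eq_bigr => b _; ring.
rewrite (Ex_ibp_sum (fun b => tame_sum (fun a =>
  tame_mul (tame_cst (gram a b)) (tame_gramL a)))).
rewrite -[RHS](gE_cst gE); apply: eq_Ex => x; rewrite exchange_big /=.
by apply: eq_bigr => a _; apply: eq_bigr => b _; rewrite mul0r add0r expr2.
Qed.

Lemma Ex_cubM_gram a d : Ex (fun x => \sum_b cubM x a b * cubM x d b) = gram a d.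
Proof.
rewrite Ex_sum => [|b]; last by sm.
by apply: eq_bigr => b _; exact: Ex_cubMM.
Qed.

Lemma Ex_cubV_gram :
  Ex (fun x => \sum_a cubV x a * (\sum_d gram a d * cubV x d)) = 2 * sqgram.
Proof.
rewrite (Ex_cubV (fun a => tame_sum (fun d =>
  tame_mul (tame_cst (gram a d)) (tame_cubV d)))).
transitivity (Ex (fun x => \sum_a \sum_d (2 * gram a d) *
    (\sum_b cubM x a b * cubM x d b))).
  apply: eq_Ex => x; apply: eq_bigr => a _.
  under eq_bigr do rewrite mulr_sumr; rewrite exchange_big /=.
  apply: eq_bigr => d _; rewrite [RHS]mulr_sumr; apply: eq_bigr => b _.
  by ring.
rewrite Ex_sum => [|a]; last by sm.
rewrite /sqgram mulr_sumr; apply: eq_bigr => a _.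
rewrite Ex_sum => [|d]; last by sm.
rewrite mulr_sumr; apply: eq_bigr => d _.
by rewrite ExZ ?Ex_cubM_gram; [ring|sm].
Qed.

(** The contraction of four copies of f along the complete graph on four
    vertices. *)
Definition tetra := \sum_b \sum_c \sum_d \sum_e
  (\sum_a f a b c * f a d e) * (\sum_a f a b e * f a c d).

Lemma sum_pairs_sqr : \sum_b \sum_c \sum_d \sum_e
  (\sum_a f a b c * f a d e) ^+ 2 = sqgram.
Proof.
transitivity (\sum_b \sum_c \sum_d \sum_e \sum_a \sum_a'
   ((f a b c * f a' b c) * (f a d e * f a' d e))).
  apply: eq_bigr => b _; apply: eq_bigr => c _; apply: eq_bigr => d _.
  apply: eq_bigr => e _; rewrite expr2 mulr_suml; apply: eq_bigr => a _.
  by rewrite mulr_sumr; apply: eq_bigr => a' _; ring.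
under eq_bigr => b _ do under eq_bigr => c _ do rewrite exchange22.
rewrite exchange22; apply: eq_bigr => a _; apply: eq_bigr => a' _.
rewrite expr2 {1}/gram mulr_suml; apply: eq_bigr => b _.
rewrite mulr_suml; apply: eq_bigr => c _; rewrite /gram mulr_sumr.
by apply: eq_bigr => d _; rewrite mulr_sumr.
Qed.

(** The inequality 2 X Y <= X^2 + Y^2; the squares of both factors of tetra sum to
    sqgram. *)
Lemma tetra_le : tetra <= sqgram.
Proof.
have h : \sum_b \sum_c \sum_d \sum_e (\sum_a f a b e * f a c d) ^+ 2 = sqgram.
  rewrite -sum_pairs_sqr; apply: eq_bigr => b _.
  under eq_bigr do rewrite exchange_big; rewrite exchange_big /=.
  rewrite exchange_big /= ; under eq_bigr do rewrite exchange_big.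
  by rewrite exchange_big.
rewrite -(@ler_pM2l _ 2)//.
have -> : 2 * sqgram = sqgram + sqgram by ring.
rewrite -[X in _ <= X + _]sum_pairs_sqr -[X in _ <= _ + X]h.
rewrite /tetra mulr_sumr -big_split /=; apply: ler_sum => b _.
rewrite mulr_sumr -big_split /=; apply: ler_sum => c _.
rewrite mulr_sumr -big_split /=; apply: ler_sum => d _.
rewrite mulr_sumr -big_split /=; apply: ler_sum => e _.
set X := (X in _ <= X ^+ 2 + _); set Y := (X in _ <= _ + X ^+ 2).
rewrite -/X -/Y.
by rewrite -subr_ge0 (_ : _ - _ = (X - Y) ^+ 2) ?sqr_ge0//; ring.
Qed.

Lemma Ex_tetra : Ex (fun x => \sum_b cubV x b *
   (\sum_a \sum_c \sum_d f a b c * (cubM x a d * cubM x d c))) = 2 * tetra.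
Proof.
rewrite (Ex_cubV (fun b => tame_sum (fun a => tame_sum (fun c => tame_sum (fun d =>
  tame_mul (tame_cst (f a b c)) (tame_mul (tame_cubM a d) (tame_cubM d c))))))).
transitivity (\sum_b \sum_e \sum_a \sum_c \sum_d f a b c *
   (f a d e * Ex (fun x => cubM x b e * cubM x d c)
   + f d c e * Ex (fun x => cubM x b e * cubM x a d))).
  rewrite Ex_sum => [|b]; last by sm.
  apply: eq_bigr => b _; rewrite Ex_sum => [|e]; last by sm.
  apply: eq_bigr => e _.
  transitivity (Ex (fun x => \sum_a \sum_c \sum_d
     ((f a b c * f a d e) * (cubM x b e * cubM x d c) +
      (f a b c * f d c e) * (cubM x b e * cubM x a d)))).
    apply: eq_Ex => x; rewrite mulr_sumr; apply: eq_bigr => a _.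
    rewrite mulr_sumr; apply: eq_bigr => c _; rewrite mulr_sumr.
    by apply: eq_bigr => d _; ring.
  rewrite Ex_sum => [|a]; last by sm.
  apply: eq_bigr => a _; rewrite Ex_sum => [|c]; last by sm.
  apply: eq_bigr => c _; rewrite Ex_sum => [|d]; last by sm.
  apply: eq_bigr => d _; rewrite ExD ?ExZ; [ring|sm..].
under eq_bigr => b _ do under eq_bigr => e _ do under eq_bigr => a _ do
  under eq_bigr => c _ do under eq_bigr => d _ do rewrite !Ex_cubMM mulrDr.
under eq_bigr => b _ do under eq_bigr => e _ do under eq_bigr => a _ do
  under eq_bigr => c _ do rewrite big_split /=.
under eq_bigr => b _ do under eq_bigr => e _ do under eq_bigr => a _ do
  rewrite big_split /=.
under eq_bigr => b _ do under eq_bigr => e _ do rewrite big_split /=.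
under eq_bigr => b _ do rewrite big_split /=.
rewrite big_split /= mulr_natl mulr2n; congr (_ + _).
  rewrite /tetra; apply: eq_bigr => b _.
  transitivity (\sum_e \sum_c \sum_d \sum_a f a b c * (f a d e * (\sum_x f b e x * f d c x))).
    apply: eq_bigr => e _; rewrite exchange_big; apply: eq_bigr => c _.
    by rewrite exchange_big.
  rewrite exchange_big; apply: eq_bigr => c _; rewrite exchange_big.
  apply: eq_bigr => d _; apply: eq_bigr => e _; rewrite mulr_suml.
  apply: eq_bigr => a _; rewrite mulrA; congr (_ * _); apply: eq_bigr => x _.
  by rewrite (fC13 b e x) (fC12 x e b) (fC23 e x b) (fC12 e b x) (fC13 d c x)
     (fC13 b e x) (fC12 x e b) (fC12 e x b) (fC23 x e b) (fC12 x c d).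
rewrite /tetra; apply: eq_bigr => b _.
transitivity (\sum_e \sum_a \sum_d \sum_c f c b a * f c d e * (\sum_x f x b e * f x a d)).
  apply: eq_bigr => e _; apply: eq_bigr => a _; rewrite exchange_big /=.
  apply: eq_bigr => d _; apply: eq_bigr => c _.
  rewrite mulrA (fC13 a b c) (fC12 d c e); congr (_ * _); apply: eq_bigr => x _.
  by rewrite (fC13 b e x) (fC23 x e b) (fC13 a d x) (fC23 x d a).
rewrite exchange_big /=; apply: eq_bigr => a _; rewrite exchange_big /=.
by apply: eq_bigr => d _; apply: eq_bigr => e _; rewrite mulr_suml.
Qed.

(** Integrating the variable of the outer matrix by parts gives back cubU once,
    paired with gramL, plus terms bounded by sqgram: a quadratic inequality that
    closes on itself. *)
Lemma Ex_cubU_sqr : Ex (fun x => \sum_a cubU x a ^+ 2) <= 16 * sqgram.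
Proof.
have E : Ex (fun x => \sum_a cubU x a ^+ 2) =
    Ex (fun x => \sum_a (2 * gramL x a) * cubU x a) + 2 * sqgram + 2 * (2 * tetra).
  transitivity (Ex (fun x => \sum_c x c *
      (\sum_a \sum_b f a b c * (cubV x b * cubU x a)))).
    apply: eq_Ex => x.
    transitivity (\sum_a \sum_b \sum_c x c * (f a b c * (cubV x b * cubU x a))).
      apply: eq_bigr => a _; rewrite expr2 {1}/cubU mulr_suml; apply: eq_bigr => b _.
      by rewrite -mulrA {1}/cubM [LHS]mulr_suml; apply: eq_bigr => c _; ring.
    under eq_bigr do rewrite exchange_big; rewrite exchange_big /=.
    by apply: eq_bigr => c _; rewrite mulr_sumr; apply: eq_bigr => a _; rewrite mulr_sumr.
  rewrite (Ex_ibp_sum (fun c => tame_sum (fun a => tame_sum (fun b =>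
    tame_mul (tame_cst (f a b c)) (tame_mul (tame_cubV b) (tame_cubU a)))))).
  transitivity (Ex (fun x => (\sum_a (2 * gramL x a) * cubU x a +
      \sum_a cubV x a * (\sum_d gram a d * cubV x d)) +
      2 * (\sum_b cubV x b *
      (\sum_a \sum_c \sum_d f a b c * (cubM x a d * cubM x d c))))); last first.
    by rewrite !ExD ?ExZ ?Ex_cubV_gram ?Ex_tetra//; sm.
  apply: eq_Ex => x.
  transitivity (\sum_c \sum_a \sum_b (f a b c * (2 * cubM x b c * cubU x a) +
     f a b c * (cubV x b * (\sum_d f a d c * cubV x d)) +
     2 * (f a b c * (cubV x b * (\sum_d cubM x a d * cubM x d c))))).
    apply: eq_bigr => c _; apply: eq_bigr => a _; apply: eq_bigr => b _.
    rewrite big_split /=.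
    have -> : \sum_d cubM x a d * (2 * cubM x d c) = 2 * \sum_d cubM x a d * cubM x d c.
      by rewrite mulr_sumr; apply: eq_bigr => d _; ring.
    by ring.
  under eq_bigr => c _ do under eq_bigr => a _ do rewrite big_split /= big_split /=.
  under eq_bigr => c _ do rewrite big_split /= big_split /=.
  rewrite big_split /= big_split /=; congr (_ + _ + _).
  - rewrite exchange_big /=; apply: eq_bigr => a _.
    transitivity (2 * (\sum_c \sum_b f a b c * cubM x b c) * cubU x a).
      rewrite -[RHS]mulrA [X in _ = 2 * X]mulr_suml [RHS]mulr_sumr.
      apply: eq_bigr => c _; rewrite [X in _ = 2 * X]mulr_suml [RHS]mulr_sumr.
      by apply: eq_bigr => b _; ring.
    congr (2 * _ * _); transitivity (\sum_c \sum_b \sum_d f a b c * f d b c * x d).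
      apply: eq_bigr => c _; apply: eq_bigr => b _; rewrite [LHS]mulr_sumr.
      by apply: eq_bigr => d _; rewrite (fC13 d) (fC12 c); ring.
    under eq_bigr do rewrite exchange_big; rewrite exchange_big /=.
    apply: eq_bigr => d _; rewrite exchange_big /= /gram mulr_suml.
    by apply: eq_bigr => b _; rewrite mulr_suml.
  - transitivity (\sum_b \sum_d (\sum_c \sum_a f b a c * f d a c) * (cubV x b * cubV x d)).
      transitivity (\sum_c \sum_a \sum_b \sum_d (f b a c * f d a c) * (cubV x b * cubV x d)).
        apply: eq_bigr => c _; apply: eq_bigr => a _; apply: eq_bigr => b _.
        rewrite [X in _ * X = _]mulr_sumr [LHS]mulr_sumr; apply: eq_bigr => d _.
        by rewrite (fC12 b) (fC12 d); ring.
      rewrite exchange22; apply: eq_bigr => b _; apply: eq_bigr => d _.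
      by rewrite [RHS]mulr_suml; apply: eq_bigr => c _; rewrite [RHS]mulr_suml.
    apply: eq_bigr => b _; rewrite [RHS]mulr_sumr; apply: eq_bigr => d _.
    by rewrite exchange_big -/(gram b d); ring.
  - rewrite [RHS]mulr_sumr exchange_big /=.
    under eq_bigr do rewrite exchange_big; rewrite exchange_big /=.
    apply: eq_bigr => b _; rewrite [X in _ = 2 * X]mulr_sumr [RHS]mulr_sumr.
    apply: eq_bigr => a _; rewrite [X in _ = 2 * X]mulr_sumr [RHS]mulr_sumr.
    apply: eq_bigr => c _.
    rewrite [X in 2 * (_ * X) = _]mulr_sumr [X in 2 * X = _]mulr_sumr [LHS]mulr_sumr.
    rewrite [X in _ = 2 * X]mulr_sumr [RHS]mulr_sumr.
    by apply: eq_bigr => d _; ring.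
have le1 : Ex (fun x => \sum_a (2 * gramL x a) * cubU x a) <=
    2^-1 * Ex (fun x => \sum_a cubU x a ^+ 2) + 2 * sqgram.
  rewrite -Ex_gramL_sqr -!ExZ; [|sm..].
  rewrite -ExD; [|sm..].
  apply: gE_le => //; [sm..|] => x; rewrite !mulr_sumr -big_split /=.
  apply: ler_sum => a _; set X := gramL x a; set Y := cubU x a.
  rewrite -subr_ge0 (_ : _ - _ = 2^-1 * (Y - 2 * X) ^+ 2).
    by rewrite mulr_ge0 ?sqr_ge0.
  by field.
have := tetra_le; move: le1 E; lra.
Qed.


(** The squared gradient is asymptotically constant: under the weight
    cos (s cubic + th) it can be replaced by its mean 2 trgram, up to terms of
    higher order in f. *)
Lemma Ex_cubV_sqr_weighted s th :
  Ex (fun x => (\sum_a cubV x a ^+ 2) * cos (s * cubic x + th)) =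
  2 * trgram * Ex (fun x => cos (s * cubic x + th))
  - 3 * s * (2 * Ex (fun x => (\sum_a gramL x a * cubV x a) * sin (s * cubic x + th))
             + Ex (fun x => (\sum_a cubV x a * cubU x a) * sin (s * cubic x + th))).
Proof.
set C := fun x => cos (s * cubic x + th); set S := fun x => sin (s * cubic x + th).
have tC : tame C (fun j x => - (3 * s) * (cubV x j * S x)).
  apply: (eq_tame (tame_cos (tame_add (tame_mul (tame_cst s) tame_cubic) (tame_cst th))))
    => // j x; by rewrite /S; ring.
have sC : smooth C by eexists; exact: tC.
have sS : smooth S by rewrite /S; sm.
transitivity (Ex (fun x => \sum_a cubV x a * (cubV x a * C x))).
  by apply: eq_Ex => x; rewrite mulr_suml; apply: eq_bigr => a _; rewrite /C; ring.
rewrite (Ex_cubV (fun a => tame_mul (tame_cubV a) tC)).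
transitivity (Ex (fun x => 2 * ((\sum_c x c * (gramL x c * C x)))
    + - (3 * s) * ((\sum_a cubV x a * cubU x a) * S x))).
  apply: eq_Ex => x.
  have -> : \sum_c x c * (gramL x c * C x) = \sum_a \sum_b cubM x a b * cubM x a b * C x.
    transitivity ((\sum_c x c * gramL x c) * C x).
      by rewrite mulr_suml; apply: eq_bigr => c _; ring.
    rewrite -cubM_sqr mulr_suml; apply: eq_bigr => a _.
    by rewrite mulr_suml.
  rewrite mulr_sumr [X in _ = _ + _ * X]mulr_suml [X in _ = _ + X]mulr_sumr -big_split /=.
  apply: eq_bigr => a _.
  have -> : cubV x a * cubU x a * S x = \sum_b cubM x a b * (cubV x a * cubV x b * S x).
    rewrite -mulrA mulrCA {1}/cubU [LHS]mulr_suml; apply: eq_bigr => b _; ring.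
  rewrite !mulr_sumr -big_split /=; apply: eq_bigr => b _; ring.
rewrite ExD ?ExZ; [|sm..].
rewrite (Ex_ibp_sum (fun c => tame_mul (tame_gramL c) tC)).
have -> : Ex (fun x => \sum_j (gram j j * C x + gramL x j * (- (3 * s) * (cubV x j * S x))))
   = trgram * Ex C - 3 * s * Ex (fun x => (\sum_a gramL x a * cubV x a) * S x).
  transitivity (Ex (fun x => trgram * C x + - (3 * s) * ((\sum_a gramL x a * cubV x a) * S x))).
    apply: eq_Ex => x; rewrite big_split /= /trgram [X in _ = X + _]mulr_suml.
    congr (_ + _); rewrite [X in _ = _ * X]mulr_suml [RHS]mulr_sumr.
    by apply: eq_bigr => a _; ring.
  by rewrite ExD ?ExZ; [ring|sm..].
by ring.
Qed.

Lemma Ex_cubV_sqr : Ex (fun x => \sum_a cubV x a ^+ 2) = 2 * trgram.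
Proof.
have := Ex_cubV_sqr_weighted 0 0; rewrite !(mulr0, mul0r) subr0.
under eq_fun do rewrite mul0r addr0 cos0 mulr1; move=> ->.
under eq_fun do rewrite mul0r addr0 cos0.
by rewrite (gE_cst gE) mulr1.
Qed.

Lemma Ex_cubic_sqr : Ex (fun x => cubic x ^+ 2) = 6 * trgram.
Proof.
transitivity (Ex (fun x => cubic x * cubic x)); first by [].
rewrite (Ex_cubic tame_cubic).
transitivity (Ex (fun x => 3 * \sum_a cubV x a ^+ 2)).
  apply: eq_Ex => x; rewrite mulr_sumr; apply: eq_bigr => a _.
  by rewrite expr2; ring.
by rewrite ExZ ?Ex_cubV_sqr; [ring|sm].
Qed.

(** The remainder in the differential equation of the characteristic function. *)
Definition cubRem x := 18 * (\sum_a gramL x a * cubV x a) + 9 * (\sum_a cubV x a * cubU x a).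

Lemma smooth_cubRem : smooth cubRem. Proof. by rewrite /cubRem; sm. Qed.

Lemma Ex_cubic_sin s th : Ex (fun x => cubic x * sin (s * cubic x + th)) =
  6 * trgram * s * Ex (fun x => cos (s * cubic x + th))
  - s ^+ 2 * Ex (fun x => cubRem x * sin (s * cubic x + th)).
Proof.
have tS := tame_sin (tame_add (tame_mul (tame_cst s) tame_cubic) (tame_cst th)).
rewrite (Ex_cubic tS).
transitivity (3 * s * Ex (fun x => (\sum_a cubV x a ^+ 2) * cos (s * cubic x + th))).
  rewrite -ExZ; last by sm.
  apply: eq_Ex => x; rewrite mulr_suml mulr_sumr; apply: eq_bigr => a _.
  by rewrite expr2; ring.
rewrite Ex_cubV_sqr_weighted.
have -> : Ex (fun x => cubRem x * sin (s * cubic x + th)) =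
   18 * Ex (fun x => (\sum_a gramL x a * cubV x a) * sin (s * cubic x + th))
   + 9 * Ex (fun x => (\sum_a cubV x a * cubU x a) * sin (s * cubic x + th)).
  rewrite -!ExZ; [|sm..]; rewrite -ExD; [|sm..]; apply: eq_Ex => x.
  by rewrite /cubRem; ring.
by ring.
Qed.

Lemma trgram_ge0 : 0 <= trgram.
Proof.
by apply: sumr_ge0 => a _; apply: sumr_ge0 => c _; apply: sumr_ge0 => d _;
  rewrite -expr2 sqr_ge0.
Qed.

Variable rho : R.
Hypothesis rho_gt0 : 0 < rho.
Hypothesis frho : forall x : J -> R,
  \sum_c \sum_d (\sum_a f a c d * x a) ^+ 2 <= rho * \sum_a x a ^+ 2.

(** The matrix gram has operator norm at most rho: apply frho to each column of
    gram and complete the square. *)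
Lemma sqgram_le : sqgram <= rho * trgram.
Proof.
rewrite /sqgram exchange_big /trgram mulr_sumr; apply: ler_sum => b _.
set X := (X in X <= _).
have XE : X = \sum_c \sum_d f b c d * (\sum_a f a c d * gram a b).
  rewrite /X; transitivity (\sum_a \sum_c \sum_d f b c d * (f a c d * gram a b)).
    apply: eq_bigr => a _; rewrite expr2 {1}/gram mulr_suml; apply: eq_bigr => c _.
    by rewrite mulr_suml; apply: eq_bigr => d _; ring.
  rewrite exchange_big /=; apply: eq_bigr => c _; rewrite exchange_big /=.
  by apply: eq_bigr => d _; rewrite mulr_sumr.
have h : \sum_c \sum_d (\sum_a f a c d * gram a b) ^+ 2 <= rho * X.
  by have := frho (fun a => gram a b).
have : 2 * X <= rho * gram b b + rho^-1 * (rho * X).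
  apply: (@le_trans _ _ (rho * gram b b + rho^-1 *
     \sum_c \sum_d (\sum_a f a c d * gram a b) ^+ 2)); last first.
    by rewrite lerD2l ler_wpM2l// invr_ge0 ltW.
  rewrite {1}XE /(gram b b) !mulr_sumr -big_split /=; apply: ler_sum => c _.
  rewrite !mulr_sumr -big_split /=; apply: ler_sum => d _.
  set Z := \sum_a _; set y := f b c d.
  rewrite -subr_ge0 (_ : _ - _ = rho^-1 * (rho * y - Z) ^+ 2).
    by rewrite mulr_ge0 ?sqr_ge0// invr_ge0 ltW.
  by field; rewrite lt0r_neq0.
rewrite mulKf ?lt0r_neq0//; lra.
Qed.

(** Cauchy-Schwarz with the weight sqrt rho, which balances the second moments of
    cubV, of order trgram, and of gramL and cubU, of order rho * trgram. *)
Lemma Ex_cubRem_le (S : (J -> R) -> R) : smooth S -> (forall x, `|S x| <= 1) ->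
  `|Ex (fun x => cubRem x * S x)| <= 108 * trgram * Num.sqrt rho.
Proof.
move=> sS S1; set l := Num.sqrt rho.
have l0 : 0 < l by rewrite sqrtr_gt0.
have rhoE : rho = l * l by rewrite -expr2 sqr_sqrtr// ltW.
pose B x := 27 / 2 * l * (\sum_a cubV x a ^+ 2) + 9 * l^-1 * (\sum_a gramL x a ^+ 2)
   + 9 / 2 * l^-1 * (\sum_a cubU x a ^+ 2).
have sB : smooth B by rewrite /B; sm.
have sR := smooth_cubRem.
have amgm (u v : R) : `|u * v| <= 2^-1 * (l * v ^+ 2 + l^-1 * u ^+ 2).
  rewrite ler_norml; apply/andP; split.
    rewrite -subr_ge0 (_ : _ - _ = 2^-1 * l^-1 * (l * v + u) ^+ 2).
      by rewrite mulr_ge0 ?sqr_ge0// mulr_ge0// invr_ge0 ltW.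
    by field; rewrite lt0r_neq0.
  rewrite -subr_ge0 (_ : _ - _ = 2^-1 * l^-1 * (l * v - u) ^+ 2).
    by rewrite mulr_ge0 ?sqr_ge0// mulr_ge0// invr_ge0 ltW.
  by field; rewrite lt0r_neq0.
have sumle (u v : J -> R) : `|\sum_a u a * v a| <=
    2^-1 * (l * (\sum_a v a ^+ 2) + l^-1 * (\sum_a u a ^+ 2)).
  apply: le_trans (ler_norm_sum _ _ _) _.
  by rewrite !mulr_sumr -big_split mulr_sumr; apply: ler_sum => a _; exact: amgm.
apply: (@le_trans _ _ (Ex B)).
  apply: Ex_abs_le => //; first by sm.
  move=> x; rewrite normrM; apply: (@le_trans _ _ `|cubRem x|); first by rewrite ler_piMr.
  rewrite /cubRem; apply: le_trans (ler_normD _ _) _; rewrite !normrM.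
  have h1 := sumle (gramL x) (cubV x).
  have h2 := sumle (cubU x) (cubV x).
  have -> : \sum_a cubV x a * cubU x a = \sum_a cubU x a * cubV x a.
    by apply: eq_bigr => a _; rewrite mulrC.
  rewrite (ger0_norm (_ : 0 <= 18))// (ger0_norm (_ : 0 <= 9))// /B.
  move: h1 h2; lra.
rewrite /B !ExD ?ExZ; [|sm..].
rewrite Ex_cubV_sqr Ex_gramL_sqr.
have hU := Ex_cubU_sqr; have hs := sqgram_le.
have h1 : l^-1 * sqgram <= l * trgram.
  by rewrite mulrC ler_pdivrMr// -mulrA [trgram * l]mulrC mulrA -rhoE.
have h2 : l^-1 * Ex (fun x => \sum_a cubU x a ^+ 2) <= 16 * (l * trgram).
  apply: (@le_trans _ _ (16 * (l^-1 * sqgram))).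
    by rewrite mulrCA ler_wpM2l// invr_ge0 ltW.
  by rewrite ler_wpM2l.
move: h1 h2; rewrite -!mulrA; lra.
Qed.

(** Here 6 trgram is the variance of the form: its characteristic function solves
    gaussian_ode with c = 6 trgram and a remainder of order sqrt rho. *)
Lemma Ex_cos_cubic th :
  `|Ex (fun x => cos (cubic x + th)) - expR (- (3 * trgram)) * cos th|
    <= 108 * trgram * Num.sqrt rho.
Proof.
pose A s := Ex (fun x => cos (s * cubic x + th)).
pose D s := Ex (fun x => cubRem x * sin (s * cubic x + th)).
have dA (s : R) : is_derive s 1 A (- (6 * trgram * s * A s) + s ^+ 2 * D s).
  apply: (is_derive_eq (Ex_cos_derive th s smooth_cubic)).
  by rewrite Ex_cubic_sin /A /D; ring.
have c0 : 0 <= 6 * trgram by rewrite mulr_ge0 ?trgram_ge0.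
have hD (s : R) : `|D s| <= 108 * trgram * Num.sqrt rho.
  by apply: Ex_cubRem_le => [|x]; [sm|rewrite ler_norml sin_geN1 sin_le1].
have := gaussian_ode c0 dA hD.
rewrite (_ : A 0 = cos th); last first.
  by rewrite /A; under eq_fun do rewrite mul0r add0r; exact: gE_cst.
rewrite (_ : A 1 = Ex (fun x => cos (cubic x + th))); last first.
  by rewrite /A; under eq_fun do rewrite mul1r.
by rewrite (_ : 6 * trgram / 2 = 3 * trgram); last by field.
Qed.

End CubicForm.
End GaussExpectation.

(** * Stein's identity for the normal law *)

Section Density.
Context d (T : measurableType d) (R : realType).
Variables (mu nu : {measure set T -> \bar R}) (p : T -> R).
Hypothesis mp : measurable_fun setT p.
Hypothesis p0 : forall x, 0 <= p x.
Hypothesis nuE : forall A, measurable A -> nu A = (\int[mu]_(x in A) (p x)%:E)%E.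

Import HBNNSimple.

Local Lemma integral_density_indic E : measurable E ->
  (\int[nu]_x (\1_E x)%:E = \int[mu]_x ((\1_E x)%:E * (p x)%:E))%E.
Proof.
move=> mE; rewrite integral_indic// setIT nuE// [LHS]integral_mkcond.
apply: eq_integral => x _; rewrite patchE indicE; case: ifPn => xE.
  by rewrite mul1e.
by rewrite mul0e.
Qed.

Local Lemma integral_density_nnsfun (f : {nnsfun T >-> R}) :
  (\int[nu]_x (f x)%:E = \int[mu]_x ((f x)%:E * (p x)%:E))%E.
Proof.
under [LHS]eq_integral do rewrite fimfunE -fsumEFin//.
rewrite [LHS]ge0_integral_fsum//; last 2 first.
  - by move=> r; exact/measurable_EFinP/measurableT_comp.
  - by move=> n x _; rewrite EFinM nnfun_muleindic_ge0.
under [RHS]eq_integral.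
  move=> x xD; rewrite fimfunE -fsumEFin// ge0_mule_fsuml; last first.
    by move=> r; rewrite EFinM nnfun_muleindic_ge0.
  over.
rewrite [RHS]ge0_integral_fsum//; last 2 first.
  - move=> r; apply: emeasurable_funM; last exact/measurable_EFinP.
    by apply/measurable_EFinP; apply: measurableT_comp.
  - by move=> n x _; rewrite mule_ge0 ?(lee_fin _ (p x))// EFinM nnfun_muleindic_ge0.
apply: eq_fsbigr => r _.
transitivity (r%:E * \int[nu]_x (\1_(f @^-1` [set r]) x)%:E)%E.
  by rewrite !integralZl_indic_nnsfun//= integral_indic// setIT.
have [r0|r0] := leP 0 r.
  rewrite integral_density_indic// -ge0_integralZl//; first last.
  - by move=> x _; rewrite mule_ge0// lee_fin.
  - apply: emeasurable_funM; apply/measurable_EFinP => //.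
  by apply: eq_integral => x _; rewrite EFinM muleA.
rewrite preimage_nnfun0//; under [in RHS]eq_integral do rewrite indic0 mulr0 mul0e.
by under eq_integral do rewrite indic0; rewrite !integral0 mule0.
Qed.

Lemma ge0_integral_density (f : T -> \bar R) : measurable_fun setT f ->
  (forall x, 0 <= f x)%E ->
  (\int[nu]_x f x = \int[mu]_x (f x * (p x)%:E))%E.
Proof.
move=> mf f0; pose f_ := nnsfun_approx measurableT mf.
transitivity (lim (\int[nu]_x (f_ n x)%:E @[n --> \oo])%E).
  rewrite -monotone_convergence//=.
  - apply: eq_integral => ? /[!inE] xD; apply/esym/cvg_lim => //=.
    exact: cvg_nnsfun_approx.
  - by move=> n; exact/measurable_EFinP/measurable_funTS.
  - by move=> n ? _; rewrite lee_fin.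
  - by move=> ? _ ? ? mn; rewrite lee_fin; exact/lefP/nd_nnsfun_approx.
transitivity (lim (\int[mu]_x ((f_ n x)%:E * (p x)%:E) @[n --> \oo])%E).
  by apply: congr_lim; apply/funext => n; exact: integral_density_nnsfun.
rewrite -monotone_convergence//=.
- apply: eq_integral => x _; apply/cvg_lim => //.
  apply: cvgeZr => //; exact: cvg_nnsfun_approx.
- move=> n; apply: emeasurable_funM; apply/measurable_EFinP => //.
- by move=> n ? _; rewrite mule_ge0// lee_fin.
- move=> x _ m n mn; rewrite lee_wpmul2r ?lee_fin//; exact/lefP/nd_nnsfun_approx.
Qed.

Lemma integrable_density (f : T -> R) : measurable_fun setT f ->
  mu.-integrable setT (EFin \o (fun x => f x * p x)) ->
  nu.-integrable setT (EFin \o f).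
Proof.
move=> mf /integrableP[_ fi]; apply/integrableP; split; first exact/measurable_EFinP.
rewrite ge0_integral_density//; last first.
  by apply: measurableT_comp => //; exact/measurable_EFinP.
apply: le_lt_trans fi; apply: ge0_le_integral => //=.
- by move=> x _; rewrite mule_ge0// lee_fin.
- by apply: emeasurable_funM; apply/measurable_EFinP => //; apply: measurableT_comp.
- by apply/measurable_EFinP; apply: measurableT_comp => //; apply: measurable_funM.
- by move=> x _; rewrite lee_fin normrM (ger0_norm (p0 x)).
Qed.

Lemma integral_density (f : T -> R) : measurable_fun setT f ->
  mu.-integrable setT (EFin \o (fun x => f x * p x)) ->
  (\int[nu]_x (f x)%:E = \int[mu]_x (f x * p x)%:E)%E.
Proof.
move=> mf fi.
have mE : measurable_fun setT (EFin \o f) by exact/measurable_EFinP.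
rewrite [LHS]integralE [RHS]integralE; congr (_ - _)%E.
  rewrite ge0_integral_density//; last exact: measurable_funepos.
  apply: eq_integral => x _; rewrite !funeposE /=.
  have [fx|fx] := leP 0 (f x).
    by rewrite !max_l ?lee_fin// ?mulr_ge0.
  by rewrite !max_r ?lee_fin ?mul0e ?mulr_le0_ge0// ltW.
rewrite ge0_integral_density//; last exact: measurable_funeneg.
apply: eq_integral => x _; rewrite !funenegE /=.
have [fx|fx] := leP 0 (f x).
  by rewrite !max_r ?mul0e// lee_fin oppr_le0// mulr_ge0.
rewrite !max_l -?EFinN ?lee_fin ?oppr_ge0 ?mulr_le0_ge0 ?(ltW fx)//.
by rewrite -EFinM mulNr.
Qed.

End Density.

Section PolyGrowth.
Context {R : realType}.

Lemma poly_exp_bound (a : R) (m : nat) : 0 < a ->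
  exists2 K, 0 < K & forall y, 0 <= y -> (1 + y) ^+ m <= K * expR (a * y).
Proof.
case: m => [|m] a0.
  by exists 1 => // y y0; rewrite expr0 mul1r -[leLHS]expR0 ler_expR mulr_ge0// ltW.
pose b := a / m.+1%:R; have b0 : 0 < b by rewrite divr_gt0.
exists ((1 + b^-1) ^+ m.+1); first by rewrite exprn_gt0// addr_gt0// invr_gt0.
move=> y y0; have -> : expR (a * y) = expR (b * y) ^+ m.+1.
  have m0 : m.+1%:R != 0 :> R by rewrite pnatr_eq0.
  by rewrite -expRM_natl; congr expR; rewrite /b mulrA mulrCA divff// mulr1.
rewrite -exprMn; apply: lerXn2r; rewrite ?nnegrE ?addr_ge0//.
  by rewrite mulr_ge0 ?expR_ge0// addr_ge0// invr_ge0 ltW.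
apply: (@le_trans _ _ ((1 + b^-1) * (1 + b * y))).
  rewrite mulrDr mulr1 mulrDl mul1r mulKf ?lt0r_neq0//.
  rewrite -subr_ge0 (_ : _ - _ = b^-1 + b * y); last by ring.
  by rewrite addr_ge0 ?mulr_ge0 ?invr_ge0 // ltW.
by rewrite ler_wpM2l ?expR_ge1Dx// addr_ge0// invr_ge0 ltW.
Qed.

Definition poly_growth (F : R -> R) := exists C m, 0 <= C /\ forall x, `|F x| <= C * (1 + x ^+ 2) ^+ m.

Lemma poly_growthX (F : R -> R) : poly_growth F -> poly_growth (fun x => x * F x).
Proof.
move=> [C [m [C0 h]]]; exists C, m.+1; split => // x.
rewrite normrM exprS mulrCA ler_pM//.
rewrite -subr_ge0 (_ : _ - _ = (`|x| - 2^-1) ^+ 2 + 3 / 4).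
  by rewrite addr_ge0 ?sqr_ge0.
by rewrite -[x ^+ 2]ger0_norm ?sqr_ge0// normrX; field.
Qed.

Variable sigma : R.
Hypothesis sigma_gt0 : 0 < sigma.
Notation mu := (@lebesgue_measure R).
Let p := normal_pdf 0 sigma.
Let s2 := Num.sqrt 2 * sigma.

Let pE x : p x = normal_peak sigma * expR (- (x ^+ 2) / (sigma ^+ 2 *+ 2)).
Proof. by rewrite /p normal_pdfE ?lt0r_neq0// /normal_fun subr0. Qed.

(** A polynomial is absorbed by half of the Gaussian exponent, which leaves a
    normal density of twice the variance. *)
Lemma normal_pdf_growth (F : R -> R) : poly_growth F ->
  exists2 K, 0 <= K & forall x, `|F x * p x| <= K * normal_pdf 0 s2 x.
Proof.
move=> [C [m [C0 h]]].
have a0 : 0 < (sigma ^+ 2 *+ 4)^-1 by rewrite invr_gt0 pmulrn_rgt0// exprn_gt0.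
have [K K0 hK] := poly_exp_bound m a0.
have s20 : 0 < s2 by rewrite mulr_gt0// sqrtr_gt0.
have pk := normal_peak_gt0 (lt0r_neq0 s20).
have pk1 := normal_peak_gt0 (lt0r_neq0 sigma_gt0).
exists (C * K * normal_peak sigma / normal_peak s2).
  by rewrite !mulr_ge0 ?invr_ge0// ltW.
move=> x; rewrite normrM (ger0_norm (normal_pdf_ge0 _ _ _)).
apply: (@le_trans _ _ (C * (K * expR ((sigma ^+ 2 *+ 4)^-1 * x ^+ 2)) * p x)).
  rewrite ler_wpM2r ?normal_pdf_ge0//; apply: le_trans (h x) _.
  by rewrite ler_wpM2l// hK// sqr_ge0.
rewrite pE normal_pdfE ?lt0r_neq0// /normal_fun subr0.
set e1 := expR _; set e2 := expR _; set e3 := expR _.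
have -> : e3 = e1 * e2.
  rewrite /e1 /e2 -expRD; congr expR; rewrite /s2 exprMn sqr_sqrtr//.
  by field; rewrite lt0r_neq0.
rewrite le_eqVlt; apply/orP; left; apply/eqP; field.
by rewrite lt0r_neq0.
Qed.

Lemma integrable_growth_pdf (F : R -> R) : measurable_fun setT F -> poly_growth F ->
  mu.-integrable setT (EFin \o (fun x => F x * p x)).
Proof.
move=> mF /normal_pdf_growth[K K0 hK].
apply: (@le_integrable _ _ _ mu _ measurableT _ (EFin \o (fun x => K * normal_pdf 0 s2 x))).
- by apply/measurable_EFinP; apply: measurable_funM => //; exact: measurable_normal_pdf.
- move=> x _ /=; rewrite lee_fin; apply: le_trans (hK x) _.
  by rewrite ler_norm.
- have := integrableZl measurableT K (integrable_normal_pdf 0 s2).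
  by apply: eq_integrable.
Qed.

Lemma integrable_normal_prob (F : R -> R) : measurable_fun setT F -> poly_growth F ->
  (normal_prob 0 sigma).-integrable setT (EFin \o F).
Proof.
move=> mF gF; apply: (@integrable_density _ _ _ mu _ p) => //.
- exact: measurable_normal_pdf.
- by move=> x; exact: normal_pdf_ge0.
- exact: integrable_growth_pdf.
Qed.

Lemma normal_prob_integralE (F : R -> R) : measurable_fun setT F -> poly_growth F ->
  (\int[normal_prob 0 sigma]_x (F x)%:E = \int[mu]_x (F x * p x)%:E)%E.
Proof.
move=> mF gF; apply: (@integral_density _ _ _ mu) => //.
- exact: measurable_normal_pdf.
- by move=> x; exact: normal_pdf_ge0.
- exact: integrable_growth_pdf.
Qed.


Lemma is_derive_normal_pdf (x : R) : is_derive x 1 p (- (x / sigma ^+ 2) * p x).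
Proof.
have -> : p = fun x => normal_peak sigma * expR (- (sigma ^+ 2 *+ 2)^-1 * x ^+ 2).
  by apply/funext => y; rewrite pE; congr (_ * expR _); ring.
have d2 : is_derive x 1 (fun x : R => x ^+ 2) (2 * x).
  apply: (is_derive_eq (is_deriveX 2 (is_derive_id x (1 : R)))).
  by rewrite /GRing.scale /= expr1 mulr1.
pose c := - (sigma ^+ 2 *+ 2)^-1; rewrite -/c.
have d1 : is_derive x 1 (fun x : R => c * x ^+ 2) (c * (2 * x)) := is_deriveZ c d2.
have d3 : is_derive x 1 (fun x : R => expR (c * x ^+ 2))
    (expR (c * x ^+ 2) * (c * (2 * x))) := is_derive1_comp (is_derive_expR _) d1.
apply: (is_derive_eq (is_deriveZ (normal_peak sigma) d3)).
by rewrite /GRing.scale /= /c; field; rewrite lt0r_neq0.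
Qed.

Lemma normal_pdf_cvg0 (F : R -> R) (u : R^nat) : poly_growth F ->
  (forall n, n%:R <= `|u n|) -> F (u n) * p (u n) @[n --> \oo] --> 0.
Proof.
move=> gF hu.
have [K K0 hK] := normal_pdf_growth (poly_growthX gF).
have s20 : 0 < s2 by rewrite mulr_gt0// sqrtr_gt0.
apply/cvgr0Pnorm_le => e e0.
near=> n.
have n0 : 0 < n%:R :> R by rewrite ltr0n; near: n; exists 1%N.
have nu : n%:R <= `|u n| by [].
have := hK (u n); rewrite -mulrA normrM => h.
have h2 : n%:R * `|F (u n) * p (u n)| <= K * normal_peak s2.
  apply: le_trans (_ : `|u n| * `|F (u n) * p (u n)| <= _); first exact: ler_wpM2r.
  by apply: le_trans h _; rewrite ler_wpM2l// normal_pdf_ub// lt0r_neq0.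
rewrite -(ler_pM2l n0); apply: le_trans h2 _.
rewrite -ler_pdivrMr//; near: n; exact: nbhs_infty_ger.
Unshelve. all: by end_near. Qed.

(** The function F p, with p the density, vanishes at infinity and has derivative
    (dF - x F / sigma^2) p, whose integral is therefore 0. *)
Lemma stein_normal_prob (F dF : R -> R) : (forall x : R, is_derive x 1 F (dF x)) ->
  continuous dF -> poly_growth F -> poly_growth dF ->
  (\int[normal_prob 0 sigma]_x (x * F x)%:E =
   (sigma ^+ 2)%:E * \int[normal_prob 0 sigma]_x (dF x)%:E)%E.
Proof.
move=> hF cdF gF gdF.
have cF : continuous F.
  by move=> x; apply/differentiable_continuous/derivable1_diffP; have [] := hF x.
have mF := continuous_measurable_fun cF.
have mdF := continuous_measurable_fun cdF.
have cp : continuous p by apply: continuous_normal_pdf; exact: lt0r_neq0.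
have gxF := poly_growthX gF.
have mxF : measurable_fun setT (fun x : R => x * F x) by apply: measurable_funM.
have idF := integrable_growth_pdf mdF gdF.
have ixF := integrable_growth_pdf mxF gxF.
pose h x := dF x * p x - (sigma ^+ 2)^-1 * (x * F x * p x).
have ixF' : mu.-integrable setT (EFin \o (fun x : R => (sigma ^+ 2)^-1 * (x * F x * p x))).
  have := integrableZl measurableT (sigma ^+ 2)^-1 ixF.
  by apply: eq_integrable.
have ih : mu.-integrable setT (EFin \o h).
  by have := integrableB measurableT idF ixF'; apply: eq_integrable.
have ch : continuous h.
  move=> x; apply: cvgB; first by apply: cvgM; [exact: cdF|exact: cp].
  apply: cvgM; first exact: cvg_cst.
  by apply: cvgM; [apply: cvgM; [exact: cvg_id|exact: cF]|exact: cp].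
have dH (x : R) : is_derive x 1 (fun x : R => F x * p x) (h x).
  apply: (is_derive_eq (is_deriveM (hF x) (is_derive_normal_pdf x))).
  by rewrite /h /GRing.scale /=; ring.
have H0 : (\int[mu]_x (h x)%:E = 0)%E.
  pose hn (n : nat) : R -> R := h \_ `[- n.+1%:R, n.+1%:R].
  have hnE (n : nat) : (\int[mu]_x (hn n x)%:E =
      (F n.+1%:R * p n.+1%:R - F (- n.+1%:R) * p (- n.+1%:R))%:E)%E.
    transitivity (\int[mu]_(x in `[(- n.+1%:R)%R, (n.+1%:R)%R]) (h x)%:E)%E.
      rewrite [RHS]integral_mkcond; apply: eq_integral => x _.
      by rewrite restrict_EFin.
    rewrite (@continuous_FTC2 _ _ (fun x : R => F x * p x)) ?EFinB//.
    - by rewrite gtrN ?ltr0n.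
    - exact: continuous_subspaceT.
    - have cH (x : R) : {for x, continuous (fun x : R => F x * p x)}.
        by apply: cvgM; [exact: cF|exact: cp].
      split => [x _|| ]; first by have [] := dH x.
      + by apply: cvg_at_right_filter; exact: cH.
      + by apply: cvg_at_left_filter; exact: cH.
    - by move=> x _; rewrite derive1E; apply: derive_val; exact: dH.
  have mh : measurable_fun setT h := continuous_measurable_fun ch.
  have [_ _ cv] : [/\ mu.-integrable setT (EFin \o h),
      (\int[mu]_x `|(hn n x)%:E - (h x)%:E| @[n --> \oo] --> 0)%E &
      (\int[mu]_x (hn n x)%:E @[n --> \oo] --> \int[mu]_x (h x)%:E)%E].
    apply: (@dominated_convergence _ _ _ mu setT measurableT
      (fun n => EFin \o hn n) (EFin \o h) (fun x => `|h x|%:E)).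
    - move=> n; apply/measurable_EFinP.
      by apply/(measurable_restrictT _ _).1 => //; exact: measurable_funTS.
    - exact/measurable_EFinP.
    - apply: aeW => x _; apply/fine_cvgP; split; first exact: nearW.
      apply: cvg_near_cst; near=> n.
      rewrite /hn /= patchE ifT// inE /= in_itv /= -ler_norml.
      near: n; have [N _ hN] := @nbhs_infty_ger R `|x|.
      exists N => // n Nn; apply: le_trans (hN n Nn) _; by rewrite ler_nat.
    - by have := integrable_abse ih; apply: eq_integrable.
    - apply: aeW => x n _; rewrite /= lee_fin /hn patchE; case: ifP => // _.
      by rewrite normr0.
  apply: (cvg_unique _ cv) => //.
  rewrite (_ : (fun n => _) = (fun n => (F n.+1%:R * p n.+1%:R - F (- n.+1%:R) * p (- n.+1%:R))%:E)); last first.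
    by apply/funext => n; exact: hnE.
  apply: cvg_EFin; first exact: nearW.
  rewrite -[0]subr0; apply: cvgB.
    apply: (normal_pdf_cvg0 (u := fun n => n.+1%:R) gF) => n.
    by rewrite normr_nat ler_nat.
  apply: (normal_pdf_cvg0 (u := fun n => - n.+1%:R) gF) => n.
  by rewrite normrN normr_nat ler_nat.
rewrite !normal_prob_integralE//.
have : (\int[mu]_x (h x)%:E = \int[mu]_x (dF x * p x)%:E -
    ((sigma ^+ 2)^-1)%:E * \int[mu]_x (x * F x * p x)%:E)%E.
  rewrite -integralZl//.
  rewrite -(integralB measurableT idF ixF').
  by apply: eq_integral => x _; rewrite /= EFinB.
have fX : (\int[mu]_x (x * F x * p x)%:E)%E \is a fin_num.
  by apply: integrable_fin_num ixF.
have fY : (\int[mu]_x (dF x * p x)%:E)%E \is a fin_num.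
  by apply: integrable_fin_num idF.
rewrite H0 -(fineK fX) -(fineK fY) => /eqP.
rewrite -EFinM -EFinB eqe eq_sym subr_eq0 => /eqP ->.
by rewrite -EFinM mulVKf// lt0r_neq0// exprn_gt0.
Unshelve. all: by end_near. Qed.

End PolyGrowth.

(** * Independent standard normal variables *)

Section TameAnalysis.
Context {R : realType} {J : finType}.
Implicit Types (F : (J -> R) -> R) (DF : J -> (J -> R) -> R).

Definition upd (y : J -> R) j (a : R) : J -> R := fun i => if i == j then a else y i.

Lemma tame_measurable F DF d (T : measurableType d) (g : J -> T -> R) :
  tame F DF -> (forall j, measurable_fun setT (g j)) ->
  measurable_fun setT (fun w => F (fun j => g j w)).
Proof.
move=> h mg; elim: h => [c|j|{}F {}DF G DG _ h1 _ h2|{}F {}DF G DG _ h1 _ h2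
  |{}F {}DF _ h|{}F {}DF _ h].
- exact: measurable_cst.
- exact: mg.
- exact: measurable_funD.
- exact: measurable_funM.
- apply: (measurableT_comp (f := @cos R)) => //.
  by apply: continuous_measurable_fun; exact: continuous_cos.
- apply: (measurableT_comp (f := @sin R)) => //.
  by apply: continuous_measurable_fun; exact: continuous_sin.
Qed.

Lemma tame_slice F DF (y : J -> R) j (a : R) : tame F DF ->
  is_derive a 1 (fun s : R => F (upd y j s)) (DF j (upd y j a)).
Proof.
elim => [c|i|{}F {}DF G DG _ h1 _ h2|{}F {}DF G DG _ h1 _ h2
  |{}F {}DF _ h|{}F {}DF _ h].
- exact: is_derive_cst.
- rewrite /upd eq_sym; case: eqP => _; [exact: is_derive_id|exact: is_derive_cst].
- exact: (is_deriveD h1 h2).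
- apply: (is_derive_eq (is_deriveM h1 h2)).
  by rewrite /GRing.scale /=; ring.
- apply: (is_derive_eq (is_derive1_comp (is_derive_cos _) h)).
  by rewrite mulNr.
- exact: (is_derive1_comp (is_derive_sin _) h).
Qed.

Lemma smooth_slice_continuous F (y : J -> R) j : smooth F ->
  continuous (fun a : R => F (upd y j a)).
Proof.
move=> [DF hF] a; have [+ _] := tame_slice y j a hF.
by move=> /derivable1_diffP /differentiable_continuous.
Qed.

Lemma smooth_growth F : smooth F ->
  exists C m, 0 <= C /\ forall x, `|F x| <= C * (1 + \sum_j x j ^+ 2) ^+ m.
Proof.
have S1 (x : J -> R) : 1 <= 1 + \sum_j x j ^+ 2.
  by rewrite lerDl sumr_ge0// => j _; exact: sqr_ge0.
have S0 (x : J -> R) : 0 <= 1 + \sum_j x j ^+ 2 by apply: le_trans (S1 x).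
move=> [DF]; elim=> [c|j|{}F {}DF G DG _ [C1 [m1 [C10 h1]]] _ [C2 [m2 [C20 h2]]]
  |{}F {}DF G DG _ [C1 [m1 [C10 h1]]] _ [C2 [m2 [C20 h2]]]
  |{}F {}DF _ _|{}F {}DF _ _].
- by exists `|c|, 0%N; split => // x; rewrite expr0 mulr1.
- exists 1, 1%N; split => // x; rewrite mul1r expr1.
  apply: (@le_trans _ _ (1 + x j ^+ 2)).
    rewrite -subr_ge0 (_ : _ - _ = (`|x j| - 2^-1) ^+ 2 + 3 / 4).
      by rewrite addr_ge0 ?sqr_ge0.
    by rewrite -[x j ^+ 2]ger0_norm ?sqr_ge0// normrX; field.
  rewrite lerD2l (bigD1 j)//= lerDl sumr_ge0// => i _; exact: sqr_ge0.
- exists (C1 + C2), (m1 + m2)%N; split => [|x]; first exact: addr_ge0.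
  apply: le_trans (ler_normD _ _) _; rewrite mulrDl lerD//.
    by apply: le_trans (h1 x) _; rewrite ler_wpM2l// ler_weXn2l// leq_addr.
  by apply: le_trans (h2 x) _; rewrite ler_wpM2l// ler_weXn2l// leq_addl.
- exists (C1 * C2), (m1 + m2)%N; split => [|x]; first exact: mulr_ge0.
  by rewrite normrM exprD mulrACA ler_pM.
- exists 1, 0%N; split => // x; rewrite mul1r expr0.
  by rewrite ler_norml cos_geN1 cos_le1.
- exists 1, 0%N; split => // x; rewrite mul1r expr0.
  by rewrite ler_norml sin_geN1 sin_le1.
Qed.

Lemma smooth_slice_growth F (y : J -> R) j : smooth F ->
  poly_growth (fun a : R => F (upd y j a)).
Proof.
move=> /smooth_growth[C [m [C0 h]]].
pose S := \sum_(i | i != j) y i ^+ 2.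
have S0 : 0 <= S by apply: sumr_ge0 => i _; exact: sqr_ge0.
exists (C * (1 + S) ^+ m), m; split.
  by rewrite mulr_ge0// exprn_ge0// addr_ge0.
move=> a; apply: le_trans (h _) _; rewrite -mulrA ler_wpM2l// -exprMn.
have -> : \sum_i upd y j a i ^+ 2 = a ^+ 2 + S.
  rewrite (bigD1 j)//= {1}/upd eqxx; congr (_ + _).
  by apply: eq_bigr => i /negbTE ij; rewrite /upd ij.
apply: lerXn2r; rewrite ?nnegrE.
- by rewrite addr_ge0 // addr_ge0 ?sqr_ge0.
- by rewrite mulr_ge0 ?addr_ge0 ?sqr_ge0.
rewrite -subr_ge0 (_ : _ - _ = S * a ^+ 2); last by ring.
by rewrite mulr_ge0 ?sqr_ge0.
Qed.

Lemma sum_pow_bound (a : J -> R) m : (forall j, 0 <= a j) ->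
  (1 + \sum_j a j) ^+ m <= #|J|.+1%:R ^+ m * (1 + \sum_j (1 + a j) ^+ m).
Proof.
move=> a0; have [b [b1 ab bm]] : exists b, [/\ 1 <= b, forall j, a j <= b &
    b ^+ m <= 1 + \sum_j (1 + a j) ^+ m].
  have p0 j : 0 <= (1 + a j) ^+ m by rewrite exprn_ge0// addr_ge0.
  case: (pickP (fun j => 1 < a j)) => [j0 j01|none].
    case: (@arg_maxP _ _ _ j0 predT a isT) => j _ hj.
    exists (a j); split => [|i|]; last 1 first.
    - rewrite (bigD1 j)//= addrCA.
      apply: (@le_trans _ _ ((1 + a j) ^+ m)).
        by apply: lerXn2r; rewrite ?nnegrE ?addr_ge0// lerDr.
      by rewrite lerDl addr_ge0// sumr_ge0.
    - by apply: ltW; apply: lt_le_trans j01 _; exact: hj.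
    - exact: hj.
  exists 1; split => // [j|]; first by rewrite leNgt none.
  by rewrite expr1n lerDl sumr_ge0.
apply: (@le_trans _ _ ((#|J|.+1%:R * b) ^+ m)).
  apply: lerXn2r; rewrite ?nnegrE ?addr_ge0 ?sumr_ge0 ?mulr_ge0//.
    by apply: le_trans b1.
  rewrite -natr1 mulrDl mul1r addrC lerD// mulr_natl.
  apply: le_trans (_ : \sum_(j : J) b <= _); first exact: ler_sum.
  by rewrite sumr_const.
by rewrite exprMn ler_wpM2l// exprn_ge0.
Qed.

End TameAnalysis.

Section TupleSigma.
Context {R : realType} (n : nat).

Definition tuple_box (A : 'I_n -> set R) : set (n.-tuple R) :=
  [set t | forall i, A i (tnth t i)].

Definition tuple_boxes : set (set (n.-tuple R)) :=
  [set B | exists2 A : 'I_n -> set R, (forall i, measurable (A i)) & B = tuple_box A].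

(** Boxes form a generating pi-system, on which independence is checked. *)
Lemma measurable_tuple_boxes : measurable = <<s tuple_boxes >>.
Proof.
apply/seteqP; split; last first.
  apply: smallest_sub; first exact: sigma_algebra_measurable.
  move=> _ [A mA ->]; rewrite (_ : tuple_box A = \bigcap_(i in [set: 'I_n]) ((@tnth n R ^~ i) @^-1` A i)).
    apply: fin_bigcap_measurable => // i _.
    by rewrite -[X in measurable X]setTI; exact: measurable_tnth.
  by apply/seteqP; split => t h i; [move=> _; exact: h|exact: h i I].
apply: smallest_sub; first exact: smallest_sigma_algebra.
move=> B; rewrite -bigcup_seq => -[i /= _ [A mA <-]].
apply: sub_sigma_algebra; exists (fun k => if k == i then A else setT).
  by move=> k; case: ifP.
apply/seteqP; split => t /=; first by move=> [_ h] k; case: eqP => // ->.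
by move=> /(_ i); rewrite eqxx.
Qed.

Lemma tuple_boxes_setI : setI_closed tuple_boxes.
Proof.
move=> _ _ [A mA ->] [B mB ->]; exists (fun i => A i `&` B i).
  by move=> i; exact: measurableI.
apply/seteqP; split => t /=; first by move=> [h k] i.
by move=> h; split => i; have [] := h i.
Qed.

Lemma tuple_boxesT : tuple_boxes setT.
Proof. by exists (fun=> setT) => //; apply/seteqP; split. Qed.

End TupleSigma.

Section GaussFamily.
Context d (Omega : measurableType d) (R : realType) (P : probability Omega R).

(** Independent N(0, 1) variables.  The law is that of a rescaled N(0, sigma^2)
    variable, as it arises for normalized coefficients. *)
Record gauss_family (J : finType) (g : J -> Omega -> R) : Prop := {
  gf_meas : forall j, measurable_fun setT (g j) ;
  gf_law : forall j, exists2 sigma : R, 0 < sigma & forall A : set R, measurable A ->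
    P ((fun w => sigma * g j w) @^-1` A) = normal_prob 0 sigma A ;
  gf_ind : forall A : J -> set R, (forall j, measurable (A j)) ->
    P [set w | forall j, A j (g j w)] = (\prod_j P (g j @^-1` A j))%E }.

Lemma poly_growth_scale (F : R -> R) (c : R) : poly_growth F ->
  poly_growth (fun y => F (c * y)).
Proof.
move=> [C [m [C0 h]]]; exists (C * (1 + c ^+ 2) ^+ m), m; split.
  by rewrite mulr_ge0// exprn_ge0// addr_ge0 ?sqr_ge0.
move=> y; apply: le_trans (h _) _; rewrite -mulrA ler_wpM2l// -exprMn.
apply: lerXn2r; rewrite ?nnegrE ?mulr_ge0 ?addr_ge0 ?sqr_ge0//.
rewrite -subr_ge0 (_ : _ - _ = c ^+ 2 + y ^+ 2); last by ring.
by rewrite addr_ge0 ?sqr_ge0.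
Qed.

Lemma poly_growthZ (F : R -> R) (c : R) : poly_growth F ->
  poly_growth (fun y => c * F y).
Proof.
move=> [C [m [C0 h]]]; exists (`|c| * C), m; split; first exact: mulr_ge0.
by move=> y; rewrite normrM -mulrA ler_wpM2l.
Qed.

Section OneVariable.
Variables (X : Omega -> R) (sigma : R).
Hypotheses (mX : measurable_fun setT X) (sigma_gt0 : 0 < sigma).
Hypothesis lawX : forall A : set R, measurable A ->
  P ((fun w => sigma * X w) @^-1` A) = normal_prob 0 sigma A.

(** The normal law lives on the generated Borel structure of the real line, which
    has to be named explicitly. *)
Local Lemma msX : @measurable_fun _ _ Omega (measurableTypeR R) setT
  (fun w => sigma * X w).
Proof.
have : measurable_fun setT (fun w => sigma * X w) by exact: measurable_funM.
exact.
Qed.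

Local Lemma law_eq_integral (G : R -> \bar R) :
  (\int[normal_prob 0 sigma]_x G x
   = \int[@distribution _ _ Omega (measurableTypeR R) R P
       (@mfun_Sub _ _ Omega (measurableTypeR R) _ (mem_set msX))]_x G x)%E.
Proof.
have h := @eq_measure_integral _ (measurableTypeR R) R setT.
apply: h => A mA _; exact: (esym (lawX mA)).
Qed.

Local Lemma law_integrable0 (G : R -> R) : measurable_fun setT G -> poly_growth G ->
  P.-integrable setT (EFin \o (fun w => G (sigma * X w))).
Proof.
move=> mG gG; have /integrableP[_ iG] := integrable_normal_prob sigma_gt0 mG gG.
apply/integrableP; split.
  by apply/measurable_EFinP; apply: (measurableT_comp mG); exact: msX.
move: iG; rewrite law_eq_integral ge0_integral_distribution//.
by apply: measurableT_comp => //; exact/measurable_EFinP.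
Qed.

Local Lemma law_integral0 (G : R -> R) : measurable_fun setT G -> poly_growth G ->
  (\int[P]_w (G (sigma * X w))%:E = \int[normal_prob 0 sigma]_x (G x)%:E)%E.
Proof.
move=> mG gG; rewrite law_eq_integral integral_distribution//.
  exact/measurable_EFinP.
exact: law_integrable0.
Qed.

Lemma law_integrable (F : R -> R) : measurable_fun setT F -> poly_growth F ->
  P.-integrable setT (EFin \o (fun w => F (X w))).
Proof.
move=> mF gF.
have := @law_integrable0 (fun y => F (sigma^-1 * y)) _ (poly_growth_scale _ gF).
have mF' : measurable_fun setT (fun y => F (sigma^-1 * y)).
  by apply: (measurableT_comp mF); exact: measurable_funM.
move=> /(_ mF'); apply: eq_integrable => //.
by move=> w _ /=; rewrite mulKf// lt0r_neq0.
Qed.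

(** The variance in Stein's identity disappears in the scaling. *)
Lemma law_stein (F dF : R -> R) : (forall x : R, is_derive x 1 F (dF x)) ->
  continuous dF -> poly_growth F -> poly_growth dF ->
  (\int[P]_w (X w * F (X w))%:E = \int[P]_w (dF (X w))%:E)%E.
Proof.
move=> hF cdF gF gdF; set c := sigma^-1.
have s0 := lt0r_neq0 sigma_gt0.
have cF : continuous F.
  by move=> x; apply/differentiable_continuous/derivable1_diffP; have [] := hF x.
have mc : measurable_fun setT (fun y : R => c * y) by exact: measurable_funM.
pose G y := c * F (c * y); pose dG y := c ^+ 2 * dF (c * y).
have hG (x : R) : is_derive x 1 G (dG x).
  have d1 : is_derive x 1 (fun y : R => c * y) c.
    apply: (is_derive_eq (is_deriveZ c (is_derive_id x (1 : R)))).
    by rewrite /GRing.scale /= mulr1.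
  have d2 : is_derive x 1 (fun y : R => F (c * y)) (dF (c * x) * c) :=
    is_derive1_comp (hF _) d1.
  apply: (is_derive_eq (is_deriveZ c d2)).
  by rewrite /GRing.scale /= /dG; ring.
have cG : continuous dG.
  move=> x; apply: cvgM; first exact: cvg_cst.
  apply: (continuous_comp (f := fun y => c * y)); last exact: cdF.
  by apply: cvgM; [exact: cvg_cst|exact: cvg_id].
have gG : poly_growth G by apply/poly_growthZ/poly_growth_scale.
have gdG : poly_growth dG by apply/poly_growthZ/poly_growth_scale.
have mG : measurable_fun setT G.
  by apply: measurable_funM => //; apply: measurableT_comp mc; exact: continuous_measurable_fun.
have mdF' : measurable_fun setT (fun y => dF (c * y)).
  by apply: measurableT_comp mc; exact: continuous_measurable_fun.
transitivity (\int[P]_w (sigma * X w * G (sigma * X w))%:E)%E.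
  apply: eq_integral => w _; rewrite /G /c mulKf//; congr EFin.
  by rewrite mulrACA divff// mul1r.
rewrite (@law_integral0 (fun y => y * G y)); first last.
- exact: poly_growthX.
- exact: measurable_funM.
rewrite (stein_normal_prob sigma_gt0 hG)//.
transitivity (\int[normal_prob 0 sigma]_x (dF (c * x))%:E)%E.
  rewrite -integralZl//; last first.
    apply: integrable_normal_prob => //; exact: continuous_measurable_fun.
  apply: eq_integral => x _; rewrite -EFinM /dG mulrA -exprMn divff//.
  by rewrite expr1n mul1r.
rewrite -law_integral0//; last exact: poly_growth_scale.
by apply: eq_integral => w _; rewrite /c mulKf.
Qed.

End OneVariable.

Section Family.
Variables (J : finType) (g : J -> Omega -> R).
Hypothesis gf : gauss_family g.

Lemma smooth_integrable (F : (J -> R) -> R) : smooth F ->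
  P.-integrable setT (EFin \o (fun w => F (fun j => g j w))).
Proof.
move=> sF; have [C [m [C0 hC]]] := smooth_growth sF; have [DF hF] := sF.
pose B w := C * (#|J|.+1%:R ^+ m * (1 + \sum_j (1 + g j w ^+ 2) ^+ m)).
have gi j : P.-integrable setT (EFin \o (fun w => (1 + g j w ^+ 2) ^+ m)).
  have [s s0 ls] := gf_law gf j.
  apply: (law_integrable (gf_meas gf j) s0 ls (F := fun y => (1 + y ^+ 2) ^+ m)).
    by apply: measurable_funX; apply: measurable_funD => //; exact: measurable_funX.
  exists 1, m; split => // x; rewrite mul1r ger0_norm// exprn_ge0//.
  by rewrite addr_ge0 ?sqr_ge0.
have sum_i : P.-integrable setT (EFin \o (fun w => \sum_j (1 + g j w ^+ 2) ^+ m)).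
  have := integrable_sum measurableT (index_enum J) (P := predT) (fun j _ => gi j).
  by apply: eq_integrable => // w _; rewrite /= sumEFin.
have Bi : P.-integrable setT (EFin \o B).
  have i1 : P.-integrable setT (EFin \o (fun w => 1 + \sum_j (1 + g j w ^+ 2) ^+ m)).
    have := integrableD measurableT (finite_measure_integrable_cst P 1 measurableT) sum_i.
    by apply: eq_integrable.
  have := integrableZl measurableT (C * #|J|.+1%:R ^+ m) i1.
  by apply: eq_integrable => // w _; rewrite /B /= -EFinM mulrA.
apply: le_integrable Bi => //.
  by apply/measurable_EFinP; apply: (tame_measurable hF); exact: gf_meas.
move=> w _ /=; rewrite lee_fin; apply: le_trans (hC _) _.
apply: le_trans (ler_norm _); rewrite /B ler_wpM2l//.
by apply: sum_pow_bound => j; exact: sqr_ge0.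
Qed.

Section IBP.
Variable j : J.
Let N := #|J|.
(* the other variables; the j-th entry is filled with 0 *)
Let h (w : Omega) : N.-tuple R :=
  [tuple (if enum_val i == j then 0 else g (enum_val i) w) | i < N].

Let mh : measurable_fun setT h.
Proof.
apply/measurable_fun_tnthP => i; rewrite (_ : _ \o _ =
  fun w => if enum_val i == j then 0 else g (enum_val i) w).
  by case: (enum_val i == j); [exact: measurable_cst|exact: gf_meas].
by apply/funext => w; rewrite /= tnth_mktuple.
Qed.

Let rec (z : R * N.-tuple R) : J -> R :=
  fun i => if i == j then z.1 else tnth z.2 (enum_rank i).

Let recE w : rec (g j w, h w) = g^~ w.
Proof.
apply/funext => i; rewrite /rec /=; case: eqP => [->//|/eqP ij].
by rewrite tnth_mktuple enum_rankK (negbTE ij).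
Qed.

Let indep_box (A : set R) (B : 'I_N -> set R) : measurable A ->
  (forall i, measurable (B i)) ->
  P (g j @^-1` A `&` h @^-1` tuple_box B) = (P (g j @^-1` A) * P (h @^-1` tuple_box B))%E.
Proof.
move=> mA mB.
have hE w : tuple_box B (h w) <-> (B (enum_rank j) 0 /\
    forall i, i != j -> B (enum_rank i) (g i w)).
  rewrite /tuple_box /=; split => [hB|[B0 hB] k].
    split; first by have := hB (enum_rank j); rewrite tnth_mktuple enum_rankK eqxx.
    move=> i ij; have := hB (enum_rank i).
    by rewrite tnth_mktuple enum_rankK (negbTE ij).
  rewrite tnth_mktuple; case: eqP => [ej|/eqP kj]; first by rewrite -[k]enum_valK ej.
  by rewrite -{1}[k]enum_valK; exact: hB.
have [B0|B0] := pselect (B (enum_rank j) 0); last first.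
  have -> : h @^-1` tuple_box B = set0.
    by apply/seteqP; split => w //= /hE[].
  by rewrite setI0 measure0 mule0.
pose A1 i := if i == j then A else B (enum_rank i).
pose A2 i := if i == j then setT else B (enum_rank i).
have -> : g j @^-1` A `&` h @^-1` tuple_box B = [set w | forall i, A1 i (g i w)].
  apply/seteqP; split => w /=.
    by move=> [Aw /hE[_ hw]] i; rewrite /A1; case: eqP => [->//|/eqP]; exact: hw.
  move=> hw; split; first by have := hw j; rewrite /A1 eqxx.
  by apply/hE; split => // i ij; have := hw i; rewrite /A1 (negbTE ij).
have -> : h @^-1` tuple_box B = [set w | forall i, A2 i (g i w)].
  apply/seteqP; split => w /=.
    by move=> /hE[_ hw] i; rewrite /A2; case: eqP => // /eqP; exact: hw.
  move=> hw; apply/hE; split => // i ij.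
  by have := hw i; rewrite /A2 (negbTE ij).
rewrite !(gf_ind gf); last 2 first.
- by move=> i; rewrite /A2; case: ifP.
- by move=> i; rewrite /A1; case: ifP.
rewrite (bigD1 j)//= [in RHS](bigD1 j)//=.
have -> : A1 j = A by rewrite /A1 eqxx.
have -> : A2 j = setT by rewrite /A2 eqxx.
rewrite preimage_setT probability_setT mul1e; congr (_ * _)%E.
by apply: eq_bigr => i /negbTE ij; rewrite /A1 /A2 ij.
Qed.

Let indep (A : set R) (B : set (N.-tuple R)) : measurable A -> measurable B ->
  P (g j @^-1` A `&` h @^-1` B) = (P (g j @^-1` A) * P (h @^-1` B))%E.
Proof.
move=> mA mB; have mgA : measurable (g j @^-1` A).
  by rewrite -[X in measurable X]setTI; exact: (gf_meas gf).
have fP : P (g j @^-1` A) \is a fin_num by exact: fin_num_measure.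
have r0 : 0 <= fine (P (g j @^-1` A)) by exact: fine_ge0.
pose H := mfun_Sub (mem_set mh).
pose m1 : {measure set _ -> \bar R} := pushforward (mrestr P mgA) H.
pose m2 : {measure set _ -> \bar R} := mscale (NngNum r0) (pushforward P H).
have cov : \bigcup_(k : nat) [set: N.-tuple R] = setT.
  by rewrite bigcup_const//; exists 0%N.
suff : m1 mh B = m2 mh B.
  rewrite [LHS](_ : _ = P (h @^-1` B `&` g j @^-1` A))//.
  rewrite [RHS](_ : _ = ((fine (P (g j @^-1` A)))%:E * P (h @^-1` B))%E)//.
  by rewrite fineK// setIC.
apply: (@measure_unique _ R _ (@tuple_boxes R N) (fun=> setT)
  (@measurable_tuple_boxes R N) (@tuple_boxes_setI R N) (fun=> @tuple_boxesT R N)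
  cov (m1 mh) (m2 mh)) => //.
- move=> _ [D mD ->].
  rewrite [LHS](_ : _ = P (h @^-1` tuple_box D `&` g j @^-1` A))//.
  rewrite [RHS](_ : _ = ((fine (P (g j @^-1` A)))%:E * P (h @^-1` tuple_box D))%E)//.
  by rewrite fineK// setIC indep_box.
- move=> _; rewrite [X in (X < _)%E](_ : _ = P (h @^-1` setT `&` g j @^-1` A))//.
  by rewrite preimage_setT setTI -(fineK fP) ltry.
Qed.

Let HG := mfun_Sub (mem_set (gf_meas gf j)).
Let HH := mfun_Sub (mem_set mh).

Lemma measurable_pair_law : measurable_fun setT (fun w => (g j w, h w)).
Proof. exact: measurable_fun_pair (gf_meas gf j) mh. Qed.

Let HP := mfun_Sub (mem_set measurable_pair_law).

Let lawE (X : set (R * N.-tuple R)) : measurable X ->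
  (distribution P HG \x distribution P HH)%E X = distribution P HP X.
Proof.
move=> mX; apply: (@product_measure_unique _ _ _ _ R (distribution P HG)
  (distribution P HH) (distribution P HP)) => //; exact: indep.
Qed.

Let rec_meas i : measurable_fun setT (fun z => rec z i).
Proof.
rewrite /rec; case: (i == j); first exact: measurable_fst.
apply: (measurableT_comp (f := fun t : N.-tuple R => tnth t (enum_rank i))) => //.
exact: measurable_tnth.
Qed.

Let fubini (F : (J -> R) -> R) : smooth F ->
  (\int[P]_w (F (g^~ w))%:E =
   \int[distribution P HH]_t \int[distribution P HG]_a (F (rec (a, t)))%:E)%E.
Proof.
move=> sF; have [DF tF] := sF.
have mF : measurable_fun setT (fun z => F (rec z)) := tame_measurable tF rec_meas.
have mFE : measurable_fun setT (fun z => (F (rec z))%:E) by exact/measurable_EFinP.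
have iP : P.-integrable setT ((fun z => (F (rec z))%:E) \o HP).
  have := smooth_integrable sF; apply: eq_integrable => // w _ /=.
  by rewrite recE.
have iD : (distribution P HP).-integrable setT (fun z => (F (rec z))%:E).
  by apply: integrable_pushforward => //; exact: measurable_pair_law.
have iM : (distribution P HG \x distribution P HH)%E.-integrable setT
    (fun z => (F (rec z))%:E).
  apply/integrableP; split => //; case/integrableP: iD => _.
  rewrite [X in (X < _)%E -> _](_ : _ =
    (\int[distribution P HG \x distribution P HH]_z `|(F (rec z))%:E|)%E)//.
  by apply: eq_measure_integral => X mX _; exact: (esym (lawE mX)).
transitivity (\int[distribution P HP]_z (F (rec z))%:E)%E.
  rewrite integral_distribution//; apply: eq_integral => w _ /=.
  by rewrite recE.
transitivity (\int[distribution P HG \x distribution P HH]_z (F (rec z))%:E)%E.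
  by apply: eq_measure_integral => X mX _; exact: (esym (lawE mX)).
by rewrite -integral21_prod_meas1.
Qed.

(** By independence and Fubini's theorem the j-th variable can be integrated
    first, the others being frozen: this is Stein's identity in one variable. *)
Lemma gauss_ibp (F : (J -> R) -> R) DF : tame F DF ->
  (\int[P]_w (g j w * F (g^~ w))%:E = \int[P]_w (DF j (g^~ w))%:E)%E.
Proof.
move=> tF; have sF : smooth F by exists DF.
have sD := tame_D tF j.
rewrite (fubini (smooth_mul (smooth_var j) sF)) (fubini sD).
apply: eq_integral => t _.
pose y i := tnth t (enum_rank i).
have recU a : rec (a, t) = upd y j a by [].
have sl (a : R) : is_derive a 1 (fun s : R => F (upd y j s)) (DF j (upd y j a)).
  exact: tame_slice.
have [s s0 ls] := gf_law gf j.
have gF := smooth_slice_growth y j sF; have gD := smooth_slice_growth y j sD.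
have cD := smooth_slice_continuous sD (y := y) (j := j).
have cF := smooth_slice_continuous sF (y := y) (j := j).
have mF := continuous_measurable_fun cF.
have mD := continuous_measurable_fun cD.
transitivity (\int[distribution P HG]_a (a * F (upd y j a))%:E)%E.
  by apply: eq_integral => a _; rewrite recU /upd eqxx.
transitivity (\int[distribution P HG]_a (DF j (upd y j a))%:E)%E; last first.
  by apply: eq_integral => a _; rewrite recU.
rewrite integral_distribution; last 2 first.
- by apply/measurable_EFinP; exact: measurable_funM.
- apply: (law_integrable (gf_meas gf j) s0 ls (F := fun a => a * F (upd y j a))).
    exact: measurable_funM.
  exact: poly_growthX.
rewrite integral_distribution; last 2 first.
- exact/measurable_EFinP.
- exact: (law_integrable (gf_meas gf j) s0 ls mD gD).
exact: (law_stein (gf_meas gf j) s0 ls sl cD gF gD).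
Qed.

End IBP.

Definition gaussE (F : (J -> R) -> R) : R := \int[P]_w F (g^~ w).

Lemma gauss_family_expectation : gauss_expectation gaussE.
Proof.
split.
- move=> c; rewrite /gaussE Rintegral_cst//.
  by rewrite [X in fine X](probability_setT P) mulr1.
- move=> a F G sF sG; rewrite /gaussE.
  rewrite RintegralD//; last exact: smooth_integrable.
    by rewrite RintegralZl//; exact: smooth_integrable.
  apply: (smooth_integrable (F := fun x => a * F x)).
  by apply: smooth_mul => //; exact: smooth_cst.
- move=> F G sF sG FG; apply: le_Rintegral => //; exact: smooth_integrable.
- by move=> j F DF tF; rewrite /gaussE /Rintegral (gauss_ibp j tF).
Qed.

End Family.
End GaussFamily.

(** * Approximation by trigonometric polynomials *)

Section TrigApproximation.
Context {R : realType}.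

(** The binomial probabilities, weights of the Bernstein polynomials. *)
Definition bern (n : nat) (u : R) (j : nat) : R :=
  'C(n, j)%:R * u ^+ j * (1 - u) ^+ (n - j).

Definition bernE n (u : R) (h : nat -> R) : R := \sum_(j < n.+1) bern n u j * h j.

Lemma bern_ge0 n u j : 0 <= u <= 1 -> 0 <= bern n u j.
Proof.
by move=> /andP[u0 u1]; rewrite !mulr_ge0 ?exprn_ge0 ?subr_ge0.
Qed.

(** The last of n + 1 Bernoulli trials is singled out; mean and variance follow
    by induction. *)
Lemma bernES n u (h : nat -> R) :
  bernE n.+1 u h = u * bernE n u (fun j => h j.+1) + (1 - u) * bernE n u h.
Proof.
rewrite /bernE big_ord_recl /bern !bin0 !subn0 expr0 !mul1r.
have -> : (1 - u) * (\sum_(j < n.+1) 'C(n, j)%:R * u ^+ j * (1 - u) ^+ (n - j) * h j)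
  = (1 - u) ^+ n.+1 * h 0%N + \sum_(j < n.+1) 'C(n, j.+1)%:R * u ^+ j.+1 * (1 - u) ^+ (n - j) * h j.+1.
  rewrite big_ord_recl /= bin0 subn0 expr0 !mul1r mulrDr mulrA -exprS; congr (_ + _).
  rewrite big_ord_recr /= bin_small// !mul0r addr0 mulr_sumr.
  apply: eq_bigr => j _; rewrite /bump /= add1n.
  have -> : (n - j = (n - j.+1).+1)%N by have := ltn_ord j; lia.
  by rewrite [(1 - u) ^+ _.+1]exprS; ring.
rewrite addrCA; congr (_ + _); rewrite mulr_sumr -big_split /=.
apply: eq_bigr => j _; rewrite /bump /= add1n subSS binS natrD exprS.
by ring.
Qed.

Lemma bernE_cst n u c : bernE n u (fun=> c) = c.
Proof.
elim: n => [|n IH]; last by rewrite bernES IH; ring.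
by rewrite /bernE big_ord_recl big_ord0 /bern /= bin0 subn0 !expr0; ring.
Qed.

Lemma bernE_var n u c : bernE n u (fun j => (j%:R - c) ^+ 2) =
  n%:R * u * (1 - u) + (n%:R * u - c) ^+ 2.
Proof.
elim: n c => [|n IH] c.
  by rewrite /bernE big_ord_recl big_ord0 /bern /= bin0 subn0 !expr0; ring.
rewrite bernES IH; have -> : bernE n u (fun j => (j.+1%:R - c) ^+ 2) =
    bernE n u (fun j => (j%:R - (c - 1)) ^+ 2).
  by apply: eq_bigr => j _; rewrite -natr1; ring.
by rewrite IH -natr1; ring.
Qed.

(** A modulus of continuity for the inverse of the sine, from the product formula
    for sin a - sin b. *)
Lemma sin_sub_ge (a b : R) : `|a| <= pi / 2 -> `|b| <= pi / 2 ->
  1 - cos (a - b) <= `|sin a - sin b|.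
Proof.
wlog ba : a b / b <= a.
  move=> h ha hb; have [ba|/ltW ab] := leP b a; first exact: h.
  by rewrite -[a - b]opprB cosN distrC h.
rewrite !ler_norml => /andP[a1 a2] /andP[b1 b2].
pose h := (a - b) / 2; pose s := (a + b) / 2.
have pi0 := @pi_gt0 R.
have h0 : 0 <= h by rewrite divr_ge0// subr_ge0.
have hE : a - b = h + h by rewrite /h; field.
have -> : sin a - sin b = 2 * (sin h * cos s).
  have -> : a = s + h by rewrite /s /h; field.
  have -> : b = s - h by rewrite /s /h; field.
  by rewrite sinD sinB; ring.
have -> : 1 - cos (a - b) = 2 * (sin h * sin h).
  by rewrite hE cosD; have := cos2Dsin2 h; rewrite !expr2; lra.
have sh0 : 0 <= sin h by apply: sin_ge0_pi; rewrite h0 /h; lra.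
have cs : sin h <= cos s.
  have -> : sin h = cos (pi / 2 - h) by rewrite cosB cos_pihalf sin_pihalf; ring.
  have -> : cos s = cos `|s| by case: (ger0P s) => // _; rewrite cosN.
  have sle : `|s| <= pi / 2 - h by rewrite ler_norml /s /h; lra.
  move: sle; rewrite le_eqVlt => /orP[/eqP ->//|slt].
  by apply/ltW; rewrite ltr_cos// in_itv /= ?normr_ge0 /h /=; move: slt; rewrite /h; lra.
apply: le_trans (ler_norm _).
by rewrite ler_wpM2l// ler_wpM2l.
Qed.

Lemma sin_sub_small (a b r : R) : `|a| <= pi / 2 -> `|b| <= pi / 2 ->
  0 <= r <= pi -> `|sin a - sin b| < 1 - cos r -> `|a - b| < r.
Proof.
move=> ha hb /andP[r0 r1] hs; rewrite ltNge; apply/negP => rab.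
have := sin_sub_ge ha hb; have -> : cos (a - b) = cos `|a - b|.
  by case: (ger0P (a - b)) => // _; rewrite cosN.
have abpi : `|a - b| <= pi.
  by apply: le_trans (ler_normB _ _) _; move: ha hb; lra.
have : cos `|a - b| <= cos r.
  move: rab; rewrite le_eqVlt => /orP[/eqP ->//|lt].
  by apply/ltW; rewrite ltr_cos// in_itv /= ?normr_ge0 ?r0.
move: hs; lra.
Qed.

Variable k : nat.
Implicit Types (p q f : 'rV[R]_k -> R).

(** The trigonometric polynomials, whose expectations are given by the
    characteristic function. *)
Inductive trig : ('rV[R]_k -> R) -> Prop :=
| trig_cos t th : trig (fun x => cos (\sum_i t i * x ord0 i + th))
| trig_add p q : trig p -> trig q -> trig (fun x => p x + q x)
| trig_scale c p : trig p -> trig (fun x => c * p x).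

Lemma trig_cst c : trig (fun=> c).
Proof.
rewrite (_ : (fun=> c) = fun x : 'rV[R]_k => c * cos (\sum_i 0 * x ord0 i + 0)).
  by apply: trig_scale; exact: (trig_cos (fun=> 0)).
by apply/funext => x; rewrite big1 ?add0r ?cos0 ?mulr1// => i _; rewrite mul0r.
Qed.

Lemma trig_mul p q : trig p -> trig q -> trig (fun x => p x * q x).
Proof.
elim=> [t th|p1 p2 _ h1 _ h2|c p1 _ h1] hq; last 2 first.
- rewrite (_ : (fun x => _) = fun x : 'rV[R]_k => p1 x * q x + p2 x * q x).
    by apply: trig_add; [exact: h1|exact: h2].
  by apply/funext => x; rewrite mulrDl.
- rewrite (_ : (fun x => _) = fun x : 'rV[R]_k => c * (p1 x * q x)).
    by apply: trig_scale; exact: h1.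
  by apply/funext => x; rewrite mulrA.
elim: hq => [t2 th2|p1 p2 _ h1 _ h2|c p1 _ h1]; last 2 first.
- rewrite (_ : (fun x => _) = fun x : 'rV[R]_k => cos (\sum_i t i * x ord0 i + th) * p1 x
     + cos (\sum_i t i * x ord0 i + th) * p2 x).
    by apply: trig_add; [exact: h1|exact: h2].
  by apply/funext => x; rewrite mulrDr.
- rewrite (_ : (fun x => _) = fun x : 'rV[R]_k => c * (cos (\sum_i t i * x ord0 i + th) * p1 x)).
    by apply: trig_scale; exact: h1.
  by apply/funext => x; rewrite mulrCA.
rewrite (_ : (fun x => _) = fun x : 'rV[R]_k => 2^-1 * (cos (\sum_i (t i + t2 i) * x ord0 i + (th + th2))
   + cos (\sum_i (t i - t2 i) * x ord0 i + (th - th2)))).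
  by apply: trig_scale; apply: trig_add;
    [exact: (trig_cos (fun i => t i + t2 i))|exact: (trig_cos (fun i => t i - t2 i))].
apply/funext => x; set u := \sum_i t i * _ + th; set v := \sum_i t2 i * _ + th2.
have -> : \sum_i (t i + t2 i) * x ord0 i + (th + th2) = u + v.
  by under eq_bigr do rewrite mulrDl; rewrite big_split /= /u /v; ring.
have -> : \sum_i (t i - t2 i) * x ord0 i + (th - th2) = u - v.
  by under eq_bigr do rewrite mulrBl; rewrite sumrB /u /v; ring.
by rewrite [cos (u + v)]cosD [cos (u - v)]cosB; field.
Qed.

Lemma trig_exp p n : trig p -> trig (fun x => p x ^+ n).
Proof.
move=> hp; elim: n => [|n IH]; first exact: (trig_cst 1).
rewrite (_ : (fun x => _) = fun x : 'rV[R]_k => p x * p x ^+ n); first exact: trig_mul.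
by apply/funext => x; rewrite exprS.
Qed.

Lemma trig_sum (I : Type) (s : seq I) (F : I -> 'rV[R]_k -> R) :
  (forall i, trig (F i)) -> trig (fun x => \sum_(i <- s) F i x).
Proof.
move=> h; elim: s => [|i s IH].
  by rewrite (_ : (fun x => _) = fun=> 0); [exact: trig_cst|apply/funext => x; rewrite big_nil].
rewrite (_ : (fun x => _) = fun x : 'rV[R]_k => F i x + \sum_(j <- s) F j x).
  exact: trig_add.
by apply/funext => x; rewrite big_cons.
Qed.

Lemma trig_prod (I : Type) (s : seq I) (F : I -> 'rV[R]_k -> R) :
  (forall i, trig (F i)) -> trig (fun x => \prod_(i <- s) F i x).
Proof.
move=> h; elim: s => [|i s IH].
  by rewrite (_ : (fun x => _) = fun=> 1); [exact: trig_cst|apply/funext => x; rewrite big_nil].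
rewrite (_ : (fun x => _) = fun x : 'rV[R]_k => F i x * \prod_(j <- s) F j x).
  exact: trig_mul.
by apply/funext => x; rewrite big_cons.
Qed.

Lemma trig_sin_coord (i : 'I_k) (c : R) : trig (fun x => sin (c * x ord0 i)).
Proof.
rewrite (_ : (fun x => _) = fun x : 'rV[R]_k => cos (\sum_j (if j == i then c else 0) * x ord0 j + - (pi / 2))).
  exact: (trig_cos (fun j => if j == i then c else 0)).
apply/funext => x; rewrite (bigD1 i)//= eqxx big1 ?addr0 => [|j /negbTE ->]; last by rewrite mul0r.
by rewrite cosB cos_pihalf sin_pihalf; ring.
Qed.

Lemma box_unif_continuous f (L e : R) : continuous f -> 0 < e ->
  exists2 eta, 0 < eta & forall x y : 'rV[R]_k, (forall i, `|x ord0 i| <= L) ->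
    (forall i, `|x ord0 i - y ord0 i| < eta) -> `|f x - f y| < e.
Proof.
move=> cf e0.
pose K : set 'rV[R]_k := [set x | forall i, `[- L, L]%classic (x ord0 i)].
have cK : compact K.
  by apply: (@rV_compact _ _ (fun=> `[(- L), L]%classic)) => i; exact: segment_compact.
pose Q (eta : R) (x : 'rV[R]_k) := forall y : 'rV[R]_k, (forall i, `|x ord0 i - y ord0 i| < eta) -> `|f x - f y| < e.
have : \forall eta \near 0^'+, K `<=` Q eta.
  move/compact_near_coveringP : cK; apply => x Kx.
  have /cvgrPdist_lt /(_ (e / 2)) := cf x; rewrite divr_gt0// => /(_ isT).
  move=> /nbhs_ballP[r /= r0 hr].
  exists (ball x (r / 2), [set eta | eta < r / 2]).
    split; first by apply: nbhsx_ballx; rewrite divr_gt0.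
    by apply: nbhs_right_lt; rewrite divr_gt0.
  move=> [x' eta] /= [bx' he] y hy.
  have bx : ball x r x' by apply: le_ball bx'; lra.
  have by_ : ball x r y.
    split=> // i j; rewrite ord1.
    have h1 : `|x ord0 j - x' ord0 j| < r / 2 := bx'.2 ord0 j.
    have h2 := hy j.
    rewrite /ball /= (_ : x ord0 j - y ord0 j = (x ord0 j - x' ord0 j) + (x' ord0 j - y ord0 j)); last by ring.
    apply: le_lt_trans (ler_normD _ _) _; move: h1 h2 he; lra.
  have h3 := hr _ bx; have h4 := hr _ by_.
  rewrite (_ : f x' - f y = (f x - f y) - (f x - f x')); last by ring.
  apply: le_lt_trans (ler_normB _ _) _; move: h3 h4; rewrite /=; lra.
move=> hn; have [eta [eta0 he]] : exists eta : R, 0 < eta /\ K `<=` Q eta.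
  near (0:R)^'+ => eta; exists eta; split => //; near: eta; exact: hn.
exists eta => // x y hx; apply: he => i /=.
by rewrite in_itv /= -ler_norml.
Unshelve. all: by end_near. Qed.

End TrigApproximation.

Section Levy.
Context {R : realType}.
Variable k : nat.
Implicit Types (p q f : 'rV[R]_k -> R).

(** The product Bernstein weights are a product law, with Bernstein marginals. *)
Lemma bern_prod_marginal n (u : 'I_k -> R) (i0 : 'I_k) (h : nat -> R) :
  \sum_(J : {ffun 'I_k -> 'I_n.+1}) h (J i0) * \prod_i bern n (u i) (J i) =
  bernE n (u i0) h.
Proof.
pose F i (j : 'I_n.+1) := (if i == i0 then h j else 1) * bern n (u i) j.
transitivity (\sum_(J : {ffun 'I_k -> 'I_n.+1}) \prod_i F i (J i)).
  apply: eq_bigr => J _; rewrite (bigD1 i0)//= [RHS](bigD1 i0)//= /F eqxx mulrA.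
  congr (_ * _).
  by apply: eq_bigr => i /negbTE ->; rewrite mul1r.
rewrite -bigA_distr_bigA (bigD1 i0)//= [X in _ * X]big1 ?mulr1 => [|i /negbTE ii0].
  by apply: eq_bigr => j _; rewrite /F eqxx mulrC.
transitivity (bernE n (u i) (fun=> 1)); last exact: bernE_cst.
by apply: eq_bigr => j _; rewrite /F ii0 mulrC.
Qed.

Lemma bern_prod_total n (u : 'I_k -> R) :
  \sum_(J : {ffun 'I_k -> 'I_n.+1}) \prod_i bern n (u i) (J i) = 1.
Proof.
rewrite -(bigA_distr_bigA (fun i (j : 'I_n.+1) => bern n (u i) j)) big1// => i _.
rewrite -[RHS](bernE_cst n (u i)).
by apply: eq_bigr => j _; rewrite mulr1.
Qed.

(** Bernstein's approximation in the variables u_i = (1 + sin (x_i / M)) / 2.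
    Polynomials in u are trigonometric polynomials in x, and x_i is a continuous
    function of u_i on the box.  The bound B is kept on the whole space because
    the weights are nonnegative with sum 1. *)
Lemma trig_approx f (B M e : R) : continuous f -> (forall x, `|f x| <= B) ->
  0 < M -> 0 < e ->
  exists p, [/\ trig p, forall x, `|p x| <= B &
    forall x : 'rV[R]_k, (forall i, `|x ord0 i| <= M) -> `|f x - p x| <= e].
Proof.
move=> cf fB M0 e0; have pi0 := @pi_gt0 R; have pi2 := @pi_ge2 R.
have B0 : 0 <= B by apply: le_trans (fB 0).
have e20 : 0 < e / 2 by rewrite divr_gt0.
have [eta eta0 uc] := @box_unif_continuous R k f M (e / 2) cf e20.
pose r := Num.min (eta / M) pi.
have r0 : 0 < r by rewrite lt_min divr_gt0.
have rpi : r <= pi by rewrite ge_min lexx orbT.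
(* a gap 2 dl between sines separates points of [-pi/2, pi/2] up to distance r *)
pose dl : R := (1 - cos r) / 2.
have dl0 : 0 < dl.
  rewrite divr_gt0// subr_gt0 -[ltRHS]cos0 ltr_cos// in_itv /= ?lexx ?(ltW pi0)//.
  by rewrite (ltW r0).
have [n n0 hn] : exists2 n : nat, (0 < n)%N & 2 * B * dl ^- 2 * k%:R / n%:R <= e / 2.
  have [N _ hN] := @nbhs_infty_ger R (2 * B * dl ^- 2 * k%:R / (e / 2)).
  exists N.+1 => //; rewrite ler_pdivrMr ?ltr0n// [leRHS]mulrC -ler_pdivrMr//.
  exact: hN N.+1 (leqnSn N).
pose U (x : 'rV[R]_k) i := (1 + sin (M^-1 * x ord0 i)) / 2.
pose y (J : {ffun 'I_k -> 'I_n.+1}) : 'rV[R]_k :=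
  \row_i (M * asin (2 * ((J i)%:R / n%:R) - 1)).
pose w (J : {ffun 'I_k -> 'I_n.+1}) x := \prod_i bern n (U x i) (J i).
have U01 x i : 0 <= U x i <= 1.
  have h1 := sin_geN1 (M^-1 * x ord0 i); have h2 := sin_le1 (M^-1 * x ord0 i).
  by rewrite /U; lra.
have w0 J x : 0 <= w J x by apply: prodr_ge0 => i _; exact: bern_ge0.
have wT x : \sum_J w J x = 1 by exact: bern_prod_total.
exists (fun x => \sum_J f (y J) * w J x); split.
- apply: trig_sum => J; apply: trig_scale; apply: trig_prod => i.
  have tU : trig (fun x => U x i).
    rewrite (_ : (fun x => _) = fun x : 'rV[R]_k => 2^-1 * (1 + sin (M^-1 * x ord0 i))).
      by apply: trig_scale; apply: trig_add; [exact: trig_cst|exact: trig_sin_coord].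
    by apply/funext => x; rewrite mulrC.
  rewrite /bern; apply: trig_mul; first by apply: trig_mul; [exact: trig_cst|exact: trig_exp].
  apply: trig_exp; rewrite (_ : (fun x => _) = fun x : 'rV[R]_k => 1 + -1 * U x i).
    by apply: trig_add; [exact: trig_cst|exact: trig_scale].
  by apply/funext => x; rewrite mulN1r.
- move=> x; apply: le_trans (ler_norm_sum _ _ _) _.
  rewrite -[leRHS]mulr1 -(wT x) mulr_sumr; apply: ler_sum => J _.
  by rewrite normrM (ger0_norm (w0 J x)) ler_wpM2r.
move=> x hx.
have key J : `|f x - f (y J)| <= e / 2 + 2 * B * dl ^- 2 *
    \sum_i ((J i)%:R / n%:R - U x i) ^+ 2.
  have rhs0 : 0 <= \sum_i ((J i)%:R / n%:R - U x i) ^+ 2.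
    by apply: sumr_ge0 => i _; exact: sqr_ge0.
  have [[i hi]|none] := pselect (exists i, dl <= `|(J i)%:R / n%:R - U x i|).
    apply: (@le_trans _ _ (2 * B)).
      by apply: le_trans (ler_normB _ _) _; rewrite mulr_natl mulr2n lerD.
    rewrite -[leLHS]add0r lerD ?(ltW e20)// -[leRHS]mulrA -[leLHS]mulr1 ler_wpM2l ?mulr_ge0//.
    rewrite mulrC ler_pdivlMr ?exprn_gt0// mul1r.
    apply: (@le_trans _ _ (((J i)%:R / n%:R - U x i) ^+ 2)).
      by rewrite -[leRHS]ger0_norm ?sqr_ge0// normrX lerXn2r ?nnegrE// ltW.
    by rewrite (bigD1 i)//= lerDl sumr_ge0// => i' _; exact: sqr_ge0.
  rewrite -[leLHS]addr0 lerD//; last by rewrite !mulr_ge0// invr_ge0 exprn_ge0// ltW.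
  apply/ltW/uc => // i; rewrite mxE.
  set v := 2 * _ - 1.
  have v1 : -1 <= v <= 1.
    have j0 : 0 <= (J i)%:R / n%:R :> R by rewrite divr_ge0.
    have j1 : (J i)%:R / n%:R <= 1 :> R.
      by rewrite ler_pdivrMr ?ltr0n// mul1r ler_nat -ltnS.
    by rewrite /v; lra.
  have sE : sin (asin v) = v by apply: asinK; rewrite in_itv.
  have a1 : `|asin v| <= pi / 2.
    by rewrite ler_norml asin_geNpi2// asin_lepi2.
  have a2 : `|M^-1 * x ord0 i| <= pi / 2.
    rewrite normrM gtr0_norm ?invr_gt0// mulrC ler_pdivrMr//.
    apply: le_trans (hx i) _; rewrite ler_peMl ?(ltW M0)//; lra.
  have hsin : `|sin (M^-1 * x ord0 i) - sin (asin v)| < 1 - cos r.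
    have : ~ (dl <= `|(J i)%:R / n%:R - U x i|) by move=> h; apply: none; exists i.
    move=> /negP; rewrite -ltNge sE distrC => hlt.
    rewrite (_ : _ - v = 2 * (U x i - (J i)%:R / n%:R)); last by rewrite /U /v; field; rewrite pnatr_eq0 -lt0n.
    rewrite normrM ger0_norm//; move: hlt; rewrite /dl; lra.
  have := sin_sub_small a2 a1 _ hsin; rewrite rpi (ltW r0) => /(_ isT).
  rewrite lt_min => /andP[h _].
  have -> : x ord0 i - M * asin v = M * (M^-1 * x ord0 i - asin v).
    by rewrite mulrBr mulrA divff ?mul1r// lt0r_neq0.
  by rewrite normrM gtr0_norm// mulrC -ltr_pdivlMr.
have -> : f x - \sum_J f (y J) * w J x = \sum_J (f x - f (y J)) * w J x.
  rewrite -{1}[f x]mulr1 -(wT x) mulr_sumr -sumrB.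
  by apply: eq_bigr => J _; rewrite mulrBl.
apply: (@le_trans _ _ (\sum_J `|(f x - f (y J)) * w J x|)); first exact: ler_norm_sum.
pose Q (J : {ffun 'I_k -> 'I_n.+1}) : R := \sum_i ((J i)%:R / n%:R - U x i) ^+ 2.
have step : \sum_J `|(f x - f (y J)) * w J x| <=
    \sum_J (e / 2 + 2 * B * dl ^- 2 * Q J) * w J x.
  by apply: ler_sum => J _; rewrite normrM (ger0_norm (w0 J x)) ler_wpM2r.
apply: (le_trans step).
under eq_bigr do rewrite mulrDl.
rewrite big_split /= -mulr_sumr wT mulr1.
have -> : \sum_J 2 * B * dl ^- 2 * Q J * w J x =
   2 * B * dl ^- 2 * \sum_i \sum_(J : {ffun 'I_k -> 'I_n.+1})
     ((J i)%:R / n%:R - U x i) ^+ 2 * w J x.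
  rewrite exchange_big mulr_sumr /=; apply: eq_bigr => J _.
  by rewrite -mulrA mulr_suml.
have var i : \sum_(J : {ffun 'I_k -> 'I_n.+1}) ((J i)%:R / n%:R - U x i) ^+ 2 * w J x <= n%:R^-1.
  rewrite (bern_prod_marginal n (U x) i (fun j => (j%:R / n%:R - U x i) ^+ 2)).
  have nn0 : n%:R != 0 :> R by rewrite pnatr_eq0 -lt0n.
  have -> : bernE n (U x i) (fun j => (j%:R / n%:R - U x i) ^+ 2) =
      n%:R ^- 2 * bernE n (U x i) (fun j => (j%:R - n%:R * U x i) ^+ 2).
    rewrite /bernE mulr_sumr; apply: eq_bigr => j _.
    by field.
  rewrite bernE_var subrr expr0n /= addr0.
  have -> : n%:R ^- 2 * (n%:R * U x i * (1 - U x i)) = n%:R^-1 * (U x i * (1 - U x i)).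
    by field.
  rewrite ler_piMr ?invr_ge0//.
  by have /andP[u0 u1] := U01 x i; rewrite mulr_ile1// ?subr_ge0// lerBlDr lerDl.
rewrite [leRHS](_ : e = e / 2 + e / 2); last by field.
rewrite lerD2l; apply: le_trans hn; rewrite -[leRHS]mulrA ler_wpM2l//.
  by rewrite !mulr_ge0// invr_ge0 exprn_ge0// ltW.
apply: (@le_trans _ _ (\sum_(i < k) n%:R^-1)); first exact: ler_sum.
by rewrite sumr_const card_ord mulr_natl.
Qed.

Section Measurability.
Context d (T : measurableType d) (X : T -> 'rV[R]_k).
Hypothesis mX : forall i, measurable_fun setT (fun w => X w ord0 i).

Lemma trig_measurable p : trig p -> measurable_fun setT (fun w => p (X w)).
Proof.
elim=> [t th|p1 p2 _ h1 _ h2|c p1 _ h1].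
- apply: (measurableT_comp (f := @cos R)).
    by apply: continuous_measurable_fun; exact: continuous_cos.
  apply: measurable_funD => //; apply: measurable_sum => i.
  exact: measurable_funM.
- exact: measurable_funD.
- exact: measurable_funM.
Qed.

(** Continuous functions are pointwise limits of trigonometric polynomials of the
    coordinates. *)
Lemma bounded_continuous_measurable f (B : R) : continuous f ->
  (forall x, `|f x| <= B) -> measurable_fun setT (fun w => f (X w)).
Proof.
move=> cf fB.
have /choice[p hp] : forall n : nat, exists p, [/\ trig p, forall x, `|p x| <= B &
    forall x : 'rV[R]_k, (forall i, `|x ord0 i| <= n.+1%:R) -> `|f x - p x| <= n.+1%:R^-1].
  by move=> n; apply: trig_approx.
apply: (@measurable_fun_cvg _ _ _ _ (fun n w => p n (X w))).
  by move=> n; apply: trig_measurable; case: (hp n).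
move=> w _; apply/cvgrPdist_le => e e0; near=> n.
have [_ _ hn] := hp n.
apply: le_trans (hn _ _) _.
  move=> i; apply: (@le_trans _ _ (\sum_i `|X w ord0 i|)).
    by rewrite (bigD1 i)//= lerDl sumr_ge0.
  apply: (@le_trans _ _ n%:R); last by rewrite ler_nat.
  by near: n; exact: nbhs_infty_ger.
rewrite invf_ple ?posrE// ; apply: (@le_trans _ _ n%:R); last by rewrite ler_nat.
by near: n; exact: nbhs_infty_ger.
Unshelve. all: by end_near. Qed.

End Measurability.
End Levy.

(** * Convergence in distribution *)

Section BoundedIntegrals.
Context d (T : measurableType d) (R : realType) (P : probability T R).

Lemma bounded_integrable (h : T -> R) (B : R) : measurable_fun setT h ->
  (forall w, `|h w| <= B) -> P.-integrable setT (EFin \o h).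
Proof.
move=> mh hB; have := finite_measure_integrable_cst P B measurableT.
apply: le_integrable => //; first exact/measurable_EFinP.
by move=> w _ /=; rewrite lee_fin; apply: le_trans (hB w) (ler_norm _).
Qed.

Lemma prob_Rintegral_cst (c : R) : \int[P]_w c = c.
Proof. by rewrite Rintegral_cst// [X in fine X](probability_setT P) mulr1. Qed.

Lemma Rintegral_abs_le (h b : T -> R) : P.-integrable setT (EFin \o h) ->
  P.-integrable setT (EFin \o b) -> (forall w, `|h w| <= b w) ->
  `|\int[P]_w h w| <= \int[P]_w b w.
Proof.
move=> ih ib hb; apply: le_trans (le_normr_Rintegral measurableT ih) _.
apply: le_Rintegral => //.
by have := integrable_abse ih; apply: eq_integrable.
Qed.

Lemma integrable_sumr (I : Type) (s : seq I) (h : I -> T -> R) :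
  (forall i, P.-integrable setT (EFin \o h i)) ->
  P.-integrable setT (EFin \o (fun w => \sum_(i <- s) h i w)).
Proof.
move=> ih; have := integrable_sum measurableT s (P := predT) (fun i _ => ih i).
by apply: eq_integrable => // w _; rewrite /= sumEFin.
Qed.

Lemma Rintegral_sum (I : Type) (s : seq I) (h : I -> T -> R) :
  (forall i, P.-integrable setT (EFin \o h i)) ->
  \int[P]_w (\sum_(i <- s) h i w) = \sum_(i <- s) \int[P]_w h i w.
Proof.
move=> ih; elim: s => [|i s IH].
  by under eq_Rintegral do rewrite big_nil; rewrite prob_Rintegral_cst big_nil.
under eq_Rintegral do rewrite big_cons.
by rewrite RintegralD ?IH ?big_cons//; exact: integrable_sumr.
Qed.

Lemma EFin_Rintegral (h : T -> R) : P.-integrable setT (EFin \o h) ->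
  (\int[P]_w (h w)%:E = (\int[P]_w h w)%:E)%E.
Proof. by move=> ih; rewrite /Rintegral fineK//; exact: integrable_fin_num. Qed.

End BoundedIntegrals.

Section Convergence.
Context {R : realType} (k : nat).
Implicit Types (p f : 'rV[R]_k -> R).

Section OneSpace.
Context d (T : measurableType d) (P : probability T R) (X : T -> 'rV[R]_k).
Hypothesis mX : forall i, measurable_fun setT (fun w => X w ord0 i).

Lemma trig_integrable p : trig p -> P.-integrable setT (EFin \o (fun w => p (X w))).
Proof.
move=> tp; have [B hB] : exists B, forall x, `|p x| <= B.
  elim: tp => [t th|p1 p2 _ [B1 h1] _ [B2 h2]|c p1 _ [B1 h1]].
  - by exists 1 => x; rewrite ler_norml cos_geN1 cos_le1.
  - by exists (B1 + B2) => x; apply: le_trans (ler_normD _ _) _; exact: lerD.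
  - by exists (`|c| * B1) => x; rewrite normrM ler_wpM2l.
by apply: (@bounded_integrable _ _ _ P _ B) => //; exact: trig_measurable.
Qed.

Hypothesis iX : forall i, P.-integrable setT (EFin \o (fun w => X w ord0 i ^+ 2)).

Lemma sum_sqr_integrable (c e : R) :
  P.-integrable setT (EFin \o (fun w => e + c * \sum_i X w ord0 i ^+ 2)).
Proof.
have i1 := integrable_sumr (index_enum 'I_k) iX.
have i2 : P.-integrable setT (EFin \o (fun w => c * \sum_i X w ord0 i ^+ 2)).
  by have := integrableZl measurableT c i1; apply: eq_integrable.
have := integrableD measurableT (finite_measure_integrable_cst P e measurableT) i2.
by apply: eq_integrable.
Qed.

Variable K : R.
Hypothesis KX : forall i, \int[P]_w (X w ord0 i ^+ 2) <= K.

Lemma sum_sqr_Rintegral (c e : R) : 0 <= c ->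
  \int[P]_w (e + c * \sum_i X w ord0 i ^+ 2) <= e + c * (k%:R * K).
Proof.
move=> c0.
rewrite RintegralD//.
- rewrite prob_Rintegral_cst lerD2l RintegralZl//; last exact: integrable_sumr.
  rewrite ler_wpM2l//.
  rewrite Rintegral_sum// (_ : k%:R * K = \sum_(i < k) K); first exact: ler_sum.
  by rewrite sumr_const card_ord mulr_natl.
- exact: finite_measure_integrable_cst.
- by have := sum_sqr_integrable c 0; apply: eq_integrable => // w _ /=; rewrite add0r.
Qed.

(** Outside of a large box, Chebyshev's inequality controls both functions. *)
Lemma trig_approx_Rintegral f p (B M e : R) : continuous f ->
  (forall x, `|f x| <= B) -> trig p -> (forall x, `|p x| <= B) -> 0 < M -> 0 <= e ->
  (forall x : 'rV[R]_k, (forall i, `|x ord0 i| <= M) -> `|f x - p x| <= e) ->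
  `|\int[P]_w f (X w) - \int[P]_w p (X w)| <= e + 2 * B / M ^+ 2 * (k%:R * K).
Proof.
move=> cf fB tp pB M0 e0 hfp.
have B0 : 0 <= B by apply: le_trans (fB 0).
have mf := bounded_continuous_measurable mX cf fB.
have if_ : P.-integrable setT (EFin \o (fun w => f (X w))) by exact: (@bounded_integrable _ _ _ P _ B).
have ip := trig_integrable tp.
have c0 : 0 <= 2 * B / M ^+ 2 by rewrite !mulr_ge0// invr_ge0 exprn_ge0// ltW.
rewrite -RintegralB//; apply: le_trans (sum_sqr_Rintegral _ c0).
apply: Rintegral_abs_le.
- by have := integrableB measurableT if_ ip; apply: eq_integrable.
- exact: sum_sqr_integrable.
move=> w; have s0 : 0 <= \sum_i X w ord0 i ^+ 2.
  by apply: sumr_ge0 => i _; exact: sqr_ge0.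
have [[i hi]|none] := pselect (exists i, M <= `|X w ord0 i|).
  apply: (@le_trans _ _ (2 * B)).
    by apply: le_trans (ler_normB _ _) _; rewrite mulr_natl mulr2n lerD.
  rewrite -[leLHS]add0r lerD// -mulrA -[leLHS]mulr1 ler_wpM2l ?mulr_ge0//.
  rewrite mulrC ler_pdivlMr ?exprn_gt0// mul1r.
  apply: (@le_trans _ _ (X w ord0 i ^+ 2)).
    by rewrite -[leRHS]ger0_norm ?sqr_ge0// normrX lerXn2r ?nnegrE// ltW.
  by rewrite (bigD1 i)//= lerDl sumr_ge0// => i' _; exact: sqr_ge0.
rewrite -[leLHS]addr0; apply: lerD; last exact: mulr_ge0.
apply: hfp => i.
by rewrite leNgt; apply/negP => /ltW h; apply: none; exists i.
Qed.

End OneSpace.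

Variables (d : measure_display) (T : measurableType d) (P : probability T R).
Variable X : nat -> T -> 'rV[R]_k.
Hypothesis mX : forall n i, measurable_fun setT (fun w => X n w ord0 i).
Hypothesis iX : forall n i, P.-integrable setT (EFin \o (fun w => X n w ord0 i ^+ 2)).
Variable K : R.
Hypothesis KX : forall n i, \int[P]_w (X n w ord0 i ^+ 2) <= K.

(** Bounded second moments give tightness, so that a bounded continuous function
    may be replaced by a trigonometric polynomial, up to an error uniform in n. *)
Lemma levy_continuity d' (T' : measurableType d') (Q : probability T' R)
    (Z : T' -> 'rV[R]_k) :
  (forall i, measurable_fun setT (fun w => Z w ord0 i)) ->
  (forall i, Q.-integrable setT (EFin \o (fun w => Z w ord0 i ^+ 2))) ->
  (forall i, \int[Q]_w (Z w ord0 i ^+ 2) <= K) ->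
  (forall (t : 'I_k -> R) th,
    \int[P]_w cos (\sum_i t i * X n w ord0 i + th) @[n --> \oo] -->
    \int[Q]_w cos (\sum_i t i * Z w ord0 i + th)) ->
  forall f (B : R), continuous f -> (forall x, `|f x| <= B) ->
  \int[P]_w f (X n w) @[n --> \oo] --> \int[Q]_w f (Z w).
Proof.
move=> mZ iZ KZ hcos f B cf fB.
have trig_cvg p : trig p ->
    \int[P]_w p (X n w) @[n --> \oo] --> \int[Q]_w p (Z w).
  elim=> [t th|p1 p2 t1 h1 t2 h2|c p1 t1 h1]; first exact: hcos.
  - rewrite RintegralD//; [|exact: trig_integrable..].
    rewrite (_ : (fun n => _) = (fun n => \int[P]_w p1 (X n w) + \int[P]_w p2 (X n w))).
      exact: cvgD.
    by apply/funext => n; rewrite RintegralD//; exact: trig_integrable.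
  - rewrite RintegralZl//; last exact: trig_integrable.
    rewrite (_ : (fun n => _) = (fun n => c * \int[P]_w p1 (X n w))).
      by apply: cvgM => //; exact: cvg_cst.
    by apply/funext => n; rewrite RintegralZl//; exact: trig_integrable.
have B0 : 0 <= B by apply: le_trans (fB 0).
apply/cvgrPdist_le => e e0.
have e40 : 0 < e / 8 by rewrite divr_gt0.
pose A := `|2 * B * (k%:R * K)| / (e / 8) + 1.
have A1 : 1 <= A by rewrite lerDr divr_ge0// ltW.
have A0 : 0 < A by apply: lt_le_trans A1.
have hA : 2 * B / A ^+ 2 * (k%:R * K) <= e / 8.
  rewrite mulrAC ler_pdivrMr ?exprn_gt0//; apply: le_trans (ler_norm _) _.
  rewrite [leRHS]mulrC -ler_pdivrMr//; apply: (@le_trans _ _ A).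
    by rewrite /A lerDl.
  by rewrite expr2 ler_peMl// ltW.
have [p [tp pB hp]] := trig_approx cf fB A0 e40.
have hX n := trig_approx_Rintegral (mX n) (iX n) (KX n) cf fB tp pB A0 (ltW e40) hp.
have hZ := trig_approx_Rintegral mZ iZ KZ cf fB tp pB A0 (ltW e40) hp.
have /cvgrPdist_le /(_ (e / 8) e40) hcv := trig_cvg p tp.
near=> n.
have h1 : `|\int[Q]_w p (Z w) - \int[P]_w p (X n w)| <= e / 8 by near: n.
have h2 := hX n; move: h1 h2 hZ hA.
move: (_ / A ^+ 2 * _) (\int[Q]_w f _) (\int[P]_w f _) (\int[Q]_w p _) (\int[P]_w p _).
move=> a u v u' v'; rewrite !ler_norml; lra.
Unshelve. all: by end_near. Qed.

(** D measures how far Y is from X as long as X stays in a box; its expectation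
    tends to 0, so the event D >= 1 is negligible by Markov's inequality. *)
Lemma slutsky (Y : nat -> T -> 'rV[R]_k) :
  (forall n i, measurable_fun setT (fun w => Y n w ord0 i)) ->
  (forall M eta : R, 0 < M -> 0 < eta -> exists D : nat -> T -> R,
    [/\ forall n w, 0 <= D n w, forall n, P.-integrable setT (EFin \o D n),
        \int[P]_w D n w @[n --> \oo] --> 0 &
        forall n w, (forall i, `|X n w ord0 i| <= M) -> D n w < 1 ->
          forall i, `|X n w ord0 i - Y n w ord0 i| < eta]) ->
  forall f (B : R), continuous f -> (forall x, `|f x| <= B) ->
  \int[P]_w f (X n w) - \int[P]_w f (Y n w) @[n --> \oo] --> 0.
Proof.
move=> mY hD f B cf fB.
have B0 : 0 <= B by apply: le_trans (fB 0).
apply/cvgr0Pnorm_le => e e0.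
have e40 : 0 < e / 8 by rewrite divr_gt0.
pose A := `|2 * B * (k%:R * K)| / (e / 8) + 1.
have A1 : 1 <= A by rewrite lerDr divr_ge0// ltW.
have A0 : 0 < A by apply: lt_le_trans A1.
have hA : 2 * B / A ^+ 2 * (k%:R * K) <= e / 8.
  rewrite mulrAC ler_pdivrMr ?exprn_gt0//; apply: le_trans (ler_norm _) _.
  rewrite [leRHS]mulrC -ler_pdivrMr//; apply: (@le_trans _ _ A).
    by rewrite /A lerDl.
  by rewrite expr2 ler_peMl// ltW.
have c0 : 0 <= 2 * B / A ^+ 2 by rewrite !mulr_ge0// invr_ge0 exprn_ge0// ltW.
have [eta eta0 uc] := @box_unif_continuous R k f A (e / 8) cf e40.
have [D [D0 iD cD hDn]] := hD A eta A0 eta0.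
have /cvgr0Pnorm_le /(_ (e / 8 / (2 * B + 1))) hcv := cD.
near=> n.
have h1 : `|\int[P]_w D n w| <= e / 8 / (2 * B + 1).
  by near: n; apply: hcv; rewrite divr_gt0// ltr_wpDl// mulr_ge0.
have bf (W : T -> 'rV[R]_k) : (forall i, measurable_fun setT (fun w => W w ord0 i)) ->
    P.-integrable setT (EFin \o (fun w => f (W w))).
  move=> mW; apply: (@bounded_integrable _ _ _ P _ B) => //.
  exact: (bounded_continuous_measurable mW cf fB).
have iBD : P.-integrable setT (EFin \o (fun w => 2 * B * D n w)).
  by have := integrableZl measurableT (2 * B) (iD n); apply: eq_integrable.
have iS := sum_sqr_integrable (iX n) (2 * B / A ^+ 2) (e / 8).
rewrite -RintegralB//; [|exact: bf..].
apply: (@le_trans _ _ (\int[P]_w ((e / 8 + 2 * B / A ^+ 2 * \sum_i X n w ord0 i ^+ 2)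
    + 2 * B * D n w))).
  apply: Rintegral_abs_le.
  - by have := integrableB measurableT (bf _ (mX n)) (bf _ (mY n)); apply: eq_integrable.
  - by have := integrableD measurableT iS iBD; apply: eq_integrable.
  move=> w; have s0 : 0 <= \sum_i X n w ord0 i ^+ 2.
    by apply: sumr_ge0 => i _; exact: sqr_ge0.
  have le2B : `|f (X n w) - f (Y n w)| <= 2 * B.
    by apply: le_trans (ler_normB _ _) _; rewrite mulr_natl mulr2n lerD.
  have BD0 : 0 <= 2 * B * D n w by rewrite !mulr_ge0.
  have [[i hi]|none] := pselect (exists i, A <= `|X n w ord0 i|).
    apply: (le_trans le2B); rewrite -[leLHS]addr0 lerD//.
    rewrite -[leLHS]add0r lerD ?(ltW e40)// -[leRHS]mulrA -[leLHS]mulr1 ler_wpM2l ?mulr_ge0//.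
    rewrite mulrC ler_pdivlMr ?exprn_gt0// mul1r.
    apply: (@le_trans _ _ (X n w ord0 i ^+ 2)).
      by rewrite -[leRHS]ger0_norm ?sqr_ge0// normrX lerXn2r ?nnegrE// ltW.
    by rewrite (bigD1 i)//= lerDl sumr_ge0// => i' _; exact: sqr_ge0.
  have hX i : `|X n w ord0 i| <= A.
    by rewrite leNgt; apply/negP => /ltW h; apply: none; exists i.
  have [Dw|Dw] := ltP (D n w) 1.
    rewrite -[leLHS]addr0; apply: lerD => //.
    rewrite -[leLHS]addr0; apply: lerD; last exact: mulr_ge0.
    by apply/ltW/uc => //; exact: hDn.
  apply: (le_trans le2B); rewrite -[leLHS]add0r lerD//.
    by rewrite addr_ge0 ?(ltW e40)// mulr_ge0.
  by rewrite -[leLHS]mulr1 ler_wpM2l ?mulr_ge0.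
rewrite RintegralD// RintegralZl//.
have h2 := sum_sqr_Rintegral (iX n) (KX n) (e / 8) c0.
have h3 : 2 * B * \int[P]_w D n w <= e / 8.
  apply: le_trans (_ : (2 * B + 1) * `|\int[P]_w D n w| <= _).
    by apply: ler_pM; rewrite ?mulr_ge0 ?lerDl ?ler_norm// Rintegral_ge0.
  by rewrite mulrC -ler_pdivlMr// ltr_wpDl// mulr_ge0.
move: h2 h3 hA; lra.
Unshelve. all: by end_near. Qed.

End Convergence.

(** * Invariant tensors in real harmonic coordinates *)

Section HarmonicBasis.
Local Open Scope complex_scope.
Local Open Scope ring_scope.
Context {R : realType}.
Implicit Types (l : nat) (m : int) (i j : nat).

Let s : R[i] := ((Num.sqrt 2)^-1)%:C.
Let ii : R[i] := 'i%C.

Let s2 : s * s = 2^-1.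
Proof.
rewrite /s -rmorphM /= -invfM -expr2 sqr_sqrtr ?ler0n//.
by rewrite fmorphV rmorphMn.
Qed.

Let ii2 : ii * ii = -1. Proof. by rewrite -expr2 sqr_i. Qed.

(** The unitary matrix U = hbasis l expresses the complex coefficients by real
    coordinates g, with a_lm = sqrt (C_l) sum_i U_mi g_i.  Position l + |m| holds
    the real part of a_l|m|, position l - |m| its imaginary part; hbasisA and
    hbasisB are the entries of row m at these two positions. *)
Definition hbasisA m : R[i] :=
  if m == 0 then 1 else if 0 < m then s else (-1) ^+ `|m|%N * s.

Definition hbasisB m : R[i] :=
  if m == 0 then 0 else if 0 < m then ii * s else - ((-1) ^+ `|m|%N * (ii * s)).

Definition hbasis l m i : R[i] :=
  hbasisA m * (i == l + `|m|)%N%:R + hbasisB m * (i == l - `|m|)%N%:R.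

Let conj_s : s^*%C = s. Proof. by rewrite /s /= oppr0. Qed.
Let conj_ii : ii^*%C = - ii. Proof. by rewrite /ii /= -[- (1 : R)]/(- 1) ; apply/eqP; rewrite eq_complex /= oppr0 !eqxx. Qed.

Let conjM (x y : R[i]) : (x * y)^*%C = x^*%C * y^*%C.
Proof. exact: rmorphM. Qed.
Let conjD (x y : R[i]) : (x + y)^*%C = x^*%C + y^*%C.
Proof. exact: rmorphD. Qed.
Let conjN (x : R[i]) : (- x)^*%C = - x^*%C.
Proof. exact: rmorphN. Qed.

Lemma conj_sign (n : nat) : ((-1) ^+ n : R[i])^*%C = (-1) ^+ n.
Proof. by rewrite [LHS](rmorphXn (@conjc R)) (rmorphN1 (@conjc R)). Qed.

Lemma hbasisA_conj m : (hbasisA m)^*%C = (-1) ^+ `|m|%N * hbasisA (- m).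
Proof.
rewrite /hbasisA oppr_eq0 oppr_gt0 abszN; case: (ltgtP m 0) => [m0|m0|->].
- by rewrite conjM conj_sign conj_s.
- by rewrite conj_s mulrA -exprMn mulrNN mulr1 expr1n mul1r.
- by rewrite expr0 mul1r conjc1.
Qed.

Lemma hbasisB_conj m : (hbasisB m)^*%C = (-1) ^+ `|m|%N * hbasisB (- m).
Proof.
rewrite /hbasisB oppr_eq0 oppr_gt0 abszN; case: (ltgtP m 0) => [m0|m0|->].
- by rewrite conjN !conjM conj_sign conj_s conj_ii; ring.
- rewrite conjM conj_s conj_ii mulrN mulrA -exprMn mulrNN mulr1 expr1n mul1r.
  by rewrite mulNr.
- by rewrite mulr0 conjc0.
Qed.

Lemma conj_nat (n : nat) : (n%:R : R[i])^*%C = n%:R.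
Proof. by rewrite (rmorph_nat (@conjc R)). Qed.

Lemma hbasis_conj l m i :
  (hbasis l m i)^*%C = (-1) ^+ `|m|%N * hbasis l (- m) i.
Proof.
rewrite /hbasis conjD !conjM !conj_nat hbasisA_conj hbasisB_conj abszN.
by ring.
Qed.

Let sum_delta l (p q : nat) : (p < (2 * l).+1)%N ->
  \sum_(i < (2 * l).+1) (i == p :> nat)%:R * (i == q :> nat)%:R = (p == q)%:R :> R[i].
Proof.
move=> hp; rewrite (bigD1 (Ordinal hp)) //= eqxx mul1r big1 ?addr0// => i ni.
rewrite (_ : (i == p :> nat) = false) ?mul0r//; apply/negbTE.
by apply: contra ni => /eqP e; apply/eqP/val_inj.
Qed.

Lemma hbasis_orthonormal l m m' : `|m| <= l%:Z -> `|m'| <= l%:Z ->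
  \sum_(i < (2 * l).+1) hbasis l m i * (hbasis l m' i)^*%C = (m == m')%:R.
Proof.
move=> hm hm'.
set A := hbasisA m; set B := hbasisB m.
set A' := (hbasisA m')^*%C; set B' := (hbasisB m')^*%C.
have -> : \sum_(i < (2 * l).+1) hbasis l m i * (hbasis l m' i)^*%C
    = A * A' * (l + `|m| == l + `|m'|)%N%:R + A * B' * (l + `|m| == l - `|m'|)%N%:R
    + B * A' * (l - `|m| == l + `|m'|)%N%:R + B * B' * (l - `|m| == l - `|m'|)%N%:R.
  rewrite -!(@sum_delta l) ?mulr_sumr -?big_split /=; [|lia..].
  apply: eq_bigr => i _; rewrite /hbasis conjD !conjM !conj_nat -/A -/B -/A' -/B'.
  by ring.
rewrite eqn_add2l.
have -> : (l - `|m| == l - `|m'|)%N = (`|m| == `|m'|)%N by lia.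
have [e|ne] := eqVneq `|m|%N `|m'|%N; last first.
  have -> : (l + `|m| == l - `|m'|)%N = false by lia.
  have -> : (l - `|m| == l + `|m'|)%N = false by lia.
  have -> : (m == m') = false by lia.
  by rewrite !mulr0 !addr0.
have [m0|m0] := eqVneq m 0.
  have m0' : m' = 0 by lia.
  rewrite /A /B /A' /B' m0 m0' /hbasisA /hbasisB eqxx conjc0 conjc1.
  by rewrite !(mul0r, mulr0, mul1r, addr0).
have -> : (l + `|m| == l - `|m'|)%N = false by lia.
have -> : (l - `|m| == l + `|m'|)%N = false by lia.
rewrite !mulr0 !addr0 !mulr1.
have nn (x : R[i]) : (-1) ^+ `|m'|%N * ((-1) ^+ `|m'|%N * x) = x.
  by rewrite mulrA -exprMn mulrNN mulr1 expr1n mul1r.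
have h2 : s * s + s * s = 1 by rewrite s2; field.
rewrite /A' /B' hbasisA_conj hbasisB_conj.
have [em|em] : m' = m \/ m' = - m by lia.
- rewrite em eqxx /A /B /hbasisA /hbasisB !oppr_eq0 !oppr_gt0 abszN (negbTE m0).
  rewrite em in nn; have [mp|mp] := ltrP 0 m.
    rewrite (lt_gtF mp) nn mulrN nn -[RHS]h2.
    rewrite [LHS](_ : _ = s * s - ii * ii * (s * s)); last by ring.
    by rewrite ii2 mulN1r opprK.
  have -> : (m < 0) = true by lia.
  rewrite -[RHS]h2; have := nn 1; rewrite mulr1.
  set x := (-1) ^+ _ => xx; rewrite [LHS](_ : _ = x * x * (s * s - ii * ii * (s * s))).
    by rewrite xx ii2 mulN1r opprK mul1r.
  by ring.
have -> : (m == m') = false by lia.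
rewrite em abszN opprK -/A -/B.
have AABB : A * A + B * B = 0.
  rewrite /A /B /hbasisA /hbasisB (negbTE m0); case: ifP => _.
    rewrite [LHS](_ : _ = s * s * (1 + ii * ii)); last by ring.
    by rewrite ii2 subrr mulr0.
  set x := (-1) ^+ _; rewrite (_ : _ * _ + _ = x * x * (s * s) * (1 + ii * ii)).
    by rewrite ii2 subrr mulr0.
  by ring.
by rewrite mulrCA [X in _ + X]mulrCA -mulrDr AABB mulr0.
Qed.

Definition sqmod (z : R[i]) : R := complex.Re z ^+ 2 + complex.Im z ^+ 2.

Lemma sqmodE z : (sqmod z)%:C = z * z^*%C.
Proof.
case: z => a b; rewrite /sqmod /=; apply/eqP; rewrite eq_complex /=.
by rewrite mulrN opprK -!expr2 mulrN [b * a]mulrC addNr !eqxx.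
Qed.

Lemma sqmodM (z z' : R[i]) : sqmod (z * z') = sqmod z * sqmod z'.
Proof. by case: z z' => a b [a' b']; rewrite /sqmod /=; ring. Qed.

Lemma sqmod_real (x : R) : sqmod x%:C = x ^+ 2.
Proof. by rewrite /sqmod /= [0 ^+ 2]expr2 mul0r addr0. Qed.

Let complexR_inj : injective (fun x : R => x%:C).
Proof. by move=> x y []. Qed.

Lemma zsum_real l (F : int -> R) : (zsum l F)%:C = zsum l (fun m => (F m)%:C).
Proof. exact: (rmorph_sum (real_complex R)). Qed.

Lemma hbasis_isometry l (z : int -> R[i]) :
  \sum_(i < (2 * l).+1) sqmod (zsum l (fun m => hbasis l m i * z m))
  = zsum l (fun m => sqmod (z m)).
Proof.
apply: complexR_inj; rewrite zsum_real (rmorph_sum (real_complex R)) /=.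
under eq_bigr => i _.
  rewrite sqmodE /zsum (rmorph_sum (@conjc R)) /= big_distrlr /=.
  over.
rewrite exchange_big /=; apply: eq_bigr => m _.
rewrite exchange_big /= (bigD1 m) //= [X in _ + X]big1 ?addr0.
  have := hbasis_orthonormal (mval_range m) (mval_range m); rewrite eqxx => h.
  rewrite sqmodE -[RHS]mul1r -[1 in RHS]h.
  by rewrite mulr_suml; apply: eq_bigr => i _; rewrite conjM; ring.
move=> m' nm; have nmm : mval m != mval m'.
  by apply: contra nm => /eqP e; apply/eqP/val_inj => /=; move: e; rewrite /mval; lia.
have := hbasis_orthonormal (mval_range m) (mval_range m'); rewrite (negbTE nmm) => h.
rewrite -[RHS](mul0r (z (mval m) * (z (mval m'))^*%C)) -[0 in RHS]h mulr_suml.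
by apply: eq_bigr => i _; rewrite conjM; ring.
Qed.

(** Orthonormality of the rows of a square matrix gives that of its columns. *)
Lemma hbasis_complete l (x : nat -> R) :
  zsum l (fun m => sqmod (\sum_(i < (2 * l).+1) hbasis l m i * (x i)%:C))
  = \sum_(i < (2 * l).+1) x i ^+ 2.
Proof.
pose M : 'M[R[i]]_((2 * l).+1) := \matrix_(m, i) hbasis l (mval m) i.
pose N : 'M[R[i]]_((2 * l).+1) := \matrix_(i, m) (hbasis l (mval m) i)^*%C.
have MN : M *m N = 1%:M.
  apply/matrixP => m m'; rewrite !mxE.
  have := hbasis_orthonormal (mval_range m) (mval_range m').
  have -> : (mval m == mval m') = (m == m').
    by apply/eqP/eqP => [|->//] e; apply/val_inj => /=; move: e; rewrite /mval; lia.
  by move=> <-; apply: eq_bigr => i _; rewrite !mxE.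
have NM (i i' : 'I_(2 * l).+1) : \sum_(m < (2 * l).+1) (hbasis l (mval m) i)^*%C * hbasis l (mval m) i' = (i == i')%:R
    :> R[i].
  have := congr1 (fun A : 'M[_]_((2 * l).+1) => A i i') (mulmx1C MN); rewrite !mxE => <-.
  by apply: eq_bigr => m _; rewrite !mxE.
apply: complexR_inj; rewrite zsum_real (rmorph_sum (real_complex R)) /=.
under eq_zsum => m _.
  rewrite sqmodE (rmorph_sum (@conjc R)) /= big_distrlr /=.
  over.
rewrite /zsum exchange_big /=; apply: eq_bigr => i _.
rewrite exchange_big /= (bigD1 i) //= [X in _ + X]big1 ?addr0.
  have h := NM i i; rewrite eqxx mulr1n in h; rewrite -[RHS]mul1r -[1 in RHS]h.
  rewrite mulr_suml; apply: eq_bigr => m _.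
  by rewrite conjM conjc_real [(x i ^+ 2)%:C](rmorphXn (real_complex R)) /=; ring.
move=> i' ni; have := NM i' i; rewrite (negbTE ni) => h.
rewrite -[RHS](mul0r ((x i)%:C * (x i')%:C)) -[0 in RHS]h mulr_suml.
by apply: eq_bigr => m _; rewrite conjM conjc_real; ring.
Qed.

End HarmonicBasis.

Section HarmonicTensor.
Local Open Scope complex_scope.
Local Open Scope ring_scope.
Context {R : realType}.
Implicit Types (l : nat) (m : int) (w : int -> int -> int -> R).

(** The tensor w in the real coordinates of its three slots. *)
Definition htensor l1 l2 l3 w (i j k : nat) : R[i] :=
  zsum l1 (fun m1 => hbasis l1 m1 i * zsum l2 (fun m2 => hbasis l2 m2 j *
    zsum l3 (fun m3 => hbasis l3 m3 k * (w m1 m2 m3)%:C))).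

(** For the 3j symbols htensor is real, by htensor_real. *)
Definition rtensor l1 l2 l3 w (i j k : nat) : R := complex.Re (htensor l1 l2 l3 w i j k).

Lemma mulr_zsumCr l (x : R[i]) (F : int -> R[i]) :
  x * zsum l F = zsum l (fun m => x * F m).
Proof. exact: mulr_sumr. Qed.

(** Contractions in different slots commute. *)
Lemma zsum_swap l1 l2 (f g : int -> R[i]) (F : int -> int -> R[i]) :
  zsum l1 (fun a => f a * zsum l2 (fun b => g b * F a b))
  = zsum l2 (fun b => g b * zsum l1 (fun a => f a * F a b)).
Proof.
under eq_zsum do rewrite mulr_zsumCr.
under [RHS]eq_zsum do rewrite mulr_zsumCr.
rewrite exchange_zsum; apply: eq_zsum => b _; apply: eq_zsum => a _.
by rewrite mulrCA.
Qed.

Lemma rtensor_swap12 l1 l2 l3 w i j k :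
  rtensor l2 l1 l3 (fun a b c => w b a c) j i k = rtensor l1 l2 l3 w i j k.
Proof. by rewrite /rtensor /htensor zsum_swap. Qed.

Lemma rtensor_swap23 l1 l2 l3 w i j k :
  rtensor l1 l3 l2 (fun a b c => w a c b) i k j = rtensor l1 l2 l3 w i j k.
Proof.
rewrite /rtensor /htensor; congr complex.Re.
by apply: eq_zsum => m1 _; rewrite zsum_swap.
Qed.

Lemma eq_rtensor l1 l2 l3 w w' i j k : (forall a b c, w a b c = w' a b c) ->
  rtensor l1 l2 l3 w i j k = rtensor l1 l2 l3 w' i j k.
Proof.
move=> e; congr complex.Re; apply: eq_zsum => a _; congr (_ * _).
apply: eq_zsum => b _; congr (_ * _).
by apply: eq_zsum => c _; rewrite e.
Qed.

(** Conjugation replaces each m by -m with sign (-1)^m; the three signs cancel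
    because m1 + m2 + m3 = 0. *)
Lemma htensor_real l1 l2 l3 w i j k :
  (forall a b c, w (- a) (- b) (- c) = w a b c) ->
  (forall a b c, a + b + c != 0 -> w a b c = 0) ->
  htensor l1 l2 l3 w i j k = (rtensor l1 l2 l3 w i j k)%:C.
Proof.
move=> wN w0; suff h : (htensor l1 l2 l3 w i j k)^*%C = htensor l1 l2 l3 w i j k.
  rewrite /rtensor; move: h; case: (htensor _ _ _ _ _ _ _) => x y [/eqP].
  by rewrite eqNr => /eqP ->.
have conjM (x y : R[i]) : (x * y)^*%C = x^*%C * y^*%C by exact: rmorphM.
have conjS l (F : int -> R[i]) : (zsum l F)^*%C = zsum l (fun m => (F m)^*%C).
  exact: (rmorph_sum (@conjc R)).
rewrite /htensor conjS -zsumN.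
under eq_zsum => a _.
  rewrite conjM hbasis_conj opprK abszN conjS -zsumN.
  under eq_zsum => b _.
    rewrite conjM hbasis_conj opprK abszN conjS -zsumN.
    under eq_zsum => c _.
      rewrite conjM hbasis_conj opprK abszN conjc_real wN.
      rewrite (_ : _ * _ * _ = (-1) ^+ `|c|%N * (hbasis l3 c k * (w a b c)%:C)).
        over.
      by ring.
    over.
  over.
apply: eq_zsum => a _; rewrite -mulrA mulrCA mulr_zsumCr; congr (_ * _).
apply: eq_zsum => b _.
rewrite [LHS](_ : _ = hbasis l2 b j * (((-1) ^+ `|a|%N * (-1) ^+ `|b|%N) *
  zsum l3 (fun c => (-1) ^+ `|c|%N * (hbasis l3 c k * (w a b c)%:C)))); last by ring.
rewrite mulr_zsumCr; congr (_ * _); apply: eq_zsum => c _.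
have [e|ne] := eqVneq (a + b + c) 0; last by rewrite w0// !mulr0.
rewrite mulrA -!exprD.
suff -> : (-1) ^+ (`|a| + `|b| + `|c|) = 1 :> R[i] by rewrite mul1r.
rewrite -signr_odd; suff -> : odd (`|a| + `|b| + `|c|) = false by rewrite expr0.
by apply/negbTE; lia.
Qed.

Lemma sqmod_Re (z : R[i]) : complex.Re z ^+ 2 <= sqmod z.
Proof. by rewrite /sqmod lerDl sqr_ge0. Qed.

Lemma htensor_contract3 l1 l2 l3 w (x : nat -> R[i]) i j :
  \sum_(k < (2 * l3).+1) htensor l1 l2 l3 w i j k * x k =
  zsum l1 (fun m1 => hbasis l1 m1 i * zsum l2 (fun m2 => hbasis l2 m2 j *
   zsum l3 (fun m3 => (\sum_(k < (2 * l3).+1) hbasis l3 m3 k * x k) * (w m1 m2 m3)%:C))).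
Proof.
rewrite /htensor; under eq_bigr do rewrite mulr_suml.
rewrite exchange_big /=; apply: eq_bigr => a _.
under eq_bigr do rewrite -mulrA mulr_suml.
rewrite -mulr_sumr exchange_big /=; congr (_ * _); apply: eq_bigr => b _.
under eq_bigr do rewrite -mulrA mulr_suml.
rewrite -mulr_sumr exchange_big /=; congr (_ * _); apply: eq_bigr => c _.
by rewrite mulr_suml; apply: eq_bigr => k _; ring.
Qed.

(** A sum with at most one nonzero term. *)
Lemma sqmod_sum_single l (z : int -> R[i]) (f : int -> R) :
  (forall a b, f a != 0 -> f b != 0 -> a = b) ->
  sqmod (zsum l (fun m => z m * (f m)%:C)) = zsum l (fun m => sqmod (z m) * f m ^+ 2).
Proof.
move=> f1; have sq0 : sqmod (0 : R[i]) = 0 by rewrite -[0]/(0%:C) sqmod_real expr2 mul0r.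
have [[i fi]|no] := pselect (exists i : 'I_(2 * l).+1, f (mval i) != 0); last first.
  have f0 (i : 'I_(2 * l).+1) : f (mval i) = 0.
    by apply/eqP; apply: contra_notT no => ?; exists i.
  rewrite /zsum !big1 ?sq0// => i _; rewrite f0; first by rewrite expr2 mulr0 mulr0.
  by rewrite mulr0.
have f0 m : m != mval i -> f m = 0.
  by move=> ne; apply/eqP; apply: contraNT ne => fm; rewrite (f1 _ _ fm fi).
rewrite (zsum1 (mval_range i)); last by move=> m /f0 ->; rewrite mulr0.
rewrite (zsum1 (mval_range i)); last by move=> m /f0 ->; rewrite expr2 !mulr0.
by rewrite sqmodM sqmod_real.
Qed.

Definition sqnorm l1 l2 l3 w : R :=
  zsum l1 (fun a => zsum l2 (fun b => zsum l3 (fun c => w a b c ^+ 2))).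

Lemma sqnorm_swap12 l1 l2 l3 w :
  sqnorm l2 l1 l3 (fun a b c => w b a c) = sqnorm l1 l2 l3 w.
Proof. by rewrite /sqnorm exchange_zsum. Qed.

Lemma sqnorm_swap23 l1 l2 l3 w :
  sqnorm l1 l3 l2 (fun a b c => w a c b) = sqnorm l1 l2 l3 w.
Proof. by rewrite /sqnorm; apply: eq_zsum => a _; rewrite exchange_zsum. Qed.

Lemma sqnorm_sqnorm3 l1 l2 l3 w : su2_invariant l1 l2 l3 w ->
  forall m, `|m| <= l3%:Z -> sqnorm3 l1 l2 w m = sqnorm l1 l2 l3 w / (2 * l3).+1%:R.
Proof.
move=> inv m hm; rewrite /sqnorm (sqnorm3_total inv hm) mulrAC mulfV ?mul1r//.
Qed.

(** By the isometries in the first two slots this is a statement about w, where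
    m1 and m2 leave a single value of m3, and where sqnorm3 is constant. *)
Lemma htensor_flat3 l1 l2 l3 w (x : nat -> R) : su2_invariant l1 l2 l3 w ->
  \sum_(i < (2 * l1).+1) \sum_(j < (2 * l2).+1)
    sqmod (\sum_(k < (2 * l3).+1) htensor l1 l2 l3 w i j k * (x k)%:C)
  = sqnorm l1 l2 l3 w / (2 * l3).+1%:R * \sum_(k < (2 * l3).+1) x k ^+ 2.
Proof.
move=> inv; rewrite exchange_big /=.
under eq_bigr => j _.
  under eq_bigr => i _ do rewrite (htensor_contract3 l1 l2 l3 w (fun k => (x k)%:C)).
  rewrite hbasis_isometry; over.
rewrite [LHS]exchange_big /=.
under eq_bigr => a _ do rewrite hbasis_isometry.
rewrite -(hbasis_complete l3 x) mulr_sumr.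
transitivity (zsum l1 (fun a => zsum l2 (fun b => zsum l3 (fun c =>
   sqmod (\sum_(k < (2 * l3).+1) hbasis l3 c k * (x k)%:C) * w a b c ^+ 2)))).
  apply: eq_bigr => a _; apply: eq_zsum => b _.
  rewrite sqmod_sum_single// => c c' h h'.
  have s (c0 : int) : w (mval a) b c0 != 0 -> mval a + b + c0 = 0.
    by move=> h0; apply/eqP; apply: contraNT h0 => h1; rewrite (inv_sum0 inv)// eqxx.
  by move: (s _ h) (s _ h'); lia.
rewrite exchange_zsum; under eq_zsum do rewrite exchange_zsum.
rewrite exchange_zsum; apply: eq_bigr => c _.
rewrite -(sqnorm_sqnorm3 inv (mval_range c)) /sqnorm3 mulrC.
rewrite exchange_zsum /zsum mulr_sumr; apply: eq_bigr => b _.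
by rewrite mulr_sumr.
Qed.

(** The factor 1 / (2 l3 + 1) is the source of the asymptotic normality. *)
Lemma rtensor_flat3 l1 l2 l3 w (x : nat -> R) : su2_invariant l1 l2 l3 w ->
  \sum_(i < (2 * l1).+1) \sum_(j < (2 * l2).+1)
    (\sum_(k < (2 * l3).+1) rtensor l1 l2 l3 w i j k * x k) ^+ 2
  <= sqnorm l1 l2 l3 w / (2 * l3).+1%:R * \sum_(k < (2 * l3).+1) x k ^+ 2.
Proof.
move=> inv; rewrite -(htensor_flat3 x inv); apply: ler_sum => i _; apply: ler_sum => j _.
rewrite (_ : \sum_(k < _) rtensor _ _ _ _ _ _ _ * _ =
  complex.Re (\sum_(k < (2 * l3).+1) htensor l1 l2 l3 w i j k * (x k)%:C)) ?sqmod_Re//.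
rewrite (raddf_sum (@complex.Re R)); apply: eq_bigr => k _; rewrite /rtensor.
by case: (htensor _ _ _ _ _ _ _) => a b /=; rewrite mulr0 subr0.
Qed.

(** The equality htensor_flat3 is summed over the standard basis vectors of the
    third slot. *)
Lemma rtensor_total l1 l2 l3 w : su2_invariant l1 l2 l3 w ->
  (forall a b c, w (- a) (- b) (- c) = w a b c) ->
  \sum_(i < (2 * l1).+1) \sum_(j < (2 * l2).+1) \sum_(k < (2 * l3).+1)
    rtensor l1 l2 l3 w i j k ^+ 2 = sqnorm l1 l2 l3 w.
Proof.
move=> inv wN.
have hk (k : 'I_(2 * l3).+1) : \sum_(i < (2 * l1).+1) \sum_(j < (2 * l2).+1)
    rtensor l1 l2 l3 w i j k ^+ 2 = sqnorm l1 l2 l3 w / (2 * l3).+1%:R.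
  have dE (F : nat -> R) : \sum_(i < (2 * l3).+1) F i * (i == k :> nat)%:R = F k.
    rewrite (bigD1 k) //= eqxx mulr1 big1 ?addr0// => i ni.
    rewrite (_ : (i == k :> nat) = false) ?mulr0//; apply/negbTE.
    by apply: contra ni => /eqP e; apply/eqP/val_inj.
  have d1 : \sum_(i < (2 * l3).+1) ((i == k :> nat)%:R : R) ^+ 2 = 1.
    rewrite -[RHS](dE (fun=> 1)); apply: eq_bigr => i _.
    by rewrite mul1r; case: eqP; rewrite ?expr1n ?expr2 ?mul0r.
  rewrite -[RHS]mulr1 -[X in _ * X]d1.
  rewrite -(htensor_flat3 (fun i => (i == k :> nat)%:R) inv).
  apply: eq_bigr => i _; apply: eq_bigr => j _.
  rewrite (eq_bigr (fun c : 'I_(2 * l3).+1 =>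
    (rtensor l1 l2 l3 w i j c * (c == k :> nat)%:R)%:C)); last first.
    by move=> c _; rewrite htensor_real ?[RHS](rmorphM (real_complex R))// => a b c' s; exact: inv_sum0 inv s.
  by rewrite -(rmorph_sum (real_complex R)) /= dE sqmod_real.
under eq_bigr do rewrite exchange_big /=.
rewrite exchange_big /= (eq_bigr _ (fun k _ => hk k)) sumr_const card_ord.
by rewrite -[LHS]mulr_natr divfK// pnatr_eq0.
Qed.

(** The Euclidean trace in real coordinates is the alternating sum over pairs
    (m, -m). *)
Lemma rtensor_trace12 l l3 w k : (0 < l3)%N -> su2_invariant l l l3 w ->
  \sum_(i < (2 * l).+1) rtensor l l l3 w i i k = 0.
Proof.
move=> l30 inv; rewrite -(raddf_sum (@complex.Re R)) /=.
suff -> : \sum_(i < (2 * l).+1) htensor l l l3 w i i k = 0 by [].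
have sgn (n : nat) (x : R[i]) : (-1) ^+ n * ((-1) ^+ n * x) = x.
  by rewrite mulrA -exprMn mulrNN mulr1 expr1n mul1r.
have hb (m m' : int) : `|m| <= l%:Z -> `|m'| <= l%:Z ->
    \sum_(i < (2 * l).+1) hbasis l m i * hbasis l m' i = (-1) ^+ `|m'|%N * (m' == - m)%:R :> R[i].
  move=> h h'; have hN : `|- m'| <= l%:Z by lia.
  have -> : (m' == - m) = (m == - m') by lia.
  rewrite -(hbasis_orthonormal h hN) mulr_sumr; apply: eq_bigr => i _.
  by rewrite hbasis_conj opprK abszN mulrCA sgn.
transitivity (zsum l (fun m1 => zsum l (fun m2 =>
    (\sum_(i < (2 * l).+1) hbasis l m1 i * hbasis l m2 i) *
    zsum l3 (fun m3 => hbasis l3 m3 k * (w m1 m2 m3)%:C)))).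
  rewrite /htensor exchange_big /=; apply: eq_bigr => m1 _.
  under eq_bigr do rewrite mulr_zsumCr.
  rewrite exchange_big /=; apply: eq_bigr => m2 _.
  by rewrite mulr_suml; apply: eq_bigr => i _; rewrite mulrA.
transitivity (zsum l (fun m1 => (-1) ^+ `|m1|%N *
    zsum l3 (fun m3 => hbasis l3 m3 k * (w m1 (- m1) m3)%:C))).
  apply: eq_zsum => m1 hm1; rewrite (@zsum1 _ l (- m1)) ?normrN//.
    by rewrite hb ?normrN// eqxx mulr1 abszN.
  move=> m2 ne; have [hm2|hm2] := lerP `|m2| l%:Z; first by rewrite hb// (negbTE ne) mulr0 mul0r.
  rewrite [X in _ * X](_ : _ = 0) ?mulr0// -[RHS](zsum0 l3); apply: eq_zsum => m3 _.
  rewrite (inv_supp inv) ?mulr0//; lia.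
transitivity (zsum l3 (fun m3 => hbasis l3 m3 k * (zsum l (fun m => (-1) ^ m * w m (- m) m3))%:C)).
  under eq_zsum do rewrite mulr_zsumCr.
  rewrite exchange_zsum; apply: eq_zsum => m3 _.
  rewrite zsum_real mulr_zsumCr; apply: eq_zsum => m1 _.
  rewrite mulrCA (rmorphM (real_complex R)) /=; congr (_ * (_ * _)).
  rewrite [RHS](fmorphXz (real_complex R)) /= (rmorphN1 (real_complex R)).
  by case: m1 => n //=; rewrite /exprz -[RHS]exprVn invrN1.
rewrite -[RHS](zsum0 l3); apply: eq_zsum => m3 _.
by rewrite (invariant_trace0 l30 inv) mulr0.
Qed.

Lemma zsum3_rtensor l1 l2 l3 w (x1 x2 x3 : nat -> R) (a1 a2 a3 : int -> R[i]) :
  (forall m, `|m| <= l1%:Z -> a1 m = \sum_(i < (2 * l1).+1) hbasis l1 m i * (x1 i)%:C) ->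
  (forall m, `|m| <= l2%:Z -> a2 m = \sum_(i < (2 * l2).+1) hbasis l2 m i * (x2 i)%:C) ->
  (forall m, `|m| <= l3%:Z -> a3 m = \sum_(i < (2 * l3).+1) hbasis l3 m i * (x3 i)%:C) ->
  complex.Re (zsum l1 (fun m1 => zsum l2 (fun m2 => zsum l3 (fun m3 =>
    (w m1 m2 m3)%:C * a1 m1 * a2 m2 * a3 m3)))) =
  \sum_(i < (2 * l1).+1) \sum_(j < (2 * l2).+1) \sum_(k < (2 * l3).+1)
    rtensor l1 l2 l3 w i j k * (x1 i * x2 j * x3 k).
Proof.
move=> h1 h2 h3.
transitivity (complex.Re (\sum_(i < (2 * l1).+1) \sum_(j < (2 * l2).+1) \sum_(k < (2 * l3).+1)
    htensor l1 l2 l3 w i j k * (x1 i * x2 j * x3 k)%:C)); last first.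
  rewrite (raddf_sum (@complex.Re R)); apply: eq_bigr => i _.
  rewrite (raddf_sum (@complex.Re R)); apply: eq_bigr => j _.
  rewrite (raddf_sum (@complex.Re R)); apply: eq_bigr => k _.
  by rewrite /rtensor; case: (htensor _ _ _ _ _ _ _) => a b /=; rewrite mulr0 subr0.
congr complex.Re.
transitivity (zsum l1 (fun m1 => a1 m1 * zsum l2 (fun m2 => a2 m2 * zsum l3 (fun m3 =>
  a3 m3 * (w m1 m2 m3)%:C)))).
  apply: eq_zsum => m1 _; rewrite mulr_zsumCr; apply: eq_zsum => m2 _.
  by rewrite !mulr_zsumCr; apply: eq_zsum => m3 _; ring.
transitivity (\sum_(i < (2 * l1).+1) (x1 i)%:C * \sum_(j < (2 * l2).+1) (x2 j)%:C *
   \sum_(k < (2 * l3).+1) htensor l1 l2 l3 w i j k * (x3 k)%:C); last first.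
  apply: eq_bigr => i _; rewrite mulr_sumr; apply: eq_bigr => j _.
  rewrite !mulr_sumr; apply: eq_bigr => k _.
  by rewrite !(rmorphM (real_complex R)) /=; ring.
under [RHS]eq_bigr => i _.
  under eq_bigr => j _.
    rewrite (htensor_contract3 l1 l2 l3 w (fun k => (x3 k)%:C)).
    rewrite mulr_zsumCr.
    over.
  rewrite exchange_big /= mulr_sumr.
  under eq_bigr => m1 _.
    under eq_bigr => j _ do rewrite mulrCA mulr_zsumCr.
    rewrite -mulr_sumr mulrA exchange_big /=.
    over.
  over.
rewrite exchange_big /=; apply: eq_bigr => m1 _.
rewrite -mulr_suml (h1 _ (mval_range m1)); congr (_ * _).
  by apply: eq_bigr => i _; rewrite mulrC.
apply: eq_bigr => m2 _; rewrite (h2 _ (mval_range m2)) mulr_suml; apply: eq_bigr => j _.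
rewrite mulrCA mulrA; congr (_ * _); apply: eq_zsum => m3 hm3; by rewrite (h3 _ hm3).
Qed.

End HarmonicTensor.

(** * Symmetrized combinations of tensors *)

Section Symmetrization.
Local Open Scope complex_scope.
Local Open Scope ring_scope.
Context {R : realType} {J : finType}.
Implicit Types F G : J -> J -> J -> R.

Definition sym3 F a b c : R :=
  6^-1 * (F a b c + F b a c + F a c b + F b c a + F c a b + F c b a).

Lemma sym3_C12 F a b c : sym3 F a b c = sym3 F b a c.
Proof. by rewrite /sym3; congr (_ * _); ring. Qed.

Lemma sym3_C23 F a b c : sym3 F a b c = sym3 F a c b.
Proof. by rewrite /sym3; congr (_ * _); ring. Qed.

Definition sum3 F : R := \sum_a \sum_b \sum_c F a b c.

Lemma sum3_12 F : sum3 (fun a b c => F b a c) = sum3 F.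
Proof. exact: exchange_big. Qed.

Lemma sum3_23 F : sum3 (fun a b c => F a c b) = sum3 F.
Proof. by apply: eq_bigr => a _; exact: exchange_big. Qed.

Lemma eq_sum3 F G : (forall a b c, F a b c = G a b c) -> sum3 F = sum3 G.
Proof.
by move=> e; apply: eq_bigr => a _; apply: eq_bigr => b _; apply: eq_bigr => c _.
Qed.

Lemma sum3D F G : sum3 (fun a b c => F a b c + G a b c) = sum3 F + sum3 G.
Proof.
rewrite /sum3 -big_split; apply: eq_bigr => a _ /=.
rewrite -big_split; apply: eq_bigr => b _ /=; exact: big_split.
Qed.

Lemma sum3Z k F : sum3 (fun a b c => k * F a b c) = k * sum3 F.
Proof.
rewrite /sum3 mulr_sumr; apply: eq_bigr => a _; rewrite mulr_sumr.
by apply: eq_bigr => b _; rewrite mulr_sumr.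
Qed.

Lemma sum3_sum (I : finType) (F : I -> J -> J -> J -> R) :
  sum3 (fun a b c => \sum_i F i a b c) = \sum_i sum3 (F i).
Proof.
rewrite /sum3 [RHS]exchange_big; apply: eq_bigr => a _ /=.
rewrite [RHS]exchange_big; apply: eq_bigr => b _ /=; exact: exchange_big.
Qed.

(** Reindexing the sum moves each permutation from F to S, which absorbs it. *)
Lemma sum3_sym3 F S : (forall a b c, S a b c = S b a c) ->
  (forall a b c, S a b c = S a c b) ->
  sum3 (fun a b c => sym3 F a b c * S a b c) = sum3 (fun a b c => F a b c * S a b c).
Proof.
move=> s12 s23; pose H a b c := F a b c * S a b c.
have e : forall a b c, sym3 F a b c * S a b c = 6^-1 *
    (H a b c + H b a c + H a c b + H b c a + H c a b + H c b a).
  move=> a b c; rewrite /H /sym3.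
  have e1 := s12 a b c; have e2 := s23 a b c; have e3 := s23 b a c.
  have e4 := s12 a c b; have e5 := s23 c a b.
  rewrite (_ : S c b a = S a b c); last by rewrite -e5 -e4 -e2.
  rewrite (_ : S c a b = S a b c); last by rewrite -e4 -e2.
  rewrite (_ : S b c a = S a b c); last by rewrite -e3 -e1.
  by rewrite -e2 -e1; ring.
rewrite (eq_sum3 e) sum3Z !sum3D.
rewrite (sum3_12 H) (sum3_23 H).
rewrite (sum3_23 (fun a b c => H b a c)) (sum3_12 H).
rewrite (sum3_12 (fun a b c => H a c b)) (sum3_23 H).
have -> : sum3 (fun a b c => H c b a) = sum3 H.
  by rewrite -(sum3_12 (fun a b c => H c b a)) (sum3_23 (fun a b c => H b a c)) sum3_12.
by field.
Qed.

Lemma sqr_sum_le (I : finType) (u : I -> R) :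
  (\sum_i u i) ^+ 2 <= #|I|%:R * \sum_i u i ^+ 2.
Proof.
have h : 0 <= \sum_i \sum_j (u i - u j) ^+ 2.
  by apply: sumr_ge0 => i _; apply: sumr_ge0 => j _; exact: sqr_ge0.
have e : \sum_i \sum_j (u i - u j) ^+ 2
    = 2 * (#|I|%:R * \sum_i u i ^+ 2) - 2 * (\sum_i u i) ^+ 2.
  rewrite (eq_bigr (fun i => #|I|%:R * u i ^+ 2 + \sum_j u j ^+ 2 - 2 * (u i * \sum_j u j))).
    rewrite sumrB big_split /= -!mulr_sumr sumr_const -mulr_suml -[X in _ + X - _]mulr_natl expr2.
    by ring.
  move=> i _; rewrite (eq_bigr (fun j => u i ^+ 2 + u j ^+ 2 - 2 * (u i * u j))); last first.
    by move=> j _; ring.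
  by rewrite sumrB big_split /= sumr_const -!mulr_sumr [#|I|%:R * _]mulr_natl.
by move: h; rewrite e -mulrBr pmulr_rge0 ?ltr0n// subr_ge0.
Qed.

Let sqr6 (x1 x2 x3 x4 x5 x6 : R) : (6^-1 * (x1 + x2 + x3 + x4 + x5 + x6)) ^+ 2 <=
  6^-1 * (x1 ^+ 2 + x2 ^+ 2 + x3 ^+ 2 + x4 ^+ 2 + x5 ^+ 2 + x6 ^+ 2).
Proof.
have := sqr_sum_le (fun i : 'I_6 => [:: x1; x2; x3; x4; x5; x6]`_i).
rewrite !big_ord_recr !big_ord0 /= card_ord !add0r => h.
rewrite exprMn expr2 -mulrA ler_pM2l ?invr_gt0 ?ltr0n//.
by rewrite mulrC ler_pdivrMr ?ltr0n// mulrC.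
Qed.

Definition flat1 F (x : J -> R) := \sum_b \sum_c (\sum_a F a b c * x a) ^+ 2.
Definition flat2 F (x : J -> R) := \sum_a \sum_c (\sum_b F a b c * x b) ^+ 2.
Definition flat3 F (x : J -> R) := \sum_a \sum_b (\sum_c F a b c * x c) ^+ 2.

(** The symmetrization is the mean of six permuted tensors, and the square is
    convex. *)
Lemma flat_sym3 F x K : flat1 F x <= K -> flat2 F x <= K -> flat3 F x <= K ->
  flat1 (sym3 F) x <= K.
Proof.
move=> h1 h2 h3.
have hle : flat1 (sym3 F) x <= 6^-1 * (flat1 F x + flat1 F x + flat2 F x + flat2 F x
   + flat3 F x + flat3 F x).
  rewrite [X in 6^-1 * (_ + X + _ + _ + _ + _)](_ : _ =
    \sum_b \sum_c (\sum_a F a c b * x a) ^+ 2); last by rewrite /flat1 exchange_big.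
  rewrite [X in 6^-1 * (_ + _ + X + _ + _ + _)](_ : _ =
    \sum_b \sum_c (\sum_a F b a c * x a) ^+ 2)//.
  rewrite [X in 6^-1 * (_ + _ + _ + X + _ + _)](_ : _ =
    \sum_b \sum_c (\sum_a F c a b * x a) ^+ 2); last by rewrite /flat2 exchange_big.
  rewrite [X in 6^-1 * (_ + _ + _ + _ + X + _)](_ : _ =
    \sum_b \sum_c (\sum_a F b c a * x a) ^+ 2)//.
  rewrite [X in 6^-1 * (_ + _ + _ + _ + _ + X)](_ : _ =
    \sum_b \sum_c (\sum_a F c b a * x a) ^+ 2); last by rewrite /flat3 exchange_big.
  rewrite [flat1 F x]/flat1 -!big_split mulr_sumr /=; apply: ler_sum => b _.
  rewrite -!big_split mulr_sumr /=; apply: ler_sum => c _.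
  apply: le_trans (sqr6 _ _ _ _ _ _); rewrite -!big_split /= le_eqVlt; apply/orP; left.
  apply/eqP; congr (_ ^+ 2); rewrite mulr_sumr; apply: eq_bigr => a _.
  by rewrite /sym3; ring.
apply: (le_trans hle); rewrite mulrC ler_pdivrMr ?ltr0n//.
rewrite (_ : K * 6 = K + K + K + K + K + K); last by ring.
by rewrite !lerD.
Qed.

End Symmetrization.

Section SymmetricCombination.
Local Open Scope complex_scope.
Local Open Scope ring_scope.
Context {R : realType} {J : finType} {k : nat}.
Variables (deg : J -> nat) (l1 l2 l3 : 'I_k -> nat).
Variables (F : 'I_k -> J -> J -> J -> R) (rho0 : R) (t : 'I_k -> R).
Hypothesis lS : forall i, (l1 i <= l2 i <= l3 i)%N.
Hypothesis l_inj : injective (fun i => (l1 i, l2 i, l3 i)).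
Hypothesis F_supp : forall i a b c, F i a b c != 0 ->
  [/\ deg a = l1 i, deg b = l2 i & deg c = l3 i].
Hypothesis F_12 : forall i a b c, l1 i = l2 i -> F i b a c = F i a b c.
Hypothesis F_23 : forall i a b c, l2 i = l3 i -> F i a c b = F i a b c.
Hypothesis F_norm : forall i, sum3 (fun a b c => F i a b c ^+ 2) = 1.
Hypothesis F_tr12 : forall i c, \sum_a F i a a c = 0.
Hypothesis F_tr13 : forall i c, \sum_a F i a c a = 0.
Hypothesis F_tr23 : forall i c, \sum_a F i c a a = 0.
Hypothesis F_flat : forall i x, [/\ flat1 (F i) x <= rho0 * \sum_a x a ^+ 2,
  flat2 (F i) x <= rho0 * \sum_a x a ^+ 2 & flat3 (F i) x <= rho0 * \sum_a x a ^+ 2].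

(** The symmetric tensor of a linear combination of the normalized cubic forms. *)
Definition symcomb a b c : R :=
  \sum_i t i / Num.sqrt (Delta (l1 i) (l2 i) (l3 i))%:R * sym3 (F i) a b c.

Lemma symcomb_C12 a b c : symcomb a b c = symcomb b a c.
Proof. by apply: eq_bigr => i _; rewrite sym3_C12. Qed.

Lemma symcomb_C23 a b c : symcomb a b c = symcomb a c b.
Proof. by apply: eq_bigr => i _; rewrite sym3_C23. Qed.

Lemma symcomb_trace c : \sum_a symcomb a a c = 0.
Proof.
rewrite exchange_big /= big1// => i _; rewrite -mulr_sumr -mulr_sumr !big_split /=.
by rewrite F_tr12 F_tr13 F_tr23 !addr0 !mulr0.
Qed.

Let sorted_supp i j a b c a' b' c' : F i a b c != 0 -> F j a' b' c' != 0 ->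
  perm_eq [:: a; b; c] [:: a'; b'; c'] -> i = j.
Proof.
move=> /F_supp[ea eb ec] /F_supp[ea' eb' ec'] /(perm_map deg) /=.
rewrite ea eb ec ea' eb' ec' => p.
have s m : sorted leq [:: l1 m; l2 m; l3 m] by have /andP[h h'] := lS m; rewrite /= h h'.
by have [e1 e2 e3] := sorted_eq leq_trans anti_leq (s i) (s j) p; apply: l_inj; rewrite e1 e2 e3.
Qed.

(** Distinct sorted triples are not permutations of each other, so the
    permuted supports are disjoint. *)
Let pairing_ne i j a b c : i != j -> F i a b c * sym3 (F j) a b c = 0.
Proof.
move=> ij; have [->|n0] := eqVneq (F i a b c) 0; first by rewrite mul0r.
have z a' b' c' : perm_eq [:: a; b; c] [:: a'; b'; c'] -> F j a' b' c' = 0.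
  move=> p; apply/eqP; apply: contraNT ij => nj; apply/eqP.
  exact: sorted_supp n0 nj p.
have pC (x y u : J) : perm_eq [:: x; y; u] [:: y; x; u].
  by rewrite -[[:: x; y; u]]/([:: x] ++ [:: y] ++ [:: u]) perm_catCA.
have pC' (x y u : J) : perm_eq [:: x; y; u] [:: x; u; y].
  by rewrite perm_cons -[[:: y; u]]/([:: y] ++ [:: u]) perm_catC.
rewrite /sym3 (z a b c (perm_refl _)) (z b a c (pC _ _ _)) (z a c b (pC' _ _ _)).
rewrite (z b c a (perm_trans (pC _ _ _) (pC' _ _ _))).
rewrite (z c a b (perm_trans (pC' _ _ _) (pC _ _ _))).
rewrite (z c b a (perm_trans (perm_trans (pC _ _ _) (pC' _ _ _)) (pC _ _ _))).
by rewrite !addr0 !mulr0.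
Qed.

(** Delta counts the permutations that fix the triple of degrees: these fix F i,
    and all others move its support away. *)
Let pairing_eq i a b c :
  F i a b c * sym3 (F i) a b c = (Delta (l1 i) (l2 i) (l3 i))%:R / 6 * F i a b c ^+ 2.
Proof.
have [->|n0] := eqVneq (F i a b c) 0; first by rewrite mul0r [0 ^+ 2]expr2 mul0r mulr0.
have [ea eb ec] := F_supp n0; have /andP[h12 h23] := lS i.
have z a' b' c' : [|| deg a' != l1 i, deg b' != l2 i | deg c' != l3 i] -> F i a' b' c' = 0.
  by move=> h; apply/eqP; apply: contraTT h => /F_supp[-> -> ->]; rewrite !eqxx.
rewrite /sym3 /Delta; case: (ltngtP (l1 i) (l2 i)) h12 => // [lt12|eq12] _.
- have -> : (l1 i == l3 i) = false by lia.
  rewrite (z b a c); last by rewrite ea eb ec; lia.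
  rewrite (z b c a); last by rewrite ea eb ec; lia.
  rewrite (z c a b); last by rewrite ea eb ec; lia.
  rewrite (z c b a); last by rewrite ea eb ec; lia.
  case: (ltngtP (l2 i) (l3 i)) h23 => // [lt23|eq23] _.
    rewrite (z a c b); last by rewrite ea eb ec; lia.
    by rewrite !addn0 /=; field.
  by rewrite F_23 // /= muln0 !addn0; field.
- rewrite (F_12 a b c eq12); case: (ltngtP (l2 i) (l3 i)) h23 => // [lt23|eq23] _.
    rewrite (z a c b); last by rewrite ea eb ec; lia.
    rewrite (z b c a); last by rewrite ea eb ec; lia.
    rewrite (z c a b); last by rewrite ea eb ec; lia.
    rewrite (z c b a); last by rewrite ea eb ec; lia.
    have -> : (l1 i == l3 i) = false by lia.
    by rewrite /= muln0 !addn0; field.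
  rewrite (F_12 b c a eq12) (F_12 a c b eq12) (F_23 b a c eq23) (F_12 a b c eq12).
  by rewrite (F_23 a b c eq23) eq12 eq23 eqxx /=; field.
Qed.

Lemma trgram_symcomb : trgram symcomb = 6^-1 * \sum_i t i ^+ 2.
Proof.
transitivity (sum3 (fun a b c => symcomb a b c * symcomb a b c)); first by [].
have dE i : sum3 (fun a b c => sym3 (F i) a b c * symcomb a b c) =
    t i * Num.sqrt (Delta (l1 i) (l2 i) (l3 i))%:R / 6.
  rewrite (sum3_sym3 _ symcomb_C12 symcomb_C23).
  rewrite (eq_sum3 (G := fun a b c =>
     (t i / Num.sqrt (Delta (l1 i) (l2 i) (l3 i))%:R * ((Delta (l1 i) (l2 i) (l3 i))%:R / 6)) *
     F i a b c ^+ 2)).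
    rewrite sum3Z F_norm mulr1 -{2}[(Delta _ _ _)%:R]sqr_sqrtr ?ler0n//.
    have : Num.sqrt (Delta (l1 i) (l2 i) (l3 i))%:R != 0 :> R.
      by rewrite sqrtr_eq0 -ltNge ltr0n /Delta.
    by move: (Num.sqrt _) => s s0; field.
  move=> a b c; rewrite /symcomb mulr_sumr (bigD1 i) //= big1 ?addr0.
    by rewrite mulrCA pairing_eq; ring.
  by move=> j ji; rewrite mulrCA pairing_ne ?mulr0// eq_sym.
rewrite (eq_sum3 (G := fun a b c => \sum_i t i / Num.sqrt (Delta (l1 i) (l2 i) (l3 i))%:R *
   (sym3 (F i) a b c * symcomb a b c))); last first.
  by move=> a b c; rewrite {1}/symcomb mulr_suml; apply: eq_bigr => i _; rewrite mulrA.
rewrite sum3_sum mulr_sumr; apply: eq_bigr => i _; rewrite sum3Z dE.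
have : Num.sqrt (Delta (l1 i) (l2 i) (l3 i))%:R != 0 :> R.
  by rewrite sqrtr_eq0 -ltNge ltr0n /Delta.
by move: (Num.sqrt _) => s s0; field.
Qed.

Lemma symcomb_flat x : \sum_c \sum_d (\sum_a symcomb a c d * x a) ^+ 2
  <= (k%:R * (\sum_i t i ^+ 2) * rho0) * \sum_a x a ^+ 2.
Proof.
pose s i : R := t i / Num.sqrt (Delta (l1 i) (l2 i) (l3 i))%:R.
have s2 i : s i ^+ 2 <= t i ^+ 2.
  rewrite /s exprMn exprVn sqr_sqrtr ?ler0n//; apply: ler_piMr; first exact: sqr_ge0.
  by rewrite invf_le1 ?ltr0n ?ler1n /Delta.
have flat0 (H : J -> J -> J -> R) : 0 <= flat1 H x.
  by apply: sumr_ge0 => b _; apply: sumr_ge0 => c _; exact: sqr_ge0.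
have le0 i : flat1 (sym3 (F i)) x <= rho0 * \sum_a x a ^+ 2.
  by have [h1 h2 h3] := F_flat i x; exact: flat_sym3.
apply: (@le_trans _ _ (k%:R * \sum_i s i ^+ 2 * flat1 (sym3 (F i)) x)).
  rewrite mulr_sumr /flat1.
  under [leRHS]eq_bigr do rewrite mulrA mulr_sumr.
  rewrite [leRHS]exchange_big; apply: ler_sum => c _ /=.
  under [leRHS]eq_bigr do rewrite mulr_sumr.
  rewrite [leRHS]exchange_big; apply: ler_sum => d _ /=.
  have -> : \sum_a symcomb a c d * x a = \sum_i s i * (\sum_a sym3 (F i) a c d * x a).
    under eq_bigr do rewrite /symcomb mulr_suml.
    rewrite exchange_big; apply: eq_bigr => i _ /=.
    by rewrite mulr_sumr; apply: eq_bigr => a _; rewrite mulrA.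
  apply: (le_trans (sqr_sum_le _)); rewrite card_ord mulr_sumr; apply: ler_sum => i _.
  by rewrite exprMn mulrA.
rewrite -!mulrA; apply: ler_wpM2l; first exact: ler0n.
rewrite mulr_suml; apply: ler_sum => i _; apply: (@le_trans _ _ (t i ^+ 2 * flat1 (sym3 (F i)) x)).
  exact: ler_wpM2r.
by apply: ler_wpM2l => //; exact: sqr_ge0.
Qed.

Lemma cubic_symcomb x : cubic symcomb x =
  \sum_i t i / Num.sqrt (Delta (l1 i) (l2 i) (l3 i))%:R *
    sum3 (fun a b c => F i a b c * (x a * x b * x c)).
Proof.
transitivity (sum3 (fun a b c => symcomb a b c * (x a * x b * x c))).
  apply: eq_bigr => a _; rewrite /cubV mulr_sumr; apply: eq_bigr => b _.
  rewrite /cubM mulr_suml mulr_sumr; apply: eq_bigr => c _; ring.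
rewrite (eq_sum3 (G := fun a b c => \sum_i t i / Num.sqrt (Delta (l1 i) (l2 i) (l3 i))%:R *
   (sym3 (F i) a b c * (x a * x b * x c)))); last first.
  by move=> a b c; rewrite /symcomb mulr_suml; apply: eq_bigr => i _; rewrite -[LHS]mulrA.
rewrite sum3_sum; apply: eq_bigr => i _; rewrite sum3Z sum3_sym3// => a b c; ring.
Qed.

End SymmetricCombination.

(** * The bispectrum tensors *)

Section CoefficientIndex.
Local Open Scope complex_scope.
Local Open Scope ring_scope.
Context {R : realType}.
Variable L : nat.

(** The positions of the real coordinates in the degrees 1, ..., L. *)
Definition cidx : finType := {l : 'I_L & 'I_(2 * l.+1).+1}.

Definition deg (a : cidx) : nat := (tag a).+1.
Definition crd (a : cidx) : nat := tagged a.

Lemma crd_le a : (crd a <= 2 * deg a)%N.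
Proof. by rewrite -ltnS; exact: ltn_ord. Qed.

Lemma sum_deg l (F : nat -> R) : (0 < l <= L)%N ->
  \sum_(a : cidx) (deg a == l)%:R * F (crd a) = \sum_(i < (2 * l).+1) F i.
Proof.
case: l => // l /= hl; pose o := Ordinal hl.
rewrite -(@sig_big_dep _ _ _ _ (fun l : 'I_L => 'I_(2 * l.+1).+1) predT (fun _ => predT)
  (fun (m : 'I_L) (i : 'I_(2 * m.+1).+1) => ((m : nat) == l)%:R * F i)) /=.
rewrite (bigD1 o) //= eqxx [X in _ + X]big1 ?addr0.
  by apply: eq_bigr => i _; rewrite mul1r.
move=> m nm; rewrite big1// => i _.
rewrite (_ : (m == l :> nat) = false) ?mul0r//; apply/negbTE.
by apply: contra nm => /eqP e; apply/eqP/val_inj.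
Qed.

Lemma cidx_inj (a b : cidx) : deg a = deg b -> crd a = crd b -> a = b.
Proof.
case: a b => l i [l' i']; rewrite /deg /crd /= => -[e] e'.
have el : l = l' by apply/val_inj.
by case: _ / el i' e' => i' e'; congr (Tagged _ _); apply/val_inj.
Qed.

(** The tensor w in harmonic coordinates, extended by 0 to all degrees. *)
Definition ctensor l1 l2 l3 w (a b c : cidx) : R :=
  [&& deg a == l1, deg b == l2 & deg c == l3]%:R
  * rtensor l1 l2 l3 w (crd a) (crd b) (crd c).

Lemma natr_and3 (x y z : bool) : [&& x, y & z]%:R = x%:R * (y%:R * z%:R) :> R.
Proof. by rewrite -!natrM !mulnb. Qed.

Lemma ctensor_rot l1 l2 l3 w a b c :
  ctensor l2 l3 l1 (fun y z x => w x y z) b c a = ctensor l1 l2 l3 w a b c.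
Proof.
rewrite /ctensor (rtensor_swap23 l2 l1 l3 (fun y x z => w x y z)) rtensor_swap12.
by congr (_%:R * _); rewrite andbA andbC.
Qed.

Lemma ctensor_swap23 l1 l2 l3 w a b c :
  ctensor l1 l3 l2 (fun x z y => w x y z) a c b = ctensor l1 l2 l3 w a b c.
Proof.
by rewrite /ctensor rtensor_swap23; congr (_%:R * _); rewrite [(deg c == l3) && _]andbC.
Qed.

Lemma ctensor_supp l1 l2 l3 w a b c :
  ctensor l1 l2 l3 w a b c != 0 -> [/\ deg a = l1, deg b = l2 & deg c = l3].
Proof.
rewrite /ctensor; case: and3P => [[/eqP ? /eqP ? /eqP ?]|_]; first by [].
by rewrite mul0r eqxx.
Qed.

Lemma sum3_ctensor (F : R -> nat -> nat -> nat -> R) l1 l2 l3 w :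
  (0 < l1 <= L)%N -> (0 < l2 <= L)%N -> (0 < l3 <= L)%N -> (forall i j k, F 0 i j k = 0) ->
  sum3 (fun a b c => F (ctensor l1 l2 l3 w a b c) (crd a) (crd b) (crd c)) =
  \sum_(i < (2 * l1).+1) \sum_(j < (2 * l2).+1) \sum_(k < (2 * l3).+1)
    F (rtensor l1 l2 l3 w i j k) i j k.
Proof.
move=> l1P l2P l3P F0; set r := rtensor l1 l2 l3 w.
rewrite -(sum_deg (fun i => \sum_(j < (2 * l2).+1) \sum_(k < (2 * l3).+1)
  F (r i j k) i j k) l1P); apply: eq_bigr => a _.
rewrite -(sum_deg (fun j => \sum_(k < (2 * l3).+1) F (r (crd a) j k) (crd a) j k) l2P).
rewrite mulr_sumr; apply: eq_bigr => b _.
rewrite -(sum_deg (fun k => F (r (crd a) (crd b) k) (crd a) (crd b) k) l3P).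
rewrite !mulr_sumr; apply: eq_bigr => c _.
rewrite !mulrA -[X in _ = X * _]mulrA -natr_and3 /ctensor.
by case: [&& _, _ & _]; rewrite ?mul1r// !mul0r F0.
Qed.

Lemma ctensor_flat3 l1 l2 l3 w x : su2_invariant l1 l2 l3 w ->
  (0 < l1 <= L)%N -> (0 < l2 <= L)%N -> (0 < l3 <= L)%N ->
  flat3 (ctensor l1 l2 l3 w) x <= sqnorm l1 l2 l3 w / (2 * l3).+1%:R * \sum_a x a ^+ 2.
Proof.
move=> inv l1P l2P l3P.
(* the part of x of degree l3, as a function of the position *)
pose y n : R := \sum_c ((deg c == l3) && (crd c == n))%:R * x c.
have yE c : deg c = l3 -> y (crd c) = x c.
  move=> ec; rewrite /y (bigD1 c) //= ec !eqxx mul1r big1 ?addr0// => c' nc.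
  rewrite (_ : _ && _ = false) ?mul0r//; apply/negbTE; apply: contra nc.
  by move=> /andP[/eqP e /eqP e']; apply/eqP/cidx_inj; rewrite ?ec.
have cE (F : cidx -> R) c : (deg c == l3)%:R * F c * x c = (deg c == l3)%:R * F c * y (crd c).
  by case: eqP => [/yE ->//|_]; rewrite !mul0r.
have xy : \sum_(k < (2 * l3).+1) y k ^+ 2 <= \sum_a x a ^+ 2.
  rewrite -(sum_deg (fun k => y k ^+ 2) l3P); apply: ler_sum => c _.
  by case: eqP => [/yE ->|_]; rewrite ?mul1r// mul0r sqr_ge0.
apply: (@le_trans _ _ (sqnorm l1 l2 l3 w / (2 * l3).+1%:R * \sum_(k < (2 * l3).+1) y k ^+ 2)).
  apply: le_trans (rtensor_flat3 y inv); set r := rtensor l1 l2 l3 w.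
  rewrite -(sum_deg (fun i => \sum_(j < (2 * l2).+1)
    (\sum_(k < (2 * l3).+1) r i j k * y k) ^+ 2) l1P); apply: ler_sum => a _.
  rewrite -(sum_deg (fun j => (\sum_(k < (2 * l3).+1) r (crd a) j k * y k) ^+ 2) l2P).
  rewrite mulr_sumr; apply: ler_sum => b _.
  rewrite -(sum_deg (fun k => r (crd a) (crd b) k * y k) l3P).
  rewrite (_ : \sum_c ctensor l1 l2 l3 w a b c * x c = (deg a == l1)%:R * (deg b == l2)%:R *
    \sum_c (deg c == l3)%:R * (r (crd a) (crd b) (crd c) * y (crd c))).
    by case: eqP => _; case: eqP => _; rewrite ?mul1r ?mul0r ?[0 ^+ 2]expr2 ?mul0r// ?mulr0.
  rewrite mulr_sumr; apply: eq_bigr => c _.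
  rewrite /ctensor natr_and3 -/r -!mulrA; congr (_ * (_ * _)).
  by rewrite !mulrA (cE (fun c => r (crd a) (crd b) (crd c))).
apply: ler_wpM2l => //; apply: divr_ge0 => //; apply: sumr_ge0 => a _.
by apply: sumr_ge0 => b _; apply: sumr_ge0 => c _; exact: sqr_ge0.
Qed.

Variables l1 l2 l3 : nat.
Hypothesis adm : admissible l1 l2 l3.
Hypothesis lS : (l1 <= l2 <= l3)%N.
Hypothesis lL : (l3 <= L)%N.

Let tr : triangle l1 l2 l3. Proof. by move: adm; rewrite /admissible /triangle; lia. Qed.
Let ev : ~~ odd (l1 + l2 + l3). Proof. by move: adm; rewrite /admissible; lia. Qed.

Let l1P : (0 < l1 <= L)%N. Proof. by move: adm lS lL; rewrite /admissible; lia. Qed.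
Let l2P : (0 < l2 <= L)%N. Proof. by move: adm lS lL; rewrite /admissible; lia. Qed.
Let l3P : (0 < l3 <= L)%N. Proof. by move: adm lS lL; rewrite /admissible; lia. Qed.

Let T := ctensor l1 l2 l3 (wigner3j l1 l2 l3).
Let inv := @wigner3j_invariant R l1 l2 l3 tr ev.
Let inv_rot := invariant23 (invariant12 inv).

Lemma ctensor3j_12 a b c : l1 = l2 -> T b a c = T a b c.
Proof.
move=> e; rewrite /T /ctensor -rtensor_swap12 -e; congr (_%:R * _).
  by rewrite andbCA.
apply: eq_rtensor => x y z; rewrite wigner3j_swap12//; by [move: tr; rewrite -e|move: ev; rewrite -e].
Qed.

Lemma ctensor3j_23 a b c : l2 = l3 -> T a c b = T a b c.
Proof.
move=> e; rewrite /T /ctensor -rtensor_swap23 -e; congr (_%:R * _).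
  by rewrite [(deg c == l2) && _]andbC.
apply: eq_rtensor => x y z; rewrite wigner3j_swap23//; by [move: tr; rewrite -e|move: ev; rewrite -e].
Qed.

Lemma ctensor3j_norm : sum3 (fun a b c => T a b c ^+ 2) = 1.
Proof.
rewrite (@sum3_ctensor (fun x _ _ _ => x ^+ 2))//; last by move=> *; rewrite expr2 mul0r.
rewrite rtensor_total//; first exact: wigner3j_sqnorm.
by move=> a b c; rewrite wigner3jN.
Qed.

Let trace_gen l l' w c : (0 < l <= L)%N -> (0 < l')%N -> su2_invariant l l l' w ->
  \sum_a ctensor l l l' w a a c = 0.
Proof.
move=> lP l'0 iw.
rewrite (eq_bigr (fun a => (deg a == l)%:R * ((deg c == l')%:R * rtensor l l l' w (crd a) (crd a) (crd c)))).
  rewrite (sum_deg (fun i => (deg c == l')%:R * rtensor l l l' w i i (crd c)) lP).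
  by rewrite -mulr_sumr rtensor_trace12// mulr0.
by move=> a _; rewrite /ctensor andbA andbb -mulnb natrM mulrA.
Qed.

(** When l1 and l2 differ the diagonal misses the support. *)
Lemma ctensor3j_tr12 c : \sum_a T a a c = 0.
Proof.
have [e|ne] := eqVneq l1 l2.
  by rewrite /T; case: _ / e inv l2P => *; apply: trace_gen => //; case/andP: l3P.
rewrite big1// => a _; apply/eqP; apply: contraNT ne => /ctensor_supp[-> <- _].
by rewrite eqxx.
Qed.

Lemma ctensor3j_tr23 c : \sum_a T c a a = 0.
Proof.
have [e|ne] := eqVneq l2 l3.
  under eq_bigr do rewrite /T -ctensor_rot.
  move: inv_rot l2P; case: _ / e => *; apply: trace_gen => //; by case/andP: l1P.
rewrite big1// => a _; apply/eqP; apply: contraNT ne => /ctensor_supp[_ <- <-].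
by rewrite eqxx.
Qed.

Lemma ctensor3j_tr13 c : \sum_a T a c a = 0.
Proof.
have [e|ne] := eqVneq l1 l3.
  have e23 : l2 = l3 by move: lS; lia.
  by rewrite -[RHS](ctensor3j_tr12 c); apply: eq_bigr => a _; rewrite ctensor3j_23.
rewrite big1// => a _; apply/eqP; apply: contraNT ne => /ctensor_supp[<- _ <-].
by rewrite eqxx.
Qed.

Let norm1 : sqnorm l1 l2 l3 (wigner3j l1 l2 l3) = 1 :> R.
Proof. exact: wigner3j_sqnorm. Qed.

(** All three bounds are relaxed to the one of the smallest degree. *)
Lemma ctensor3j_flat x : [/\ flat1 T x <= (2 * l1).+1%:R^-1 * \sum_a x a ^+ 2,
  flat2 T x <= (2 * l1).+1%:R^-1 * \sum_a x a ^+ 2 &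
  flat3 T x <= (2 * l1).+1%:R^-1 * \sum_a x a ^+ 2].
Proof.
have le l : (l1 <= l)%N -> forall N, N = 1 -> N / (2 * l).+1%:R * \sum_a x a ^+ 2
    <= (2 * l1).+1%:R^-1 * \sum_a x a ^+ 2.
  move=> hl N ->; rewrite mul1r; apply: ler_wpM2r.
    by apply: sumr_ge0 => a _; exact: sqr_ge0.
  by rewrite lef_pV2 ?posrE ?ltr0n// ler_nat; lia.
split.
- rewrite (_ : flat1 T x = flat3 (ctensor l2 l3 l1 (fun y z x => wigner3j l1 l2 l3 x y z)) x).
    apply: le_trans (ctensor_flat3 x inv_rot l2P l3P l1P) (le _ _ _ _) => //.
    by rewrite -[RHS]norm1 -[RHS]sqnorm_swap12 -[RHS]sqnorm_swap23.
  apply: eq_bigr => b _; apply: eq_bigr => c _; congr (_ ^+ 2); apply: eq_bigr => a _.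
  by rewrite ctensor_rot.
- rewrite (_ : flat2 T x = flat3 (ctensor l1 l3 l2 (fun x z y => wigner3j l1 l2 l3 x y z)) x).
    apply: le_trans (ctensor_flat3 x (invariant23 inv) l1P l3P l2P) (le _ _ _ _) => //.
      by move: lS; lia.
    by rewrite -[RHS]norm1 -[RHS]sqnorm_swap23.
  apply: eq_bigr => b _; apply: eq_bigr => c _; congr (_ ^+ 2); apply: eq_bigr => a _.
  by rewrite ctensor_swap23.
- apply: le_trans (ctensor_flat3 x inv l1P l2P l3P) (le _ _ _ norm1).
  by move: lS; lia.
Qed.

End CoefficientIndex.

(** * The Gaussian family of harmonic coordinates *)

Section CenteredIndex.
Local Open Scope complex_scope.
Local Open Scope ring_scope.

Lemma big_centered (S : Type) (idx : S) (op : Monoid.com_law idx) (n : nat) (F : nat -> S) :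
  \big[op/idx]_(i < (2 * n).+1) F i =
  op (F n) (\big[op/idx]_(1 <= m < n.+1) op (F (n + m)%N) (F (n - m)%N)).
Proof.
rewrite -(big_mkord predT) (@big_cat_nat _ _ _ n) //=; last by lia.
rewrite [X in op _ X]big_ltn; last by lia.
rewrite Monoid.mulmCA; congr (op _ _); rewrite Monoid.mulmC big_split; congr (op _ _).
  rewrite (_ : n.+1 = 1 + n)%N// (_ : (2 * n).+1 = n.+1 + n)%N; last by lia.
  rewrite -{1}[n.+1]add1n (_ : (n.+1 + n = n.+1 + n)%N)// big_addn.
  rewrite (_ : (n.+1 + n - n = n.+1)%N); last by lia.
  by apply: eq_bigr => i _; rewrite addnC.
rewrite big_nat_rev (big_addn 0 n.+1 1) /=; rewrite subn1 /=.
by apply: eq_bigr => i _; congr F; lia.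
Qed.

End CenteredIndex.

Section CoefficientFamily.
Local Open Scope complex_scope.
Local Open Scope ring_scope.
Context d (Omega : measurableType d) (R : realType) (P : probability Omega R).
Variables (C : nat -> R) (a : nat -> int -> Omega -> R[i]).
Hypothesis ha : gaussian_coefs P C a.
Hypothesis hC : forall l, (0 < l)%N -> 0 < C l.

(** The real coordinates of degree l, scaled to variance 1. *)
Definition gcoef (l i : nat) (w : Omega) : R :=
  if i == l then (Num.sqrt (C l))^-1 * complex.Re (a l 0 w)
  else if (l < i)%N then (Num.sqrt (C l / 2))^-1 * complex.Re (a l (i - l)%N%:Z w)
  else (Num.sqrt (C l / 2))^-1 * complex.Im (a l (l - i)%N%:Z w).

Lemma sqrtC_gt0 l : (0 < l)%N -> 0 < Num.sqrt (C l).
Proof. by move=> l0; rewrite sqrtr_gt0 hC. Qed.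

Lemma sqrtC2_gt0 l : (0 < l)%N -> 0 < Num.sqrt (C l / 2).
Proof. by move=> l0; rewrite sqrtr_gt0 divr_gt0 ?hC. Qed.

Lemma sum_hbasis l m (x : nat -> R[i]) : `|m| <= l%:Z ->
  \sum_(i < (2 * l).+1) hbasis l m i * x i =
  hbasisA m * x (l + `|m|)%N + hbasisB m * x (l - `|m|)%N.
Proof.
move=> hm; have s1 (p : nat) (z : R[i]) : (p < (2 * l).+1)%N ->
    \sum_(i < (2 * l).+1) z * (i == p :> nat)%:R * x i = z * x p.
  move=> hp; rewrite (bigD1 (Ordinal hp)) //= eqxx mulr1 big1 ?addr0// => i ni.
  rewrite (_ : (i == p :> nat) = false) ?mulr0 ?mul0r//; apply/negbTE.
  by apply: contra ni => /eqP e; apply/eqP/val_inj.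
rewrite -(s1 (l + `|m|)%N) -?(s1 (l - `|m|)%N) -?big_split /=; [|lia..].
by apply: eq_bigr => i _; rewrite /hbasis mulrDl.
Qed.

Lemma coef_hbasis l m w : (0 < l)%N -> `|m| <= l%:Z ->
  a l m w = (Num.sqrt (C l))%:C * \sum_(i < (2 * l).+1) hbasis l m i * (gcoef l i w)%:C.
Proof.
move=> l0 hm; rewrite (sum_hbasis (fun i => (gcoef l i w)%:C) hm).
have c0 : Num.sqrt (C l) != 0 by rewrite gt_eqF// sqrtC_gt0.
have s0 : Num.sqrt 2 != 0 :> R by rewrite gt_eqF// sqrtr_gt0.
have c2 : Num.sqrt (C l / 2) = Num.sqrt (C l) / Num.sqrt 2.
  by rewrite sqrtrM ?(ltW (hC l0))// sqrtrV.
have pos (n : nat) : (0 < n)%N -> (n <= l)%N -> a l n%:Z w =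
    (Num.sqrt (C l))%:C * ((Num.sqrt 2)^-1%:C * (gcoef l (l + n) w)%:C +
      'i%C * (Num.sqrt 2)^-1%:C * (gcoef l (l - n) w)%:C).
  move=> n0 nl; rewrite /gcoef.
  have -> : (l + n == l)%N = false by lia.
  have -> : (l - n == l)%N = false by lia.
  have -> : (l < l + n)%N by lia.
  have -> : (l < l - n)%N = false by lia.
  rewrite (_ : (l + n - l = n)%N); last by lia.
  rewrite (_ : (l - (l - n) = n)%N); last by lia.
  rewrite c2; case: (a l n w) => x y; apply/eqP; rewrite eq_complex /=.
  by apply/andP; split; apply/eqP; field; rewrite c0 s0.
have [m0|m0|m0] := ltgtP m 0.
- have mN : m = - (`|m|%N)%:Z by lia.
  rewrite [in LHS]mN (gc_conj ha)//.
  rewrite pos; [|lia..]; rewrite /hbasisA /hbasisB (lt_eqF m0) (lt_gtF m0).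
  move: (gcoef _ _ _) (gcoef _ _ _) ((Num.sqrt 2)^-1) (Num.sqrt (C l)) => y x s c.
  have -> : (c%:C * (s%:C * x%:C + 'i%C * s%:C * y%:C))^*%C =
      c%:C * (s%:C * x%:C - 'i%C * s%:C * y%:C).
    by apply/eqP; rewrite eq_complex /=; apply/andP; split; apply/eqP; ring.
  by ring.
- have mE : m = (`|m|%N)%:Z by lia.
  rewrite [in LHS]mE pos; [|lia..]; rewrite /hbasisA /hbasisB (gt_eqF m0) m0.
  by [].
- rewrite m0 /hbasisA /hbasisB eqxx mul1r mul0r addr0 /gcoef addn0 eqxx.
  have := gc_conj ha w l0 (leq0n l); rewrite oppr0 expr0 mul1r.
  case: (a l 0 w) => x y [/esym/eqP]; rewrite eqNr => /eqP -> .
  by apply/eqP; rewrite eq_complex /=; apply/andP; split; apply/eqP; field.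
Qed.

Lemma gcoef_measurable l i : (0 < l)%N -> (i <= 2 * l)%N -> measurable_fun setT (gcoef l i).
Proof.
move=> l0 il; rewrite /gcoef; case: eqP => [_|ne].
  by apply: measurable_funM => //; case: (gc_zero ha l0).
by case: (ltnP l i) => h; apply: measurable_funM => //;
  [case: (@gc_Re _ _ _ _ _ _ ha l (i - l)%N)|case: (@gc_Im _ _ _ _ _ _ ha l (l - i)%N)] => //; lia.
Qed.

Lemma gcoef_law l i : (0 < l)%N -> (i <= 2 * l)%N ->
  exists2 sigma : R, 0 < sigma & forall A : set R, measurable A ->
    P ((fun w => sigma * gcoef l i w) @^-1` A) = normal_prob 0 sigma A.
Proof.
move=> l0 il; rewrite /gcoef; case: eqP => [_|ne].
  exists (Num.sqrt (C l)); first exact: sqrtC_gt0.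
  move=> A mA; have [_ /(_ A mA)] := gc_zero ha l0.
  rewrite /centered_normal gt_eqF ?hC// => <-; congr (P _).
  by apply/funext => w; rewrite /preimage /= mulrA divff ?mul1r// gt_eqF// sqrtC_gt0.
have v0 : (C l / 2 == 0) = false by rewrite gt_eqF// divr_gt0 ?hC.
exists (Num.sqrt (C l / 2)); first exact: sqrtC2_gt0.
move=> A mA; case: (ltnP l i) => h.
  have [||_ /(_ A mA)] := @gc_Re _ _ _ _ _ _ ha l (i - l)%N; [lia|lia|].
  rewrite /centered_normal v0 => <-; congr (P _).
  by apply/funext => w; rewrite /preimage /= mulrA divff ?mul1r// gt_eqF// sqrtC2_gt0.
have [||_ /(_ A mA)] := @gc_Im _ _ _ _ _ _ ha l (l - i)%N; [lia|lia|].
rewrite /centered_normal v0 => <-; congr (P _).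
by apply/funext => w; rewrite /preimage /= mulrA divff ?mul1r// gt_eqF// sqrtC2_gt0.
Qed.

Variable L : nat.

Definition cfam (b : cidx L) : Omega -> R := gcoef (deg b) (crd b).

(** The pairs (Re a_lm, Im a_lm) with m >= 0 are mutually independent, and the
    two components of a pair are the coordinates at l + m and l - m; only for m = 0
    does a pair yield a single coordinate. *)
Lemma cfam_family : gauss_family P cfam.
Proof.
split=> [b|b|A mA]; first exact/gcoef_measurable/crd_le.
  exact/gcoef_law/crd_le.
(* A in terms of degree and position, without constraint elsewhere *)
pose B l i : set R := [set x | forall b, deg b = l -> crd b = i -> A b x].
have BE b : B (deg b) (crd b) = A b.
  apply/seteqP; split=> x /=; first by apply.
  by move=> Ax b' e e'; rewrite (cidx_inj e e').
have mB l i : measurable (B l i).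
  have [[b [<- <-]]|no] := pselect (exists b : cidx L, deg b = l /\ crd b = i).
    by rewrite BE.
  rewrite (_ : B l i = setT)//; apply/seteqP; split=> // x _ b e e'.
  by exfalso; apply: no; exists b.
pose F l i : \bar R := P (gcoef l i @^-1` B l i).
pose c1 (lm : nat * nat) := if lm.2 == 0%N then (Num.sqrt (C lm.1))^-1 else (Num.sqrt (C lm.1 / 2))^-1.
pose A1 (lm : nat * nat) : set R := ( *%R (c1 lm)) @^-1` B lm.1 (lm.1 + lm.2)%N.
pose A2 (lm : nat * nat) : set R :=
  if lm.2 == 0%N then setT else ( *%R (c1 lm)) @^-1` B lm.1 (lm.1 - lm.2)%N.
have mscale (c : R) (S : set R) : measurable S -> measurable ( *%R c @^-1` S).
  move=> mS; rewrite -[X in measurable X]setTI.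
  by apply: (@measurable_funM _ _ _ _ (cst c) id).
have mA1 lm : measurable (A1 lm) by exact: mscale.
have mA2 lm : measurable (A2 lm) by rewrite /A2; case: ifP => // _; exact: mscale.
pose s : seq (nat * nat) := [seq (l, m) | l <- iota 1 L, m <- iota 0 l.+1].
have sP l m : ((l, m) \in s) = (0 < l <= L)%N && (m <= l)%N.
  apply/allpairsPdep/idP => [[l' [m' []]]|/andP[h h']].
    by rewrite !mem_iota => h h' [-> ->]; apply/andP; lia.
  by exists l, m; rewrite !mem_iota; split=> //; lia.
have us : uniq s.
  apply: allpairs_uniq_dep; first exact: iota_uniq.
    by move=> l _; exact: iota_uniq.
  by move=> [l m] [l' m'] _ _ [-> ->].
have sD : {subset s <= [pred lm : nat * nat | (0 < lm.1)%N & (lm.2 <= lm.1)%N]}.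
  by move=> [l m]; rewrite sP inE /= => /andP[/andP[-> _] ->].
have key := gc_independent ha us sD (fun lm => measurableX (mA1 lm) (mA2 lm)).
have g1 l m w : c1 (l, m) * complex.Re (a l m%:Z w) = gcoef l (l + m) w.
  rewrite /c1 /gcoef /=; have [->|m0] := posnP m; first by rewrite addn0 eqxx.
  have -> : (l + m == l)%N = false by lia.
  have -> : (l < l + m)%N by lia.
  by rewrite (_ : (l + m - l = m)%N)//; lia.
have g2 l m w : (0 < m <= l)%N -> c1 (l, m) * complex.Im (a l m%:Z w) = gcoef l (l - m) w.
  move=> h; rewrite /c1 /gcoef /=.
  have -> : (l - m == l)%N = false by lia.
  have -> : (l < l - m)%N = false by lia.
  have -> : (m == 0)%N = false by lia.
  by rewrite (_ : (l - (l - m) = m)%N)//; lia.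
have -> : [set w | forall b, A b (cfam b w)] = [set w | forall lm, lm \in s ->
    (A1 lm `*` A2 lm) (complex.Re (a lm.1 lm.2%:Z w), complex.Im (a lm.1 lm.2%:Z w))].
  apply/seteqP; split=> w /= hw.
    move=> [l m]; rewrite sP => /andP[hl hm]; split=> /=.
      by rewrite /A1 /preimage /= g1 => b e e'; have := hw b; rewrite /cfam e e'.
    rewrite /A2 /=; case: eqP => // m0; rewrite /preimage /= g2; last by lia.
    by move=> b e e'; have := hw b; rewrite /cfam e e'.
  move=> b; rewrite -BE /cfam.
  have dL : (0 < deg b <= L)%N by rewrite /deg /= ltn_ord.
  have [h|h] := leqP (deg b) (crd b).
    have := hw (deg b, crd b - deg b)%N; rewrite sP dL /= => /(_ _)[].
      by have := crd_le b; lia.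
    by rewrite /A1 /preimage /= g1 subnKC.
  have := hw (deg b, deg b - crd b)%N; rewrite sP dL /= => /(_ _)[]; first by lia.
  rewrite /A2 /= => _; rewrite (_ : (deg b - crd b == 0)%N = false); last by lia.
  by rewrite /preimage /= g2 ?(subKn (ltnW h))//; lia.
rewrite key /s big_allpairs_dep /=.
transitivity (\prod_(l <- iota 1 L) \prod_(i < (2 * l).+1) F l i)%E.
  rewrite [LHS]big_seq [RHS]big_seq; apply: eq_bigr => l; rewrite mem_iota => hl.
  rewrite big_centered big_cons /=; congr (_ * _)%E.
    rewrite /F; congr (P _); apply/seteqP; split=> w /=.
      by rewrite /A1 /A2 /preimage /= => -[/=]; rewrite g1 addn0.
    by move=> hw; split=> //; rewrite /A1 /preimage /= g1 addn0.
  rewrite /index_iota subSS subn0 [LHS]big_seq [RHS]big_seq; apply: eq_bigr => m.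
  rewrite mem_iota => hm.
  have := gc_Re_Im ha (m := m) (l := l) _ _ (mA1 (l, m)) (mA2 (l, m)).
  move=> /(_ _ _)->; [|lia|lia].
  have m0 : (m == 0)%N = false by lia.
  congr (P _ * P _)%E; apply/seteqP; split=> w; rewrite /A1 /A2 /preimage /= ?g1// m0 /=.
    by rewrite g2//; lia.
  by rewrite g2//; lia.
rewrite (_ : iota 1 L = index_iota (0 + 1) (L + 1)); last by rewrite /index_iota addnK.
rewrite big_addn addnK big_mkord.
transitivity (\prod_(l < L) \prod_(i < (2 * l.+1).+1) F l.+1 i)%E.
  by apply: eq_bigr => i _; rewrite addn1.
rewrite (@sig_big_dep _ _ _ _ (fun l : 'I_L => 'I_(2 * l.+1).+1) predT (fun _ => predT)
  (fun (m : 'I_L) (i : 'I_(2 * m.+1).+1) => F m.+1 i)) /=.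
by under eq_bigl do rewrite /=; apply: eq_bigr => b _; rewrite /F -[A b]BE.
Qed.

End CoefficientFamily.

(** * The standard normal law *)

Section StandardNormalFamily.
Context {R : realType}.

Lemma std_normal_cons (k : nat) (A : set R) (B : set (k.-tuple R)) :
  measurable A -> measurable B ->
  std_normal k.+1 [set t | A (tnth t ord0) /\ B [tuple of behead t]] =
  (normal_prob 0 1 A * std_normal k B)%E.
Proof.
move=> mA mB; rewrite /= /distribution /pushforward /=.
rewrite -product_measure1E//; congr (_ _); apply/seteqP; split => -[x t] /=.
  by rewrite /tuple_cons /= => -[h1 h2]; split => //=; move: h2; congr (B _); apply/val_inj.
by move=> [h1 h2]; split => //; move: h2 => /=; congr (B _); apply/val_inj.
Qed.

Let tnthS k (t : k.+1.-tuple R) j : tnth t (lift ord0 j) = tnth [tuple of behead t] j.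
Proof. by rewrite !(tnth_nth 0) /= nth_behead. Qed.

Lemma std_normal_marginal k (j : 'I_k) (A : set R) : measurable A ->
  std_normal k [set t | A (tnth t j)] = normal_prob 0 1 A.
Proof.
move=> mA; elim: k j => [[]//|k IH] j; have [j'|] := unliftP ord0 j => ->.
  rewrite -(IH j') -[RHS]mul1e -(@probability_setT _ _ _ (normal_prob 0 1)) -std_normal_cons//.
    by congr (_ _); apply/seteqP; split=> t /=; rewrite tnthS // => -[].
  by rewrite -[X in measurable X]setTI; exact: measurable_tnth.
rewrite -[RHS]mule1 -(@probability_setT _ _ _ (std_normal k)) -std_normal_cons//.
by congr (_ _); apply/seteqP; split=> t //= -[].
Qed.

Lemma std_normal_family (k : nat) :
  gauss_family (std_normal k) (fun (i : 'I_k) (t : k.-tuple R) => tnth t i).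
Proof.
split.
- by move=> j; exact: measurable_tnth.
- move=> j; exists 1 => // A mA; rewrite -(std_normal_marginal j mA); congr (_ _).
  by apply/seteqP; split=> t; rewrite /preimage /= mul1r.
- elim: k => [|k IH] A mA.
    rewrite big_ord0 (_ : [set _ | _] = setT) ?probability_setT//.
    by apply/seteqP; split=> // t _ [].
  rewrite big_ord_recl [X in (X * _)%E]std_normal_marginal//.
  rewrite (eq_bigr (fun j => std_normal k [set t | A (lift ord0 j) (tnth t j)])); last first.
    by move=> j _; rewrite [LHS]std_normal_marginal// std_normal_marginal.
  rewrite -(IH (fun j => A (lift ord0 j)))// -std_normal_cons//; last first.
    rewrite (_ : [set _ | _] = \bigcap_(j : 'I_k) [set t | A (lift ord0 j) (tnth t j)]).
      apply: fin_bigcap_measurable => // j _.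
      by rewrite -[X in measurable X]setTI; apply: measurable_tnth.
    by apply/seteqP; split=> t /= h; [move=> j _; exact: h|move=> j; exact: h].
  congr (_ _); apply/seteqP; split=> t /=.
    by move=> h; split=> // j; rewrite -tnthS.
  by move=> [h h'] j; have [j'|] := unliftP ord0 j => -> //; rewrite tnthS.
Qed.

End StandardNormalFamily.

(** * Normalized and estimated bispectra *)

Section BispectrumTensor.
Local Open Scope complex_scope.
Local Open Scope ring_scope.
Context d (Omega : measurableType d) (R : realType) (P : probability Omega R).
Variables (C : nat -> R) (a : nat -> int -> Omega -> R[i]).
Hypothesis ha : gaussian_coefs P C a.
Hypothesis hC : forall l, (0 < l)%N -> 0 < C l.

Let g := gcoef C a.

Lemma Re_sample_bispectrum l1 l2 l3 w : (0 < l1)%N -> (0 < l2)%N -> (0 < l3)%N ->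
  complex.Re (sample_bispectrum a l1 l2 l3 w) = Num.sqrt (C l1 * C l2 * C l3) *
    \sum_(i < (2 * l1).+1) \sum_(j < (2 * l2).+1) \sum_(k < (2 * l3).+1)
      rtensor l1 l2 l3 (wigner3j l1 l2 l3) i j k * (g l1 i w * g l2 j w * g l3 k w).
Proof.
move=> p1 p2 p3; pose b l m := \sum_(i < (2 * l).+1) hbasis l m i * (g l i w)%:C.
rewrite -(@zsum3_rtensor _ l1 l2 l3 (wigner3j l1 l2 l3) (fun i => g l1 i w)
  (fun i => g l2 i w) (fun i => g l3 i w) (b l1) (b l2) (b l3)) //.
have e : sample_bispectrum a l1 l2 l3 w = (Num.sqrt (C l1 * C l2 * C l3))%:C *
   zsum l1 (fun m1 => zsum l2 (fun m2 => zsum l3 (fun m3 =>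
    (wigner3j l1 l2 l3 m1 m2 m3)%:C * b l1 m1 * b l2 m2 * b l3 m3))).
  rewrite !sqrtrM ?mulr_ge0 ?(ltW (hC _))// mulr_zsumCr; apply: eq_bigr => m1 _.
  rewrite mulr_zsumCr; apply: eq_bigr => m2 _.
  rewrite mulr_zsumCr; apply: eq_bigr => m3 _.
  rewrite !(coef_hbasis ha hC w)// ?mval_range// -/g -/(b l1 _) -/(b l2 _) -/(b l3 _).
  by rewrite !(rmorphM (real_complex R)) /=; ring.
by rewrite e; case: (zsum _ _) => x y /=; rewrite mul0r subr0.
Qed.

Lemma Re_normalized_bispectrum (D : nat -> R) l1 l2 l3 w :
  complex.Re (normalized_bispectrum a D l1 l2 l3 w) =
  (-1) ^+ (l1 + l2 + l3)./2 * complex.Re (sample_bispectrum a l1 l2 l3 w)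
    / Num.sqrt (D l1 * D l2 * D l3).
Proof.
rewrite /normalized_bispectrum -fmorphV /=.
have -> : (-1) ^+ (l1 + l2 + l3)./2 = ((-1) ^+ (l1 + l2 + l3)./2)%:C :> R[i].
  by rewrite [RHS](rmorphXn (real_complex R)) (rmorphN1 (real_complex R)).
move: ((-1) ^+ _) (Num.sqrt _)^-1 => x y.
by case: (sample_bispectrum _ _ _ _ _) => u v /=; rewrite !mulr0 !mul0r !subr0.
Qed.

(** The ratio of the estimated to the true power spectrum. *)
Definition cratio l w : R := (2 * l).+1%:R^-1 * \sum_(i < (2 * l).+1) g l i w ^+ 2.

Lemma sample_spectrumE l w : (0 < l)%N -> sample_spectrum a l w = C l * cratio l w.
Proof.
move=> l0; rewrite /sample_spectrum /cratio addn1 mulrCA; congr (_ * _).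
rewrite -(hbasis_complete l (fun i => g l i w)) /zsum mulr_sumr; apply: eq_bigr => m _.
rewrite (coef_hbasis ha hC w l0 (mval_range m)) -/g.
rewrite -[C l in RHS]sqr_sqrtr ?(ltW (hC l0))// -[in RHS]sqmod_real -sqmodM.
by case: (_ * _) => x y; rewrite /sqmod /= sqr_sqrtr// addr_ge0 ?sqr_ge0.
Qed.

Lemma estimated_bispectrumE l1 l2 l3 w : (0 < l1)%N -> (0 < l2)%N -> (0 < l3)%N ->
  complex.Re (estimated_bispectrum a l1 l2 l3 w) =
  complex.Re (normalized_bispectrum a C l1 l2 l3 w)
    / Num.sqrt (cratio l1 w * cratio l2 w * cratio l3 w).
Proof.
move=> p1 p2 p3; rewrite /estimated_bispectrum !Re_normalized_bispectrum.
rewrite !sample_spectrumE//.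
have -> : C l1 * cratio l1 w * (C l2 * cratio l2 w) * (C l3 * cratio l3 w) =
  (C l1 * C l2 * C l3) * (cratio l1 w * cratio l2 w * cratio l3 w) by ring.
by rewrite sqrtrM ?mulr_ge0 ?(ltW (hC _))// invfM mulrA.
Qed.

Lemma normalized_bispectrum_tensor l1 l2 l3 L w : admissible l1 l2 l3 ->
  (l1 <= l2 <= l3)%N -> (l3 <= L)%N ->
  complex.Re (normalized_bispectrum a C l1 l2 l3 w) = (-1) ^+ (l1 + l2 + l3)./2 *
  sum3 (fun x y z : cidx L => ctensor l1 l2 l3 (wigner3j l1 l2 l3) x y z *
    (cfam C a x w * cfam C a y w * cfam C a z w)).
Proof.
move=> adm lS lL.
have [p1 [p2 p3]] : (0 < l1 <= L)%N /\ (0 < l2 <= L)%N /\ (0 < l3 <= L)%N.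
  by move: adm; rewrite /admissible; lia.
rewrite Re_normalized_bispectrum Re_sample_bispectrum; [|lia..].
have c0 : Num.sqrt (C l1 * C l2 * C l3) != 0.
  by rewrite sqrtr_eq0 -ltNge !mulr_gt0 ?hC//; lia.
rewrite [_ * (Num.sqrt _ * _)]mulrCA mulrAC divff// mul1r; congr (_ * _).
rewrite -(@sum3_ctensor _ L (fun t i j k => t * (g l1 i w * g l2 j w * g l3 k w)))//; last first.
  by move=> *; rewrite mul0r.
apply: eq_sum3 => x y z; have [->|ne] := eqVneq (ctensor l1 l2 l3 (wigner3j l1 l2 l3) x y z) (0 : R).
  by rewrite !mul0r.
by have [e1 e2 e3] := ctensor_supp ne; rewrite /cfam e1 e2 e3.
Qed.

End BispectrumTensor.

(** With x = p q r >= 1/8, use 1 - 1 / sqrt x = (x - 1) / (x + sqrt x). *)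
Lemma inv_sqrt_dev (R : realType) (p q r e : R) : e <= 2^-1 ->
  `|p - 1| <= e -> `|q - 1| <= e -> `|r - 1| <= e ->
  `|1 - (Num.sqrt (p * q * r))^-1| <= 40 * e.
Proof.
move=> e2 hp hq hr; have := hp; rewrite ler_norml => /andP[p1 p2].
have := hq; rewrite ler_norml => /andP[q1 q2]; have := hr; rewrite ler_norml => /andP[r1 r2].
have e0 : 0 <= e by lra.
have [pl ph] : 1 - e <= p /\ p <= 1 + e by split; lra.
have [ql qh] : 1 - e <= q /\ q <= 1 + e by split; lra.
have [rl rh] : 1 - e <= r /\ r <= 1 + e by split; lra.
have lo0 : 0 <= 1 - e by lra.
have hlo : (1 - e) * (1 - e) * (1 - e) <= p * q * r.
  by apply: ler_pM => //; [rewrite mulr_ge0|apply: ler_pM].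
have hhi : p * q * r <= (1 + e) * (1 + e) * (1 + e).
  by apply: ler_pM => //; [rewrite mulr_ge0//; lra|lra|apply: ler_pM => //; lra].
set x := p * q * r in hlo hhi *.
have x8 : 8^-1 <= x by nra.
have x0 : 0 < x by lra.
have xd : `|x - 1| <= 5 * e by rewrite ler_norml; apply/andP; split; nra.
set s := Num.sqrt x; have s0 : 0 < s by rewrite sqrtr_gt0.
have sx : s * s = x by rewrite -expr2 sqr_sqrtr// ltW.
have -> : 1 - s^-1 = (x - 1) / (x + s).
  by rewrite -sx; field; rewrite !lt0r_neq0//; nra.
rewrite normrM normfV (@ger0_norm _ (x + s)); last by lra.
rewrite ler_pdivrMr; last by lra.
by apply: (le_trans xd); nra.
Qed.

Section BispectrumLimit.
Local Open Scope complex_scope.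
Local Open Scope ring_scope.
Context d (Omega : measurableType d) (R : realType) (P : probability Omega R).
Variables (C : nat -> R) (a : nat -> int -> Omega -> R[i]).
Hypothesis ha : gaussian_coefs P C a.
Hypothesis hC : forall l, (0 < l)%N -> 0 < C l.
Variables (k : nat) (l1 l2 l3 : 'I_k -> nat) (l0 : nat).
Hypothesis hadm : forall i, admissible (l1 i) (l2 i) (l3 i).
Hypothesis hord : forall i, (l1 i <= l2 i <= l3 i)%N.
Hypothesis hdist : injective (fun i : 'I_k => (l1 i, l2 i, l3 i)).
Hypothesis hl0 : forall i, (l0 <= l1 i)%N.

Definition bispectrum_vec w : 'rV[R]_k := \row_i
  (complex.Re (normalized_bispectrum a C (l1 i) (l2 i) (l3 i) w)
   / Num.sqrt (Delta (l1 i) (l2 i) (l3 i))%:R).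

Let L := \max_i l3 i.
Let hL i : (l3 i <= L)%N. Proof. exact: leq_bigmax. Qed.

Let gf := cfam_family ha hC L.
Let gE := gauss_family_expectation gf.

Let F i : cidx L -> cidx L -> cidx L -> R :=
  ctensor (l1 i) (l2 i) (l3 i) (wigner3j (l1 i) (l2 i) (l3 i)).
(* a sign that is moved from the form to the coefficients of the combination *)
Let sg i : R := (-1) ^+ (l1 i + l2 i + l3 i)./2.
Let T (t : 'I_k -> R) := symcomb l1 l2 l3 F (fun i => sg i * t i).

Let sg2 i x : (sg i * x) ^+ 2 = x ^+ 2.
Proof. by rewrite exprMn /sg -exprM mulnC exprM sqrrN expr1n expr1n mul1r. Qed.

Let T12 t := symcomb_C12 l1 l2 l3 F (fun i => sg i * t i).
Let T23 t := symcomb_C23 l1 l2 l3 F (fun i => sg i * t i).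

Let Ttr t c : \sum_x T t x x c = 0.
Proof.
apply: symcomb_trace => i c'; [exact: ctensor3j_tr12|exact: ctensor3j_tr13|exact: ctensor3j_tr23].
Qed.

Let Tgram t : trgram (T t) = 6^-1 * \sum_i t i ^+ 2.
Proof.
rewrite /T (@trgram_symcomb _ _ _ (@deg L)).
- by congr (_ * _); apply: eq_bigr => i _; rewrite sg2.
- exact: hord.
- exact: hdist.
- by move=> i x y z; exact: ctensor_supp.
- by move=> i x y z; exact: ctensor3j_12.
- by move=> i x y z; exact: ctensor3j_23.
- by move=> i; exact: ctensor3j_norm.
Qed.

Let Tflat t x : \sum_c \sum_d (\sum_b T t b c d * x b) ^+ 2 <=
  (k%:R * (\sum_i t i ^+ 2) * (2 * l0).+1%:R^-1) * \sum_b x b ^+ 2.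
Proof.
have -> : \sum_i t i ^+ 2 = \sum_i (sg i * t i) ^+ 2.
  by apply: eq_bigr => i _; rewrite sg2.
apply: symcomb_flat => i y.
have [h1 h2 h3] := ctensor3j_flat (hadm i) (hord i) (hL i) y.
have le : (2 * l1 i).+1%:R^-1 * \sum_b y b ^+ 2 <= (2 * l0).+1%:R^-1 * \sum_b y b ^+ 2.
  apply: ler_wpM2r; first by apply: sumr_ge0 => b _; exact: sqr_ge0.
  by rewrite lef_pV2 ?posrE ?ltr0n// ler_nat ltnS leq_mul2l hl0.
by split; [exact: le_trans h1 le|exact: le_trans h2 le|exact: le_trans h3 le].
Qed.

Lemma bispectrum_cubic t w :
  \sum_i t i * bispectrum_vec w ord0 i = cubic (T t) (fun b => cfam C a b w).
Proof.
rewrite cubic_symcomb; apply: eq_bigr => i _; rewrite mxE.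
rewrite (normalized_bispectrum_tensor ha hC w (hadm i) (hord i) (hL i)) -/(sg i).
by rewrite -/(F i); ring.
Qed.

Let coord i w : bispectrum_vec w ord0 i = cubic (T (fun j => (i == j)%:R)) (fun b => cfam C a b w).
Proof.
rewrite -bispectrum_cubic (bigD1 i) //= eqxx mul1r big1 ?addr0// => j.
by rewrite eq_sym => /negbTE ->; rewrite mul0r.
Qed.

Lemma bispectrum_measurable i : measurable_fun setT (fun w => bispectrum_vec w ord0 i).
Proof.
have [D tD] := @smooth_cubic R _ (T (fun j => (i == j)%:R)) (T12 _) (T23 _).
under eq_fun do rewrite coord.
exact: (tame_measurable tD (gf_meas gf)).
Qed.

Lemma bispectrum_sqr_integrable i :
  P.-integrable setT (EFin \o (fun w => bispectrum_vec w ord0 i ^+ 2)).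
Proof.
have s := @smooth_cubic R _ (T (fun j => (i == j)%:R)) (T12 _) (T23 _).
have := smooth_integrable gf (smooth_exp 2 s).
by apply: eq_integrable => // w _ /=; rewrite coord.
Qed.

Lemma bispectrum_variance i : \int[P]_w (bispectrum_vec w ord0 i ^+ 2) = 1.
Proof.
under eq_Rintegral do rewrite coord.
have := Ex_cubic_sqr gE (T12 (fun j => (i == j)%:R)) (T23 _) (Ttr _); rewrite /gaussE Tgram => ->.
rewrite (bigD1 i) //= eqxx expr1n big1 ?addr0 => [|j]; first by field.
by rewrite eq_sym => /negbTE ->; rewrite expr2 mul0r.
Qed.

(** The bound is of order 1 / sqrt l0; what exceeds k s / (2 l0 + 1) under the root
    only keeps the radicand positive. *)
Lemma bispectrum_cos t th (s := \sum_i t i ^+ 2) :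
  `|\int[P]_w cos (\sum_i t i * bispectrum_vec w ord0 i + th) - expR (- (s / 2)) * cos th|
  <= 18 * s * Num.sqrt (k%:R * (s + 1) * (2 * l0).+1%:R^-1 + (2 * l0).+1%:R^-1).
Proof.
have s0 : 0 <= s by apply: sumr_ge0 => i _; exact: sqr_ge0.
have r0 : 0 < (2 * l0).+1%:R^-1 :> R by rewrite invr_gt0.
have rho0 : 0 < k%:R * (s + 1) * (2 * l0).+1%:R^-1 + (2 * l0).+1%:R^-1.
  by rewrite ltr_wpDl// !mulr_ge0 ?addr_ge0// ltW.
under eq_Rintegral do rewrite bispectrum_cubic.
have := @Ex_cos_cubic _ _ _ gE (T t) (T12 t) (T23 t) (Ttr t) _ rho0 _ th.
rewrite /gaussE Tgram -/s.
rewrite (_ : 3 * (6^-1 * s) = s / 2); last by field.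
rewrite (_ : 108 * (6^-1 * s) = 18 * s); last by field.
apply=> x; apply: (le_trans (Tflat t x)); apply: ler_wpM2r.
  by apply: sumr_ge0 => b _; exact: sqr_ge0.
rewrite -/s -[leLHS]addr0 lerD ?(ltW r0)// ler_wpM2r ?(ltW r0)// ler_wpM2l// lerDl//.
Qed.

Let lP i : [/\ (0 < l1 i <= L)%N, (0 < l2 i <= L)%N & (0 < l3 i <= L)%N].
Proof. by have := hadm i; have := hord i; have := hL i; rewrite /admissible; split; lia. Qed.

Let cratio_sum l w : (0 < l <= L)%N -> cratio C a l w - 1 =
  \sum_(b : cidx L) (2 * l).+1%:R^-1 * (deg b == l)%:R * (cfam C a b w ^+ 2 - 1).
Proof.
move=> hl; rewrite (eq_bigr (fun b => (2 * l).+1%:R^-1 *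
  ((deg b == l)%:R * (gcoef C a l (crd b) w ^+ 2 - 1)))); last first.
  by move=> b _; rewrite -mulrA /cfam; case: eqP => [->|_] //; rewrite !mul0r.
rewrite -mulr_sumr (sum_deg (fun i => gcoef C a l i w ^+ 2 - 1) hl) sumrB mulrBr /cratio.
by rewrite sumr_const card_ord mulVf.
Qed.

Let smooth_dev l : smooth (fun x : cidx L -> R =>
  (\sum_b (2 * l).+1%:R^-1 * (deg b == l)%:R * (x b ^+ 2 - 1)) ^+ 2).
Proof. by smooth_tac. Qed.

Let cratio_integrable l : (0 < l <= L)%N ->
  P.-integrable setT (EFin \o (fun w => (cratio C a l w - 1) ^+ 2)).
Proof.
move=> hl; have := smooth_integrable gf (smooth_dev l).
by apply: eq_integrable => // w _ /=; rewrite cratio_sum.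
Qed.

Let cratio_variance l : (0 < l <= L)%N -> \int[P]_w ((cratio C a l w - 1) ^+ 2) = 2 / (2 * l).+1%:R.
Proof.
move=> hl; under eq_Rintegral do rewrite cratio_sum//.
have := Ex_chi_square gE (fun b => (2 * l).+1%:R^-1 * (deg b == l)%:R); rewrite /gaussE => ->.
congr (_ * _); rewrite (eq_bigr (fun b : cidx L => (deg b == l)%:R * (2 * l).+1%:R^-1 ^+ 2)).
  rewrite (sum_deg (fun=> (2 * l).+1%:R^-1 ^+ 2) hl) sumr_const card_ord -[LHS]mulr_natl.
  by rewrite expr2 mulVKf.
by move=> b _; case: eqP; rewrite ?mulr1 ?mul1r// mulr0 mul0r expr2 mul0r.
Qed.

Lemma cratio_ge0 l w : 0 <= cratio C a l w.
Proof. by rewrite mulr_ge0 ?invr_ge0 ?ler0n// sumr_ge0// => i _; exact: sqr_ge0. Qed.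

Definition estimated_vec w : 'rV[R]_k := \row_i
  (complex.Re (estimated_bispectrum a (l1 i) (l2 i) (l3 i) w)
   / Num.sqrt (Delta (l1 i) (l2 i) (l3 i))%:R).

Let rprod i w := cratio C a (l1 i) w * cratio C a (l2 i) w * cratio C a (l3 i) w.

Lemma estimated_vecE i w :
  estimated_vec w ord0 i = bispectrum_vec w ord0 i / Num.sqrt (rprod i w).
Proof.
have [p1 p2 p3] := lP i; rewrite !mxE (estimated_bispectrumE ha hC); [|lia..].
by rewrite mulrAC.
Qed.

Let rprod_ge0 i w : 0 <= rprod i w.
Proof. by apply: mulr_ge0; [apply: mulr_ge0|]; exact: cratio_ge0. Qed.

Lemma estimated_measurable i : measurable_fun setT (fun w => estimated_vec w ord0 i).
Proof.
have [p1 p2 p3] := lP i.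
under eq_fun => w.
  rewrite estimated_vecE -powR12_sqrt// -powRN.
  over.
apply: measurable_funM; first exact: bispectrum_measurable.
apply: (@measurableT_comp _ _ _ _ _ _ (fun x : R => x `^ (- 2^-1))).
  exact: measurable_powR.
have mr l : (0 < l <= L)%N -> measurable_fun setT (fun w => cratio C a l w).
  move=> hl; apply: measurable_funM => //; apply: measurable_sum => j.
  by apply: measurable_funX; apply: (gcoef_measurable ha); have := ltn_ord j; lia.
by rewrite /rprod; apply: measurable_funM; [apply: measurable_funM|]; exact: mr.
Qed.

Definition spectrum_dev w : R := \sum_i ((cratio C a (l1 i) w - 1) ^+ 2
  + (cratio C a (l2 i) w - 1) ^+ 2 + (cratio C a (l3 i) w - 1) ^+ 2).

Lemma spectrum_dev_ge0 w : 0 <= spectrum_dev w.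
Proof. by apply: sumr_ge0 => i _; rewrite !addr_ge0 ?sqr_ge0. Qed.

Let dev1_integrable i : P.-integrable setT (EFin \o (fun w => (cratio C a (l1 i) w - 1) ^+ 2
  + (cratio C a (l2 i) w - 1) ^+ 2 + (cratio C a (l3 i) w - 1) ^+ 2)).
Proof.
have [p1 p2 p3] := lP i.
have := integrableD measurableT (integrableD measurableT (cratio_integrable p1)
  (cratio_integrable p2)) (cratio_integrable p3).
exact: eq_integrable.
Qed.

Lemma spectrum_dev_integrable : P.-integrable setT (EFin \o spectrum_dev).
Proof. exact: (integrable_sumr (index_enum 'I_k) dev1_integrable). Qed.

(** Each ratio cratio has variance 2 / (2 l + 1). *)
Lemma spectrum_dev_mean : \int[P]_w spectrum_dev w <= 6 * k%:R / (2 * l0).+1%:R.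
Proof.
have -> : \int[P]_w spectrum_dev w = \sum_i (2 / (2 * l1 i).+1%:R + 2 / (2 * l2 i).+1%:R
   + 2 / (2 * l3 i).+1%:R).
  rewrite Rintegral_sum//; apply: eq_bigr => i _; have [p1 p2 p3] := lP i.
  rewrite RintegralD//; [|by have := integrableD measurableT (cratio_integrable p1)
    (cratio_integrable p2); exact: eq_integrable|exact: cratio_integrable].
  by rewrite RintegralD ?cratio_variance//; exact: cratio_integrable.
rewrite (_ : 6 * k%:R / (2 * l0).+1%:R = \sum_(i < k) 6 / (2 * l0).+1%:R); last first.
  by rewrite sumr_const card_ord -mulr_natl; ring.
apply: ler_sum => i _; have := hord i; have := hl0 i => h h'.
have le l : (l0 <= l)%N -> (2 * l).+1%:R^-1 <= (2 * l0).+1%:R^-1 :> R.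
  by move=> hl; rewrite lef_pV2 ?posrE ?ltr0n// ler_nat ltnS leq_mul2l hl.
have h1 := le _ h; have h2 : (2 * l2 i).+1%:R^-1 <= (2 * l0).+1%:R^-1 :> R by apply: le; lia.
have h3 : (2 * l3 i).+1%:R^-1 <= (2 * l0).+1%:R^-1 :> R by apply: le; lia.
have aux (x y z u : R) : x <= u -> y <= u -> z <= u -> 2 * x + 2 * y + 2 * z <= 6 * u by lra.
exact: aux.
Qed.

(** A small spectrum_dev forces all the ratios to be close to 1, and the two
    vectors differ by the inverse square roots of products of three ratios. *)
Lemma estimated_close (M eta e : R) : 0 < M -> 0 < e -> e <= 2^-1 -> 40 * e * M < eta ->
  forall w, (forall i, `|bispectrum_vec w ord0 i| <= M) -> e ^- 2 * spectrum_dev w < 1 ->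
  forall i, `|bispectrum_vec w ord0 i - estimated_vec w ord0 i| < eta.
Proof.
move=> M0 e0 e2 heta w hM; rewrite mulrC ltr_pdivrMr ?exprn_gt0// mul1r => hd i.
have hi : (cratio C a (l1 i) w - 1) ^+ 2 + (cratio C a (l2 i) w - 1) ^+ 2
    + (cratio C a (l3 i) w - 1) ^+ 2 < e ^+ 2.
  apply: le_lt_trans hd; rewrite /spectrum_dev (bigD1 i) //= lerDl sumr_ge0// => j _.
  by rewrite !addr_ge0 ?sqr_ge0.
have sq (x y z : R) : 0 <= y -> 0 <= z -> x ^+ 2 + y + z < e ^+ 2 -> `|x| <= e.
  move=> y0 z0 h; rewrite -(@ler_pXn2r _ 2)// ?nnegrE ?normr_ge0 ?(ltW e0)//.
  by rewrite -normrX ger0_norm ?sqr_ge0//; lra.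
have h1 : `|cratio C a (l1 i) w - 1| <= e by apply: sq hi; exact: sqr_ge0.
have h2 : `|cratio C a (l2 i) w - 1| <= e.
  by apply: (@sq _ ((cratio C a (l1 i) w - 1) ^+ 2) ((cratio C a (l3 i) w - 1) ^+ 2));
    rewrite ?sqr_ge0//; lra.
have h3 : `|cratio C a (l3 i) w - 1| <= e.
  by apply: (@sq _ ((cratio C a (l1 i) w - 1) ^+ 2) ((cratio C a (l2 i) w - 1) ^+ 2));
    rewrite ?sqr_ge0//; lra.
rewrite estimated_vecE (_ : _ - _ = bispectrum_vec w ord0 i * (1 - (Num.sqrt (rprod i w))^-1)).
  rewrite normrM; apply: le_lt_trans heta; rewrite mulrC.
  by apply: ler_pM => //; exact: inv_sqrt_dev.
by rewrite mulrBr mulr1.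
Qed.

End BispectrumLimit.

(** * The central limit theorem *)

Section CentralLimit.
Context d (Omega : measurableType d) (R : realType) (P : probability Omega R).
Variables (C : nat -> R) (a : nat -> int -> Omega -> R[i]).
Hypothesis ha : gaussian_coefs P C a.
Hypothesis hC : forall l, (0 < l)%N -> 0 < C l.
Variables (k : nat) (l1 l2 l3 : nat -> 'I_k -> nat) (l0 : nat -> nat).
Hypothesis hadm : forall n i, admissible (l1 n i) (l2 n i) (l3 n i).
Hypothesis hord : forall n i, (l1 n i <= l2 n i <= l3 n i)%N.
Hypothesis hdist : forall n, injective (fun i : 'I_k => (l1 n i, l2 n i, l3 n i)).
Hypothesis hl0 : forall n i, (l0 n <= l1 n i)%N.
Hypothesis l0_cvg : l0 n @[n --> \oo] --> \oo.

Let X n := bispectrum_vec C a (l1 n) (l2 n) (l3 n).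
Let Y n := estimated_vec a (l1 n) (l2 n) (l3 n).
Let Z (t : k.-tuple R) : 'rV[R]_k := \row_i tnth t i.
Let u n : R := (2 * l0 n).+1%:R^-1.

Let u_cvg : u n @[n --> \oo] --> 0.
Proof.
apply/cvgrPdist_le => e e0; near=> n.
rewrite sub0r normrN ger0_norm ?invr_ge0// invf_ple ?posrE//.
apply: (@le_trans _ _ (Num.truncn e^-1).+1%:R); first by rewrite ltW// truncnS_gt.
rewrite ler_nat ltnS; apply: (@leq_trans (l0 n)); last by lia.
by near: n; exact: ((cvgnyPge l0).1 l0_cvg).
Unshelve. all: by end_near. Qed.

Let mX n i : measurable_fun setT (fun w => X n w ord0 i).
Proof. exact: (bispectrum_measurable ha hC (hadm n) (hord n)). Qed.

Let iX n i : P.-integrable setT (EFin \o (fun w => X n w ord0 i ^+ 2)).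
Proof. exact: (bispectrum_sqr_integrable ha hC (hadm n) (hord n)). Qed.

Let KX n i : \int[P]_w (X n w ord0 i ^+ 2) <= 1.
Proof. by rewrite (bispectrum_variance ha hC (hadm n) (hord n) (@hdist n)). Qed.

Let mY n i : measurable_fun setT (fun w => Y n w ord0 i).
Proof. exact: (estimated_measurable ha hC (hadm n) (hord n)). Qed.

Let gZ := std_normal_family (R := R) k.
Let gEZ := gauss_family_expectation gZ.

Let mZ i : measurable_fun setT (fun t => Z t ord0 i).
Proof. by under eq_fun do rewrite mxE; exact: measurable_tnth. Qed.

Let iZ i : (std_normal k).-integrable setT (EFin \o (fun t => Z t ord0 i ^+ 2)).
Proof.
have := smooth_integrable gZ (smooth_exp 2 (smooth_var i)).
by apply: eq_integrable => // t _ /=; rewrite mxE.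
Qed.

Let KZ i : \int[std_normal k]_t (Z t ord0 i ^+ 2) <= 1.
Proof.
under eq_Rintegral do rewrite mxE.
by have := Ex_var_sqr gEZ i; rewrite /gaussE => ->.
Qed.

Let cos_cvg (t : 'I_k -> R) th : \int[P]_w cos (\sum_i t i * X n w ord0 i + th)
  @[n --> \oo] --> \int[std_normal k]_z cos (\sum_i t i * Z z ord0 i + th).
Proof.
have -> : \int[std_normal k]_z cos (\sum_i t i * Z z ord0 i + th) =
    expR (- ((\sum_i t i ^+ 2) / 2)) * cos th.
  rewrite -(Ex_cos_linear gEZ); apply: eq_Rintegral => z _.
  by congr (cos (_ + _)); apply: eq_bigr => i _; rewrite mxE.
set s := \sum_i t i ^+ 2.
have bnd : 18 * s * Num.sqrt (k%:R * (s + 1) * u n + u n) @[n --> \oo] --> 0.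
  rewrite -[0](mulr0 (18 * s)); apply: cvgMr; rewrite -[0](@sqrtr0 R).
  apply: continuous_cvg; first exact: sqrt_continuous.
  rewrite -[0](addr0 (0 : R)); apply: cvgD => //.
  by rewrite -[0](mulr0 (k%:R * (s + 1))); apply: cvgMr.
apply/cvgrPdist_le => e e0; have /cvgrPdist_le /(_ e e0) h := bnd.
near=> n; rewrite distrC.
apply: (le_trans (bispectrum_cos ha hC (hadm n) (hord n) (@hdist n) (hl0 n) t th)).
have : `|0 - 18 * s * Num.sqrt (k%:R * (s + 1) * u n + u n)| <= e by near: n.
by rewrite sub0r normrN; apply: le_trans; exact: ler_norm.
Unshelve. all: by end_near. Qed.

(** The hypothesis of slutsky, with D a multiple of spectrum_dev. *)
Let close (M eta : R) : 0 < M -> 0 < eta -> exists D : nat -> Omega -> R,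
  [/\ forall n w, 0 <= D n w, forall n, P.-integrable setT (EFin \o D n),
      \int[P]_w D n w @[n --> \oo] --> 0 &
      forall n w, (forall i, `|X n w ord0 i| <= M) -> D n w < 1 ->
        forall i, `|X n w ord0 i - Y n w ord0 i| < eta].
Proof.
(* e is at most 1/2 and satisfies 40 e M < eta, as estimated_close requires *)
move=> M0 eta0; pose e := eta / (80 * M + 2 * eta).
have den0 : 0 < 80 * M + 2 * eta by lra.
have e0 : 0 < e by rewrite divr_gt0.
have e2 : e <= 2^-1 by rewrite ler_pdivrMr//; lra.
have heta : 40 * e * M < eta.
  rewrite (_ : 40 * e * M = eta * (40 * M) / (80 * M + 2 * eta)); last by rewrite /e; ring.
  by rewrite ltr_pdivrMr//; nra.
pose D n w := e ^- 2 * spectrum_dev C a (l1 n) (l2 n) (l3 n) w.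
have ie0 : 0 <= e ^- 2 by rewrite invr_ge0 exprn_ge0// ltW.
have iS n := spectrum_dev_integrable ha hC (hadm n) (hord n).
exists D; split.
- by move=> n w; rewrite mulr_ge0// spectrum_dev_ge0.
- by move=> n; have := integrableZl measurableT (e ^- 2) (iS n); apply: eq_integrable.
- have b : e ^- 2 * (6 * k%:R * u n) @[n --> \oo] --> 0.
    rewrite -[0](mulr0 (e ^- 2)); apply: cvgMr; rewrite -[0](mulr0 (6 * k%:R)).
    exact: cvgMr.
  apply: (squeeze_cvgr _ (cvg_cst 0) b); near=> n; rewrite RintegralZl//.
  apply/andP; split.
    by apply: mulr_ge0 => //; apply: Rintegral_ge0 => w _; exact: spectrum_dev_ge0.
  rewrite ler_wpM2l//.
  exact: (spectrum_dev_mean ha hC (hadm n) (hord n) (hl0 n)).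
- by move=> n w hM hD; exact: (estimated_close ha hC (hadm n) (hord n) M0 e0 e2 heta hM hD).
Unshelve. all: by end_near. Qed.

Lemma Rintegral_cvg_in_distribution (W : nat -> Omega -> 'rV[R]_k) :
  (forall n i, measurable_fun setT (fun w => W n w ord0 i)) ->
  (forall f (B : R), continuous f -> (forall x, `|f x| <= B) ->
    \int[P]_w f (W n w) @[n --> \oo] --> \int[std_normal k]_z f (Z z)) ->
  cvg_in_distribution P W (std_normal k).
Proof.
move=> mW h f cf [B fB].
have bf d' (T : measurableType d') (Q : probability T R) (V : T -> 'rV[R]_k) :
    (forall i, measurable_fun setT (fun w => V w ord0 i)) ->
    (\int[Q]_w (f (V w))%:E)%E = (\int[Q]_w f (V w))%:E.
  move=> mV; apply: EFin_Rintegral; apply: (@bounded_integrable _ _ _ Q _ B) => //.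
  exact: (bounded_continuous_measurable mV cf fB).
rewrite (bf _ _ _ Z mZ); under eq_fun do rewrite bf//.
by apply: cvg_EFin; [near=> n|exact: h].
Unshelve. all: by end_near. Qed.

Lemma bispectrum_clt : cvg_in_distribution P X (std_normal k).
Proof.
apply: (Rintegral_cvg_in_distribution mX) => f B.
exact: (levy_continuity mX iX KX mZ iZ KZ cos_cvg).
Qed.

Lemma estimated_bispectrum_clt : cvg_in_distribution P Y (std_normal k).
Proof.
apply: (Rintegral_cvg_in_distribution mY) => f B cf fB.
have h1 := levy_continuity mX iX KX mZ iZ KZ cos_cvg cf fB.
have h2 := slutsky mX iX KX mY close cf fB.
rewrite -[X in _ --> X]subr0.
rewrite (_ : (fun n => _) = (fun n => \int[P]_w f (X n w) -
   (\int[P]_w f (X n w) - \int[P]_w f (Y n w)))); first exact: cvgB.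
by apply/funext => n; rewrite opprB addrC subrK.
Qed.

End CentralLimit.

Unset Implicit Arguments.

Theorem theorem3p3 (R : realType) (d : measure_display)
  (Omega : measurableType d) (P : probability Omega R)
  (T : 'rV[R]_3 -> Omega -> R) (C : nat -> R)
  (hT : isotropic_gaussian_field P T)
  (hspec : spectral_representation P T)
  (hcoef : gaussian_coefs P C (harmonic_coef T))
  (hC : forall l : nat, (0 < l)%N -> 0 < C l)
  (k : nat) (hk : (0 < k)%N)
  (l1 l2 l3 : nat -> 'I_k -> nat)
  (hadm : forall n i, admissible (l1 n i) (l2 n i) (l3 n i))
  (hord : forall n i, (l1 n i <= l2 n i <= l3 n i)%N)
  (hmono : forall n (i j : 'I_k), (i <= j)%N -> (l1 n i <= l1 n j)%N)
  (hdist : forall n, injective (fun i : 'I_k => (l1 n i, l2 n i, l3 n i)))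
  (hlim : l1 n (Ordinal hk) @[n --> \oo] --> \oo) :
  cvg_in_distribution P
    (fun n w => \row_i
      (complex.Re (normalized_bispectrum (harmonic_coef T) C
                     (l1 n i) (l2 n i) (l3 n i) w)
       / Num.sqrt (Delta (l1 n i) (l2 n i) (l3 n i))%:R))
    (std_normal k)
  /\
  cvg_in_distribution P
    (fun n w => \row_i
      (complex.Re (estimated_bispectrum (harmonic_coef T)
                     (l1 n i) (l2 n i) (l3 n i) w)
       / Num.sqrt (Delta (l1 n i) (l2 n i) (l3 n i))%:R))
    (std_normal k).
Proof.
have hl n i : (l1 n (Ordinal hk) <= l1 n i)%N by apply: hmono.
split.
  exact: (bispectrum_clt hcoef hC hadm hord hdist hl hlim).
exact: (estimated_bispectrum_clt hcoef hC hadm hord hdist hl hlim).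
Qed.
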